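(* Assume that $\rho$ satisfies: $\rho\in H^2(0,\pi)$, $0<\rho(x)\le\beta_0$ for all $x\in[0,\pi]$ (for some constant $\beta_0$), and $\rho_0=\operatorname{ess\,inf}\eta_\rho>0$. Let $0<p<1$, let the boundary conditions be of Dirichlet–Neumann type, i.e. either $\alpha_1>0,\ \beta_1=0,\ \alpha_2=0,\ \beta_2>0$, or $\alpha_1=0,\ \beta_1>0,\ \alpha_2>0,\ \beta_2=0$, and let $\mu$ be a real constant with $\mu\notin\Lambda(L)$ and $\mu>\rho_1$, where $\rho_1=\frac{2}{\pi}\int_0^\pi\eta_\rho(x)\,dx$. Then the problem $$\rho(x)u_{tt}-(\rho(x)u_x)_x=\mu\rho(x)u+\rho(x)|u|^{p-1}u,\quad (t,x)\in\Omega,$$ $$a_1u(t,0)+b_1u_x(t,0)=0,\quad a_2u(t,\pi)+b_2u_x(t,\pi)=0,\quad t\in(0,T),$$ $$u(0,x)=u(T,x),\quad u_t(0,x)=u_t(T,x),\quad x\in(0,\pi),$$ has infinitely many periodic weak solutions $u_l$ satisfying $$\int_\Omega|u_l|^{p+1}\rho\,dt\,dx\to0\quad\text{as } l\to\infty.$$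
   Context: $T=2\pi a/b$ with $a,b$ relatively prime positive integers; $\Omega=(0,T)\times(0,\pi)$; $a_i,b_i\in\mathbb R$ with $a_i^2+b_i^2\ne0$ for $i=1,2$. Unknown functions $u$ are real-valued. $\eta_\rho=\frac12\frac{\rho''}{\rho}-\frac14\left(\frac{\rho'}{\rho}\right)^2$. Also $\alpha_1=a_1-\frac{b_1}{2}\frac{\rho'(0)}{\rho(0)}$, $\alpha_2=a_2-\frac{b_2}{2}\frac{\rho'(\pi)}{\rho(\pi)}$, $\beta_1=-b_1$, $\beta_2=b_2$. For $r\ge1$, $L^r(\Omega)$ is the space of $u$ with $\|u\|_{L^r(\Omega)}^r=\int_\Omega|u|^r\rho\,dt\,dx<\infty$. $\Psi$ is the set of functions $\psi$ that are $C^\infty$ on $\Omega$ up to the boundary and satisfy $a_1\psi(t,0)+b_1\psi_x(t,0)=0$, $a_2\psi(t,\pi)+b_2\psi_x(t,\pi)=0$, $\psi(0,x)=\psi(T,x)$, $\psi_t(0,x)=\psi_t(T,x)$. A function $u\in L^r(\Omega)$ is a weak solution of the problem if $\int_\Omega u(\rho\psi_{tt}-(\rho\psi_x)_x)\,dt\,dx-\int_\Omega(\mu u+|u|^{p-1}u)\psi\rho\,dt\,dx=0$ for all $\psi\in\Psi$. Let $\lambda_k^2$ be the eigenvalues (listed increasingly) of the Sturm–Liouville problem $-(\rho\varphi')'=\lambda^2\rho\varphi$ on $(0,\pi)$, $a_1\varphi(0)+b_1\varphi'(0)=0$, $a_2\varphi(\pi)+b_2\varphi'(\pi)=0$, and let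 $\nu_j=2\pi j/T$, $j\in\mathbb Z$. Then $\Lambda(L)$ denotes the set of all numbers $\lambda_{jk}=\lambda_k^2-\nu_j^2$; these are the eigenvalues of the wave operator $L$ (the self-adjoint extension to $L^2(\Omega)$ of $\psi\mapsto\rho^{-1}(\rho\psi_{tt}-(\rho\psi_x)_x)$, $\psi\in\Psi$). *)

(* Defs.v *)
From HB Require Import structures.
From mathcomp Require Import all_boot all_order all_algebra.
From mathcomp Require Import all_classical all_reals all_analysis.
From mathcomp Require Import ess_sup_inf.

Set Implicit Arguments.
Unset Strict Implicit.
Unset Printing Implicit Defensive.

Import Order.TTheory GRing.Theory Num.Theory.
Import numFieldNormedType.Exports.

Local Open Scope classical_set_scope.
Local Open Scope ring_scope.

Definition test_fun {R : realType} (a b : R) (phi : R -> R) : Prop :=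
  (forall (n : nat) (x : R), derivable (derive1n n phi) x 1) /\
  (exists c d : R, [/\ a < c, d < b &
     forall x : R, x \notin `[c, d] -> phi x = 0]).

Definition L2 {R : realType} (a b : R) (f : R -> R) : Prop :=
  measurable_fun `]a, b[ f /\
  (\int[lebesgue_measure]_(x in `]a, b[) ((f x ^+ 2)%:E) < +oo)%E.

Definition weak_derivative {R : realType} (a b : R) (f g : R -> R) : Prop :=
  forall phi : R -> R, test_fun a b phi ->
    (\int[lebesgue_measure]_(x in `]a, b[) (f x * derive1 phi x) =
     - \int[lebesgue_measure]_(x in `]a, b[) (g x * phi x))%R.

(* f is in H^2(a, b), with weak derivatives df and ddf.  As usual in dimension
   one, f and df are the representatives that are continuous on [a, b], so that
   f and f' have values at every point, endpoints included. *)
Definition sobolev_H2 {R : realType} (a b : R) (f df ddf : R -> R) : Prop :=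
  [/\ [/\ L2 a b f, L2 a b df & L2 a b ddf],
      weak_derivative a b f df, weak_derivative a b df ddf,
      {within `[a, b], continuous f} & {within `[a, b], continuous df}].

Definition eta {R : realType} (rho drho ddrho : R -> R) (x : R) : R :=
  2^-1 * (ddrho x / rho x) - 4^-1 * (drho x / rho x) ^+ 2.

Definition ess_inf_eta {R : realType} (rho drho ddrho : R -> R) : \bar R :=
  ess_inf (mrestr lebesgue_measure (measurable_itv `](0 : R), pi[))
    (EFin \o eta rho drho ddrho).

Definition eta_average {R : realType} (rho drho ddrho : R -> R) : R :=
  2 / pi * \int[lebesgue_measure]_(x in `](0 : R), pi[) eta rho drho ddrho x.

Definition alpha1 {R : realType} (a1 b1 : R) (rho drho : R -> R) : R :=
  a1 - b1 / 2 * (drho 0 / rho 0).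
Definition alpha2 {R : realType} (a2 b2 : R) (rho drho : R -> R) : R :=
  a2 - b2 / 2 * (drho pi / rho pi).
Definition beta1 {R : realType} (b1 : R) : R := - b1.
Definition beta2 {R : realType} (b2 : R) : R := b2.

(* phi is C^1 on [0, pi] with derivative dphi, the endpoint values dphi 0 and
   dphi pi being the one-sided derivatives; since rho is C^1 on [0, pi] and the
   right-hand side is continuous, the equation holds in the classical sense. *)
Definition SL_eigenvalue {R : realType} (rho : R -> R) (a1 b1 a2 b2 : R)
    (kappa : R) : Prop :=
  exists phi dphi : R -> R,
    [/\ {within `[0, pi], continuous phi} /\ {within `[0, pi], continuous dphi},
        forall x : R, x \in `]0, pi[ ->
          is_derive x 1 phi (dphi x) /\
          is_derive x 1 (fun y => rho y * dphi y) (- (kappa * rho x * phi x)),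
        a1 * phi 0 + b1 * dphi 0 = 0,
        a2 * phi pi + b2 * dphi pi = 0 &
        exists2 x : R, x \in `[0, pi] & phi x != 0].

Definition Lambda {R : realType} (T : R) (rho : R -> R) (a1 b1 a2 b2 : R) :
    set R :=
  [set lam | exists (kappa : R) (j : int),
     SL_eigenvalue rho a1 b1 a2 b2 kappa /\
     lam = kappa - (2 * pi * j%:~R / T) ^+ 2].

Definition Omega {R : realType} (T : R) : set (R * R) :=
  `]0, T[ `*` `]0, pi[.
Definition Omega_bar {R : realType} (T : R) : set (R * R) :=
  `[0, T] `*` `[0, pi].

Definition leb2 {R : realType} :
    {measure set (measurableTypeR R * measurableTypeR R) -> \bar R} :=
  (@lebesgue_measure R \x @lebesgue_measure R)%E.

Definition weighted_Lr {R : realType} (T : R) (rho : R -> R) (r : R)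
    (u : R * R -> R) : Prop :=
  measurable_fun (Omega T : set (measurableTypeR R * measurableTypeR R)) u /\
  (\int[leb2]_(z in Omega T) ((`|u z| `^ r * rho z.2)%:E) < +oo)%E.

(* D i j is the continuous extension to the closed rectangle of the partial
   derivative d_t^i d_x^j psi. *)
Definition smooth_jet {R : realType} (T : R) (psi : R * R -> R)
    (D : nat -> nat -> R * R -> R) : Prop :=
  [/\ forall z, Omega_bar T z -> D 0%N 0%N z = psi z,
      forall i j : nat, {within Omega_bar T, continuous (D i j)} &
      forall (i j : nat) (t x : R), Omega T (t, x) ->
        is_derive t 1 (fun s => D i j (s, x)) (D i.+1 j (t, x)) /\
        is_derive x 1 (fun y => D i j (t, y)) (D i j.+1 (t, x))].

Definition Psi {R : realType} (T a1 b1 a2 b2 : R) : set (R * R -> R) :=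
  [set psi | exists D : nat -> nat -> R * R -> R,
    [/\ smooth_jet T psi D,
        forall t : R, t \in `[0, T] ->
          a1 * psi (t, 0) + b1 * D 0%N 1%N (t, 0) = 0 /\
          a2 * psi (t, pi) + b2 * D 0%N 1%N (t, pi) = 0 &
        forall x : R, x \in `[0, pi] ->
          psi (0, x) = psi (T, x) /\ D 1%N 0%N (0, x) = D 1%N 0%N (T, x)]].

(* rho psi_tt - (rho psi_x)_x; only used at points of the open set Omega. *)
Definition wave_op {R : realType} (rho : R -> R) (psi : R * R -> R)
    (z : R * R) : R :=
  rho z.2 * derive1n 2 (fun s : R => psi (s, z.2)) z.1 -
  derive1 (fun y : R => rho y * derive1 (fun w : R => psi (z.1, w)) y) z.2.

Definition weak_solution {R : realType} (T : R) (rho : R -> R)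
    (a1 b1 a2 b2 mu p r : R) (u : R * R -> R) : Prop :=
  weighted_Lr T rho r u /\
  forall psi : R * R -> R, Psi T a1 b1 a2 b2 psi ->
    \int[leb2]_(z in Omega T) (u z * wave_op rho psi z) -
    \int[leb2]_(z in Omega T)
      ((mu * u z + `|u z| `^ (p - 1) * u z) * psi z * rho z.2) = 0.

(* Main.v *)
Require Import Defs.
From mathcomp Require Import all_boot all_order all_algebra.
From mathcomp Require Import all_classical all_reals all_analysis.
From mathcomp Require Import measurable_realfun ess_sup_inf ring lra.
Import Order.TTheory GRing.Theory Num.Theory.
Import numFieldNormedType.Exports.
Local Open Scope classical_set_scope.
Local Open Scope ring_scope.

(** The solutions constructed here do not depend on [t]: [u_l (t, x) = v_l x], where
    [v_l] solves the two-point problem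
      [- (rho v')' = rho * (mu * v + |v|^(p-1) * v)]
    with the given boundary conditions. A function of [x] alone is periodic in [t],
    so the wave equation reduces to an ordinary differential equation, and infinitely
    many small solutions exist because the nonlinearity is sublinear: since [p < 1],
    the restoring force divided by [v] tends to infinity at [v = 0], so solutions of
    smaller amplitude oscillate faster. Starting at the Dirichlet end with smaller and
    smaller initial slope, the solution makes more and more half-turns before it
    reaches the other end; between an initial slope for which it arrives there after
    exactly [j] half-turns and one for which it arrives after [j + 1], there is one
    for which it satisfies the boundary condition. The coefficient [mu] is positive
    since it exceeds twice the average of the function [eta], which is positive almost
    everywhere ([eta_average_ge0]).

    The nonlinearity is not Lipschitz at [0], so that the Cauchy problem and its
    continuous dependence on the data are not covered by Picard's theorem. They are
    recovered by a change of variables. With the energy coordinate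
    [y = sgn v * sqrt (2 F v)], [F] a primitive of the nonlinearity, and the flux
    [z = rho v'], orbits turn around the origin of the plane [(y, z)]; in polar
    coordinates, taking the angle as independent variable, the position [x] and the
    logarithm of the radius solve a system with bounded and globally Lipschitz
    right-hand side ([slope_log_lipschitz], [prufer_lipschitz], [prufer_flow]). The
    solution is monotone in the angle, and [is_derive_reparam] converts it back into
    a function of [x].

    The quantity [y^2 + (z / rho)^2] changes at most by a bounded factor
    while [x] runs through the interval. It follows that every orbit arrives at the
    right end, at an angle which depends continuously on the initial radius and
    tends to infinity as this radius tends to [0], and that small initial data give
    small solutions. The intermediate value theorem then provides arbitrarily small
    initial radii for which the Robin condition holds ([shooting_parameter],
    [shooting_solution]). The two arrangements of the boundary conditions are
    exchanged by reflection ([small_stationary]).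

    The weight [rho] is given by weak derivatives; by the du Bois-Reymond lemma its
    continuous representative has the continuous function [drho] as classical
    derivative ([weak_derivative_is_derive]). A classical stationary solution is a
    weak one ([stationary_weak_form]): by Fubini's theorem, the terms with [psi_tt]
    integrate to zero in [t] by periodicity, and the others in [x] by Green's
    identity. Finally the solutions are chosen with strictly decreasing norms
    tending to [0] ([weak_solution_sequence]), which makes them pairwise different
    ([ae_eq_weighted_norm]). *)

Set Implicit Arguments.
Unset Strict Implicit.
Unset Printing Implicit Defensive.

(** * Antiderivatives and monotonicity *)

Lemma is_derive1_continuous (R : realType) (f : R -> R) (x l : R) :
  is_derive x 1 f l -> {for x, continuous f}.
Proof. by move=> [df _]; exact/differentiable_continuous/derivable1_diffP. Qed.

Lemma is_derive_derive1 (R : realType) (f : R -> R) (x l : R) :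
  is_derive x 1 f l -> derive1 f x = l.
Proof. by move=> d; rewrite derive1E derive_val. Qed.

Lemma is_derive_near_eq (R : realType) (f g : R -> R) (x l : R) :
  (\near x, f x = g x) -> is_derive x 1 f l -> is_derive x 1 g l.
Proof. by move=> fg df; exact: near_eq_is_derive fg df. Qed.

Lemma derive_ge0_le (R : realType) (f df : R -> R) (a b : R) : a <= b ->
  {within `[a, b], continuous f} ->
  (forall x : R, x \in `]a, b[ -> is_derive x 1 f (df x)) ->
  (forall x, x \in `]a, b[ -> 0 <= df x) -> f a <= f b.
Proof.
move=> ab cf d p; move: ab; rewrite le_eqVlt => /predU1P[->//|ab].
have [c cab e] := MVT ab d cf.
by rewrite -subr_ge0 e mulr_ge0 ?p// subr_ge0 ltW.
Qed.

(** On the whole line there is no privileged left endpoint at which to start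
    integrating; the primitive is glued from the integrals over
    [[-|x| - 1, x]], normalised to vanish at [0]. *)
Lemma antiderivative (R : realType) (f : R -> R) : continuous f ->
  exists2 P : R -> R, P 0 = 0 & forall x : R, is_derive x 1 P (f x).
Proof.
move=> cf; pose mu := @lebesgue_measure R.
have icf (a b : R) : mu.-integrable `[a, b] (EFin \o f).
  apply: continuous_compact_integrable; first exact: segment_compact.
  exact: continuous_subspaceT.
pose I (a x : R) : R := (\int[mu]_(t in `[a, x]) f t)%R.
have IB (c a x : R) : c <= a -> a <= x -> I c x = I c a + I a x.
  move=> ca ax; apply/eqP; rewrite addrC -subr_eq; apply/eqP.
  rewrite /I Rintegral_itvB ?bnd_simp//.
  rewrite Rintegral_itv_obnd_cbnd//.
  by apply: integrableS (icf a x) => //; exact: subset_itv_oc_cc.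
pose m (x : R) : R := - `|x| - 1.
have indep (x c a : R) : c <= a -> a <= x -> a <= 0 -> I c x - I c 0 = I a x - I a 0.
  move=> ca ax a0; rewrite (IB c a x)// (IB c a 0)//; ring.
exists (fun x => I (m x) x - I (m x) 0); first by rewrite subrr.
move=> x.
pose a : R := - `|x| - 2.
have ax : a < x by rewrite /a; have := ler_norm (- x); rewrite normrN; lra.
have xx1 : x < x + 1 by rewrite ltrDl.
have [d1 d2] := continuous_FTC1_closed xx1 (icf _ _) ax (cf x).
have d : is_derive x 1 (fun y => I a y - I a 0) (f x).
  have d3 : is_derive x 1 (I a) (f x).
    by rewrite -{}d2 derive1E; exact: derivableP.
  by apply: is_derive_eq; rewrite subr0.
apply: is_derive_near_eq d; near=> y.
have yx : `|y - x| < 1.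
  by rewrite distrC; near: y; exact: (nbhsx_ballx x 1 ltr01).
have h1 : `|y| <= `|x| + 1.
  by rewrite -lerBlDl (le_trans (lerB_dist _ _))// ltW.
apply: indep; rewrite /a/m; have := normr_ge0 y; have := ler_norm (- y); rewrite normrN; lra.
Unshelve. all: by end_near.
Qed.

(** * The Cauchy problem for planar Lipschitz systems *)

Lemma le_add_geometric (R : realType) (a b C : R) :
  (forall n : nat, a <= b + C / 2 ^+ n) -> a <= b.
Proof.
move=> H; apply/ler_addgt0Pr => e e0.
have [n ne] : exists n : nat, C < e * 2 ^+ n.
  have [n Cn] : exists n : nat, C / e < n%:R.
    exists (Num.Def.truncn `|C / e|).+1.
    by apply: le_lt_trans (ler_norm _) _; rewrite truncnS_gt.
  exists n; rewrite mulrC -ltr_pdivrMr// (lt_le_trans Cn)//.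
  by rewrite -natrX ler_nat ltnW// ltn_expl.
apply: le_trans (H n) _; rewrite lerD2l ler_pdivrMr ?exprn_gt0//.
exact: ltW.
Qed.

(** The intervals of radius [2 C / 2^n] around [u n] are nested, so the supremum
    of their left endpoints lies in all of them. *)
Lemma geometric_limit (R : realType) (u : nat -> R) (C : R) :
  (forall n, `|u n.+1 - u n| <= C / 2 ^+ n) ->
  exists l, forall n, `|l - u n| <= 2 * C / 2 ^+ n.
Proof.
move=> H.
have half n : C / 2 ^+ n.+1 = C / 2 ^+ n / 2 by rewrite exprS invfM mulrA mulrAC.
pose lo n := u n - 2 * C / 2 ^+ n; pose hi n := u n + 2 * C / 2 ^+ n.
have C2 n : 2 * C / 2 ^+ n = 2 * (C / 2 ^+ n) by rewrite mulrA.
have loS n : lo n <= lo n.+1.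
  by rewrite /lo !C2 half; have := H n; rewrite ler_distl; lra.
have hiS n : hi n.+1 <= hi n.
  by rewrite /hi !C2 half; have := H n; rewrite ler_distl; lra.
have lohi n : lo n <= hi n.
  by rewrite /lo/hi C2; have := H n; have := normr_ge0 (u n.+1 - u n); lra.
have lom m n : (m <= n)%N -> lo m <= lo n.
  move=> /subnK <-; elim: (n - m)%N => [|k IH]; first by rewrite add0n.
  exact: le_trans IH (loS _).
have him m n : (m <= n)%N -> hi n <= hi m.
  move=> /subnK <-; elim: (n - m)%N => [|k IH]; first by rewrite add0n.
  exact: le_trans (hiS _) IH.
have lh m n : lo m <= hi n.
  have [mn|/ltnW nm] := leqP m n; first exact: le_trans (lom _ _ mn) (lohi _).
  exact: le_trans (lohi _) (him _ _ nm).
have ub n : ubound (range lo) (hi n) by move=> _ [m _ <-]; exact: lh.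
exists (sup (range lo)) => n; rewrite ler_distl; apply/andP; split.
  rewrite lerBlDr -lerBlDr; apply: ub_le_sup; first by exists (hi 0%N); exact: ub.
  by exists n.
apply: ge_sup; last exact: ub.
by exists (lo 0%N); exists 0%N.
Qed.

Lemma lipschitz_continuous (R : realType) (f : R -> R) (M : R) :
  (forall x y, `|f x - f y| <= M * `|x - y|) -> continuous f.
Proof.
move=> H x; apply/cvgrPdist_le => e e0; near=> y.
apply: le_trans (H _ _) _.
have M1 : 0 < `|M| + 1 by have := normr_ge0 M; lra.
apply: (@le_trans _ _ ((`|M| + 1) * `|x - y|)).
  by apply: ler_wpM2r => //; have := ler_norm M; lra.
rewrite mulrC -ler_pdivlMr//; near: y.
by apply: (@cvgr_dist_le _ _ _ _ _ id x) => //; rewrite divr_gt0.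
Unshelve. all: by end_near. Qed.

Lemma derive_le_dist (R : realType) (f df : R -> R) (M : R) :
  (forall x : R, is_derive x 1 f (df x)) -> (forall x, `|df x| <= M) ->
  forall x y, `|f x - f y| <= M * `|x - y|.
Proof.
move=> d b.
suff H x y : x <= y -> `|f y - f x| <= M * `|y - x|.
  move=> x y; have [xy|/ltW xy] := leP x y; last exact: H.
  by rewrite distrC (distrC x); exact: H.
move=> xy; have [|c _ ->] := MVT_segment xy (fun x _ => d x).
  by apply: continuous_subspaceT => z; exact: is_derive1_continuous.
by rewrite normrM ler_wpM2r.
Qed.

(** Comparison of increments: both [W + D] and [W - D] are nondecreasing. *)
Lemma derive_dominated_itv (R : realType) (D dD W dW : R -> R) (a b : R) :
  a <= b ->
  (forall x : R, is_derive x 1 D (dD x)) ->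
  (forall x : R, is_derive x 1 W (dW x)) ->
  (forall x, a < x < b -> `|dD x| <= dW x) -> `|D b - D a| <= W b - W a.
Proof.
move=> ab dDP dWP le.
have mono (s : R) : `|s| = 1 -> W a + s * D a <= W b + s * D b.
  move=> s1.
  have dx (z : R) : is_derive z 1 (fun t => W t + s * D t) (dW z + s * dD z).
    by apply: is_derive_eq; rewrite /GRing.scale /=; ring.
  apply: (derive_ge0_le ab _ (fun z _ => dx z)) => [|z zab].
    by apply: continuous_subspaceT => z; exact: is_derive1_continuous.
  have := le z; rewrite in_itv /= in zab => /(_ zab).
  have : `|s * dD z| <= `|dD z| by rewrite normrM s1 mul1r.
  by have := ler_norm (- (s * dD z)); rewrite normrN; lra.
have := mono 1 (normr1 _); have := mono (-1) (normrN1 _).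
by rewrite ler_norml; lra.
Qed.

Lemma derive_dominated (R : realType) (D dD W dW : R -> R) :
  (forall x : R, is_derive x 1 D (dD x)) ->
  (forall x : R, is_derive x 1 W (dW x)) ->
  (forall x, `|dD x| <= dW x) -> D 0 = 0 -> W 0 = 0 ->
  forall x, `|D x| <= `|W x|.
Proof.
move=> dDP dWP b D0 W0 x; have [x0|/ltW x0] := leP 0 x.
- have := derive_dominated_itv x0 dDP dWP (fun u _ => b u).
  by rewrite W0 D0 !subr0 => /le_trans; apply; exact: ler_norm.
- have := derive_dominated_itv x0 dDP dWP (fun u _ => b u).
  by rewrite W0 D0 !sub0r normrN => /le_trans; apply; rewrite -normrN ler_norm.
Qed.

Section ode.
Variables (R : realType) (G1 G2 : R -> R -> R -> R) (L M : R).
Hypotheses (L0 : 0 < L) (M0 : 0 < M).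
Hypothesis lip1 : forall t x s x' s',
  `|G1 t x s - G1 t x' s'| <= L * (`|x - x'| + `|s - s'|).
Hypothesis lip2 : forall t x s x' s',
  `|G2 t x s - G2 t x' s'| <= L * (`|x - x'| + `|s - s'|).
Hypothesis bnd1 : forall t x s, `|G1 t x s| <= M.
Hypothesis bnd2 : forall t x s, `|G2 t x s| <= M.
Hypothesis cont1 : forall X S : R -> R, continuous X -> continuous S ->
  continuous (fun t => G1 t (X t) (S t)).
Hypothesis cont2 : forall X S : R -> R, continuous X -> continuous S ->
  continuous (fun t => G2 t (X t) (S t)).

Let A := 4 * L.
(* The Picard map contracts by the factor 1/2 for the weight [w], on the whole
   line at once: [w] grows on both sides and [2 L] times its primitive
   [(expR (A t) - expR (- A t)) / A] is bounded by [w / 2]. *)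
Let w (t : R) := expR (A * t) + expR (- (A * t)).

Let A0 : 0 < A. Proof. by rewrite /A mulr_gt0. Qed.

Let w1 t : 1 <= w t.
Proof.
rewrite /w; have [t0|/ltW t0] := leP 0 t.
- have : 1 <= expR (A * t) by rewrite -expR0 ler_expR mulr_ge0// ltW.
  by have := expR_ge0 (- (A * t)); lra.
- have : 1 <= expR (- (A * t)).
    by rewrite -expR0 ler_expR oppr_ge0 mulr_ge0_le0// ltW.
  by have := expR_ge0 (A * t); lra.
Qed.

Let dom (D dD : R -> R) c : 0 <= c -> (forall x : R, is_derive x 1 D (dD x)) ->
  D 0 = 0 -> (forall t, `|dD t| <= c * w t) -> forall t, `|D t| <= c / A * w t.
Proof.
move=> c0 d D0 b t.
pose W (t : R) := c / A * (expR (A * t) - expR (- (A * t))).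
have dW (x : R) : is_derive x 1 W (c * w x).
  rewrite /W; apply: is_derive_eq.
  rewrite /w /GRing.scale /=; field; exact: lt0r_neq0.
apply: le_trans (derive_dominated d dW b D0 _ t) _.
  by rewrite /W mulr0 oppr0 subrr mulr0.
rewrite /W normrM ger0_norm ?divr_ge0// ?(ltW A0)// ler_wpM2l ?divr_ge0// ?(ltW A0)//.
by rewrite /w ler_norml; have := expR_ge0 (A * t); have := expR_ge0 (- (A * t)); lra.
Qed.

(** Picard iteration. The bound on the right-hand side is used to start the
    geometric series and to see that the limit is Lipschitz, hence continuous,
    so that one more Picard step can be applied to it. *)
Lemma ode_exists (s0 : R) : exists XS : (R -> R) * (R -> R),
  [/\ XS.1 0 = 0, XS.2 0 = s0,
      forall t : R, is_derive t 1 XS.1 (G1 t (XS.1 t) (XS.2 t)) &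
      forall t : R, is_derive t 1 XS.2 (G2 t (XS.1 t) (XS.2 t))].
Proof.
have /choice[prim primP] : forall f : R -> R, exists P : R -> R,
    continuous f -> P 0 = 0 /\ forall x : R, is_derive x 1 P (f x).
  move=> f; have [cf|ncf] := pselect (continuous f); last by exists f.
  by have [P P0 dP] := antiderivative cf; exists P.
pose rhs1 (p : (R -> R) * (R -> R)) t := G1 t (p.1 t) (p.2 t).
pose rhs2 (p : (R -> R) * (R -> R)) t := G2 t (p.1 t) (p.2 t).
pose step p := (prim (rhs1 p), fun t => s0 + prim (rhs2 p) t).
pose u n : (R -> R) * (R -> R) := iter n step (fun _ => 0, fun _ => s0).
pose okc (p : (R -> R) * (R -> R)) := continuous p.1 /\ continuous p.2.
have stepP p : okc p ->
    [/\ (step p).1 0 = 0, (step p).2 0 = s0,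
      forall t : R, is_derive t 1 (step p).1 (rhs1 p t) &
      forall t : R, is_derive t 1 (step p).2 (rhs2 p t)].
  move=> [c1 c2]; have [P10 d1] := primP _ (cont1 c1 c2).
  have [P20 d2] := primP _ (cont2 c1 c2).
  split=> //=; first by rewrite P20 addr0.
  move=> x; have := d2 x => ?; have : is_derive x 1 (fun t => s0 + prim (rhs2 p) t) (0 + rhs2 p x) by apply: is_deriveD.
  by rewrite add0r.
have okstep p : okc p -> okc (step p).
  by move=> /stepP[_ _ d1 d2]; split=> t; exact: is_derive1_continuous.
have oku n : okc (u n).
  elim: n => [|n IH]; last exact: okstep.
  by split => t /=; exact: cvg_cst.
(* The right-hand sides along [p] and [q] differ by at most [2 * L * c * w],
   which integrates to at most [c / 2 * w]. *)
have stepB p q (c : R) : 0 <= c -> okc p -> okc q ->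
    (forall t, `|p.1 t - q.1 t| <= c * w t /\ `|p.2 t - q.2 t| <= c * w t) ->
    forall t, `|(step p).1 t - (step q).1 t| <= c / 2 * w t /\
              `|(step p).2 t - (step q).2 t| <= c / 2 * w t.
  move=> c0 okp okq pq t.
  have [p10 p20 dp1 dp2] := stepP _ okp; have [q10 q20 dq1 dq2] := stepP _ okq.
  have e : c / 2 = (2 * L * c) / A by rewrite /A; field; exact: lt0r_neq0.
  have Lc : 0 <= 2 * L * c by rewrite !mulr_ge0// ltW.
  have bb t' : L * (`|p.1 t' - q.1 t'| + `|p.2 t' - q.2 t'|) <= 2 * L * c * w t'.
    have [h1 h2] := pq t'; have -> : 2 * L * c * w t' = L * (c * w t' + c * w t').
      by ring.
    by rewrite ler_wpM2l ?lerD// ltW.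
  split; rewrite e.
  - apply: (@dom (fun t => (step p).1 t - (step q).1 t)
      (fun t => rhs1 p t - rhs1 q t) (2 * L * c)) => //; first by rewrite p10 q10 subrr.
    by move=> t'; apply: le_trans (bb t'); exact: lip1.
  - apply: (@dom (fun t => (step p).2 t - (step q).2 t)
      (fun t => rhs2 p t - rhs2 q t) (2 * L * c)) => //; first by rewrite p20 q20 subrr.
    by move=> t'; apply: le_trans (bb t'); exact: lip2.
pose K := M / A.
have K0 : 0 <= K by rewrite divr_ge0// ltW.
have uB n t : `|(u n.+1).1 t - (u n).1 t| <= K / 2 ^+ n * w t /\
              `|(u n.+1).2 t - (u n).2 t| <= K / 2 ^+ n * w t.
  elim: n t => [|n IH] t.
    rewrite expr0 divr1; have [p10 p20 dp1 dp2] := stepP _ (oku 0%N).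
    have Mw t' : M <= M * w t' by rewrite ler_peMr// ltW.
    split.
    + apply: (@dom (fun t => (u 1%N).1 t - 0) (fun t => rhs1 (u 0%N) t - 0) M) => //.
      * exact: ltW.
      * by rewrite p10 subrr.
      * by move=> t'; rewrite subr0; apply: le_trans (Mw t'); exact: bnd1.
    + apply: (@dom (fun t => (u 1%N).2 t - s0) (fun t => rhs2 (u 0%N) t - 0) M) => //.
      * exact: ltW.
      * by rewrite p20 subrr.
      * by move=> t'; rewrite subr0; apply: le_trans (Mw t'); exact: bnd2.
  have -> : K / 2 ^+ n.+1 = K / 2 ^+ n / 2 by rewrite exprS invfM mulrA mulrAC.
  by apply: (stepB _ _ _ _ (oku n.+1) (oku n) IH); rewrite divr_ge0// exprn_ge0.
have conv (i : (R -> R) * (R -> R) -> R -> R) :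
    (forall n t, `|i (u n.+1) t - i (u n) t| <= K / 2 ^+ n * w t) ->
    exists X : R -> R, forall t n, `|X t - i (u n) t| <= 2 * K / 2 ^+ n * w t.
  move=> H; have /choice[X XP] : forall t, exists l,
      forall n, `|l - i (u n) t| <= 2 * (K * w t) / 2 ^+ n.
    by move=> t1; apply: geometric_limit => n1; rewrite mulrAC.
  exists X => t2 n2; rewrite (le_trans (XP t2 n2))//.
  by rewrite le_eqVlt; apply/orP; left; apply/eqP; ring.
have [X XP] := conv fst (fun n t => (uB n t).1).
have [S SP] := conv snd (fun n t => (uB n t).2).
have lim_continuous (i : (R -> R) * (R -> R) -> R -> R) (Y : R -> R) :
    (forall t n, `|Y t - i (u n) t| <= 2 * K / 2 ^+ n * w t) ->
    (forall n x y, `|i (u n) x - i (u n) y| <= M * `|x - y|) -> continuous Y.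
  move=> YP lipi; apply: (@lipschitz_continuous _ _ M) => x y.
  apply: (@le_add_geometric _ _ _ (2 * K * (w x + w y))) => n.
  have := lipi n x y; have := YP x n; have := YP y n; rewrite !ler_norml.
  have -> : 2 * K * (w x + w y) / 2 ^+ n =
    2 * K / 2 ^+ n * w x + 2 * K / 2 ^+ n * w y by ring.
  lra.
have lipu n x y : `|(u n).1 x - (u n).1 y| <= M * `|x - y| /\
                  `|(u n).2 x - (u n).2 y| <= M * `|x - y|.
  case: n => [|n]; first by rewrite /= !subrr normr0 mulr_ge0// ltW.
  have [_ _ d1 d2] := stepP _ (oku n).
  split; first exact: (derive_le_dist d1 (fun t => bnd1 _ _ _)).
  exact: (derive_le_dist d2 (fun t => bnd2 _ _ _)).
have cX : continuous X by apply: (lim_continuous fst _ XP) => n x y; case: (lipu n x y).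
have cS : continuous S by apply: (lim_continuous snd _ SP) => n x y; case: (lipu n x y).
have okXS : okc (X, S) by [].
have close t n : `|(step (X, S)).1 t - X t| <= 3 * K * w t / 2 ^+ n /\
    `|(step (X, S)).2 t - S t| <= 3 * K * w t / 2 ^+ n.
  have := @stepB (X, S) (u n) (2 * K / 2 ^+ n) _ okXS (oku n) _ t.
  case; first by rewrite divr_ge0// ?exprn_ge0// mulr_ge0.
    by move=> t'; split; [exact: XP|exact: SP].
  move=> h1 h2; have := XP t n.+1; have := SP t n.+1.
  have -> : 2 * K / 2 ^+ n.+1 * w t = K * w t / 2 ^+ n.
    by rewrite exprS; field; rewrite expf_neq0// pnatr_eq0.
  have e : 2 * K / 2 ^+ n / 2 * w t = K * w t / 2 ^+ n.
    by field; rewrite expf_neq0// pnatr_eq0.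
  have e3 : 3 * K * w t / 2 ^+ n = K * w t / 2 ^+ n + (K * w t / 2 ^+ n) * 2 by ring.
  have p : 0 <= K * w t / 2 ^+ n.
    rewrite mulr_ge0 ?invr_ge0 ?exprn_ge0// mulr_ge0//; have := w1 t; lra.
  have tri (x y z r : R) : 0 <= r ->
      `|x - y| <= r -> `|z - y| <= r -> `|x - z| <= r + r * 2.
    by rewrite !ler_norml; lra.
  move: h1 h2; rewrite e e3 -[step (u n)]/(u n.+1) => h1 h2 h3 h4.
  by split; [exact: tri h1 h4|exact: tri h2 h3].
have eX : (step (X, S)).1 = X.
  apply/funext => t; apply/eqP; rewrite -subr_eq0 -normr_le0.
  apply: (@le_add_geometric _ _ _ (3 * K * w t)) => n; rewrite add0r.
  by case: (close t n).
have eS : (step (X, S)).2 = S.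
  apply/funext => t; apply/eqP; rewrite -subr_eq0 -normr_le0.
  apply: (@le_add_geometric _ _ _ (3 * K * w t)) => n; rewrite add0r.
  by case: (close t n).
by exists (X, S); have := stepP _ okXS; rewrite eX eS.
Qed.

(** The square of the distance of two solutions grows at most like
    [expR (4 L t)]; squares avoid differentiating an absolute value. *)
Lemma ode_gronwall (X S X' S' : R -> R) :
  (forall t : R, is_derive t 1 X (G1 t (X t) (S t))) ->
  (forall t : R, is_derive t 1 S (G2 t (X t) (S t))) ->
  (forall t : R, is_derive t 1 X' (G1 t (X' t) (S' t))) ->
  (forall t : R, is_derive t 1 S' (G2 t (X' t) (S' t))) ->
  forall t, 0 <= t -> (X t - X' t) ^+ 2 + (S t - S' t) ^+ 2 <=
    expR (A * t) * ((X 0 - X' 0) ^+ 2 + (S 0 - S' 0) ^+ 2).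
Proof.
move=> dX dS dX' dS' t t0.
pose dx t := G1 t (X t) (S t) - G1 t (X' t) (S' t).
pose ds t := G2 t (X t) (S t) - G2 t (X' t) (S' t).
pose phi t := ((X t - X' t) ^+ 2 + (S t - S' t) ^+ 2) * expR (- (A * t)).
pose dphi t := (2 * (X t - X' t) * dx t + 2 * (S t - S' t) * ds t
   - A * ((X t - X' t) ^+ 2 + (S t - S' t) ^+ 2)) * expR (- (A * t)).
have d (x : R) : is_derive x 1 phi (dphi x).
  rewrite /phi; apply: is_derive_eq.
  by rewrite /dphi /dx /ds /GRing.scale /=; ring.
have dle (x : R) : dphi x <= 0.
  rewrite /dphi mulr_le0_ge0 ?expR_ge0// subr_le0.
  set a := X x - X' x; set b := S x - S' x.
  have h1 : `|dx x| <= L * (`|a| + `|b|) by exact: lip1.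
  have h2 : `|ds x| <= L * (`|a| + `|b|) by exact: lip2.
  have e1 : a * dx x <= `|a| * (L * (`|a| + `|b|)).
    by rewrite (le_trans (ler_norm _))// normrM ler_wpM2l.
  have e2 : b * ds x <= `|b| * (L * (`|a| + `|b|)).
    by rewrite (le_trans (ler_norm _))// normrM ler_wpM2l.
  have e3 : 0 <= L * (`|a| - `|b|) ^+ 2 by rewrite mulr_ge0 ?sqr_ge0// ltW.
  rewrite -(real_normK (num_real a)) -(real_normK (num_real b)) /A.
  move: e1 e2 e3; set m := `|a|; set n := `|b|; nra.
suff : - phi 0 <= - phi t.
  rewrite lerN2 /phi mulr0 oppr0 expR0 mulr1 expRN => h.
  by rewrite mulrC -ler_pdivrMr ?expR_gt0.
apply: (@derive_ge0_le _ (fun t => - phi t) (fun t => - dphi t) _ _ t0) => [|x _].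
- by apply: continuous_subspaceT => z; apply: continuousN; exact: is_derive1_continuous.
- by rewrite oppr_ge0.
Qed.

End ode.

(** * The nonlinearity and its energy coordinate *)

Lemma powR_norm_continuous (R : realType) (r : R) : 0 < r ->
  continuous (fun v : R => `|v| `^ r).
Proof.
move=> r0 x; have [->|x0] := eqVneq x 0.
  rewrite /continuous_at normr0 powR0 ?gt_eqF//.
  apply/cvgrPdist_lt => e e0; near=> y.
  rewrite sub0r normrN ger0_norm ?powR_ge0//.
  have -> : e = (e `^ r^-1) `^ r by rewrite -powRrM mulVf ?gt_eqF// powRr1// ltW.
  rewrite gt0_ltr_powR ?nnegrE ?powR_ge0//.
  near: y; have := @cvgr_dist_lt _ _ _ (nbhs (0 : R)) _ id 0 cvg_id (e `^ r^-1).
  rewrite powR_gt0// => /(_ _ isT); apply: filterS => y /=.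
  by rewrite sub0r normrN.
apply: (@continuous_comp _ _ _ (fun v : R => `|v|) (fun v : R => v `^ r)).
  exact: norm_continuous.
by apply: is_derive1_continuous; apply: is_derive1_powR; rewrite normr_gt0.
Unshelve. all: by end_near. Qed.

(** With [F] the primitive of [nonlin] vanishing at [0], the energy coordinate of
    [v] is [y = sgn v * sqrt (2 F v)], and the amplitude map [V] is its inverse.
    The derivative [k] of [V] satisfies [k y * nonlin (V y) = y]. In the plane
    [(y, z)] with [z = rho v'], the equation [(rho v')' = - rho nonlin v] becomes,
    for the new time [tau] with [dx = k y dtau], the system
    [y' = z / rho x], [z' = - rho x * y], [x' = k y]: the non-Lipschitz term has
    moved into the speed [k] at which [x] is travelled. *)
Section energy_coordinate.
Variables (R : realType) (mu p : R).
Hypotheses (mu0 : 0 < mu) (p0 : 0 < p) (p1 : p < 1).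

Definition nonlin (v : R) : R := mu * v + `|v| `^ (p - 1) * v.

(* [a] is twice the factor in the primitive of [v^p], so that [Q] is [2 F]. *)
Let a : R := 2 / (p + 1).
Let Q (v : R) : R := mu * v ^+ 2 + a * `|v| `^ (p + 1).

Let a_bnd : 0 < a /\ a < 2 /\ 1 < a.
Proof.
rewrite /a divr_gt0 ?addr_gt0// ltr_pdivrMr ?addr_gt0// ltr_pdivlMr ?addr_gt0//.
by have := p0; have := p1; lra.
Qed.

Lemma nonlinN (v : R) : nonlin (- v) = - nonlin v.
Proof. by rewrite /nonlin normrN !mulrN opprD. Qed.

Let nonlinE (v : R) : 0 < v -> nonlin v = v * (mu + v `^ (p - 1)).
Proof. by move=> v0; rewrite /nonlin gtr0_norm//; ring. Qed.

Let QE (v : R) : 0 < v -> Q v = v ^+ 2 * (mu + a * v `^ (p - 1)).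
Proof.
move=> v0; rewrite /Q gtr0_norm//.
rewrite (_ : p + 1 = 2 + (p - 1)); last by ring.
rewrite (@powRD _ v 2 (p - 1)); last by rewrite (gt_eqF v0) implybT.
by rewrite (powR_mulrn 2 (ltW v0)); ring.
Qed.

Let QN (v : R) : Q (- v) = Q v. Proof. by rewrite /Q normrN sqrrN. Qed.

Let Q0 : Q 0 = 0.
Proof. by rewrite /Q normr0 powR0 ?expr0n/= ?mulr0 ?addr0// gt_eqF// addr_gt0. Qed.

Let wle (u v : R) : 0 < u -> u <= v -> v `^ (p - 1) <= u `^ (p - 1).
Proof.
move=> u0 uv; have v0 := lt_le_trans u0 uv.
rewrite -(opprB 1 p) !powRN lef_pV2 ?posrE ?powR_gt0//.
by apply: ge0_ler_powR; rewrite ?nnegrE ?subr_ge0 // ltW.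
Qed.

Lemma nonlin_gt0 (v : R) : 0 < v -> 0 < nonlin v.
Proof. by move=> v0; rewrite nonlinE// mulr_gt0// addr_gt0// powR_gt0. Qed.

Let nonlinE' (v : R) : 0 < v -> nonlin v = mu * v + v `^ p.
Proof.
by move=> v0; rewrite /nonlin gtr0_norm// mulrC [X in _ + X]mulrC mulr_powRB1// ltW.
Qed.

Let nonlin_le (u v : R) : 0 < u -> u <= v -> nonlin u <= nonlin v.
Proof.
move=> u0 uv; have v0 := lt_le_trans u0 uv.
rewrite !nonlinE'// lerD ?ler_wpM2l ?(ltW mu0)//.
by apply: ge0_ler_powR; rewrite ?nnegrE // ltW.
Qed.

Lemma nonlin0 : nonlin 0 = 0. Proof. by rewrite /nonlin !mulr0 addr0. Qed.

Lemma nonlin_continuous : continuous nonlin.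
Proof.
have cpos (v : R) : 0 < v -> {for v, continuous nonlin}.
  move=> v0; have : {for v, continuous (fun v : R => mu * v + v `^ p)}.
    apply: cvgD; first by apply: cvgM; [exact: cvg_cst|exact: cvg_id].
    exact: (is_derive1_continuous (is_derive1_powR p v0)).
  move=> H; rewrite /prop_for /continuous_at nonlinE'//.
  apply: cvg_trans H; apply: near_eq_cvg; near=> u; rewrite nonlinE'//.
  by near: u; exact: lt_nbhsr.
move=> v; have [v0|/cpos//|->] := ltgtP v 0.
  have -> : nonlin = (fun u => - nonlin (- u)).
    by apply/funext => u; rewrite nonlinN opprK.
  apply: cvgN; apply: (@continuous_comp _ _ _ -%R nonlin).
    exact: opp_continuous.
  by apply: cpos; rewrite oppr_gt0.
have bnd (u : R) : `|nonlin u| <= mu * `|u| + `|u| `^ p.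
  apply: le_trans (ler_normD _ _) _; rewrite !normrM (gtr0_norm mu0) lerD2l.
  by rewrite (ger0_norm (powR_ge0 _ _)) mulrC mulr_powRB1.
rewrite /continuous_at nonlin0.
have : {for (0 : R), continuous (fun u : R => mu * `|u| + `|u| `^ p)}.
  apply: cvgD; last exact: powR_norm_continuous.
  by apply: cvgM; [exact: cvg_cst|exact: norm_continuous].
rewrite /prop_for /continuous_at normr0 mulr0 powR0 ?gt_eqF// addr0.
move=> /cvgr0Pnorm_lt H; apply/cvgr0Pnorm_lt => e e0; near=> u.
apply: le_lt_trans (bnd u) _; apply: le_lt_trans (ler_norm _) _.
by near: u; exact: H.
Unshelve. all: by end_near. Qed.

Let Q_lt (u v : R) : 0 <= u -> u < v -> Q u < Q v.
Proof.
move=> u0 uv; have v0 := le_lt_trans u0 uv.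
rewrite /Q ltr_leD//; last first.
  rewrite ler_wpM2l ?(ltW a_bnd.1)// ge0_ler_powR ?nnegrE// ?ler_norm2//.
    by rewrite addr_ge0 ?ltW.
  by rewrite !ger0_norm ?(ltW uv)// ltW.
by rewrite ltr_pM2l// ltr_pXn2r ?nnegrE// ltW.
Qed.

Let Q_inj (u v : R) : 0 <= u -> 0 <= v -> Q u = Q v -> u = v.
Proof.
move=> u0 v0 e; have [uv|uv|//] := ltgtP u v.
- by have := Q_lt u0 uv; rewrite e ltxx.
- by have := Q_lt v0 uv; rewrite e ltxx.
Qed.

Let Q_le_inv (u v : R) : 0 <= u -> 0 <= v -> Q u <= Q v -> u <= v.
Proof.
by move=> u0 v0 h; rewrite leNgt; apply/negP => /(Q_lt v0); rewrite ltNge h.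
Qed.

Let Qge (v : R) : mu * v ^+ 2 <= Q v.
Proof. by rewrite /Q lerDl mulr_ge0 ?powR_ge0// ltW// a_bnd.1. Qed.

Let Q_continuous : continuous Q.
Proof.
move=> x; apply: cvgD; apply: cvgM; try exact: cvg_cst.
  exact: exprn_continuous.
by apply: powR_norm_continuous; rewrite addr_gt0.
Qed.

Let Q_surj (y : R) : 0 <= y -> exists2 v, 0 <= v & Q v = y ^+ 2.
Proof.
move=> y0; pose B := y / Num.sqrt mu.
have s0 : 0 < Num.sqrt mu by rewrite sqrtr_gt0.
have B0 : 0 <= B by rewrite divr_ge0// ltW.
have QB : y ^+ 2 <= Q B.
  apply: le_trans (Qge _).
  by rewrite /B expr_div_n sqr_sqrtr ?(ltW mu0)// mulrC divfK// gt_eqF.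
have [||v vB <-] := @IVT R Q 0 B (y ^+ 2) B0.
- by apply: continuous_subspaceT.
- by rewrite Q0 min_l ?max_r ?QB ?sqr_ge0// (le_trans _ QB)// sqr_ge0.
by exists v => //; rewrite (itvP vB).
Qed.

(* The sign condition selects the odd inverse of the even function [Q]. *)
Let Vex : { V : R -> R | forall y, Q (V y) = y ^+ 2 /\ 0 <= y * V y }.
Proof.
apply: cid; suff /choice[V VP] : forall y : R, exists v : R,
    Q v = y ^+ 2 /\ 0 <= y * v by exists V.
move=> y; have [y0|/ltW y0] := leP 0 y.
  by have [v v0 e] := Q_surj y0; exists v; rewrite mulr_ge0.
have [|v v0 e] := @Q_surj (- y); first by rewrite oppr_ge0.
exists (- v); rewrite QN e sqrrN mulrN -mulNr; split => //.
by rewrite mulr_ge0// oppr_ge0.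
Qed.

Definition amplitude : R -> R := sval Vex.
(** The derivative of [amplitude]; the value at [0] is right because
    [nonlin 0 = 0] and [0 / 0 = 0]. *)
Definition slope (y : R) : R := y / nonlin (amplitude y).
Let V := amplitude.
Let k := slope.

Let QV (y : R) : Q (V y) = y ^+ 2. Proof. by rewrite /V /amplitude; case: Vex => /= f /(_ y)[]. Qed.
Let Vsgn (y : R) : 0 <= y * V y. Proof. by rewrite /V /amplitude; case: Vex => /= f /(_ y)[]. Qed.

Lemma amplitude0 : V 0 = 0.
Proof.
have := QV 0; rewrite expr0n/= => e; have := Qge (V 0); rewrite e.
have := sqr_ge0 (V 0); have := mu0 => m0 h1 h2; apply/eqP; rewrite -sqrf_eq0.
by rewrite eq_le h1 andbT -(pmulr_rle0 _ m0).
Qed.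

Let V_gt0 (y : R) : 0 < y -> 0 < V y.
Proof.
move=> y0; have := Vsgn y; rewrite pmulr_rge0// le_eqVlt => /predU1P[e|//].
by have := QV y; rewrite -e Q0 => /esym/eqP; rewrite sqrf_eq0 gt_eqF.
Qed.

Lemma amplitudeN (y : R) : V (- y) = - V y.
Proof.
wlog y0 : y / 0 < y => [H|].
  have [y0|y0|->] := ltgtP y 0; last by rewrite oppr0 amplitude0 oppr0.
    by have := H (- y); rewrite opprK oppr_gt0 => /(_ y0) ->; rewrite opprK.
  exact: H.
apply/eqP; rewrite -eqr_oppLR; apply/eqP; apply: Q_inj.
- by have := Vsgn (- y); rewrite mulNr -mulrN pmulr_rge0.
- exact/ltW/V_gt0.
- by rewrite QN !QV sqrrN.
Qed.

Lemma slopeN (y : R) : k (- y) = k y.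
Proof. by rewrite /k/slope -/V amplitudeN nonlinN invrN mulrNN. Qed.

Lemma slope_amplitude (y : R) : k y * nonlin (V y) = y.
Proof.
wlog y0 : y / 0 < y => [H|]; last by rewrite divfK// gt_eqF// nonlin_gt0// V_gt0.
have [y0|y0|->] := ltgtP y 0; last by rewrite /k /slope !mul0r.
  by rewrite -[y]opprK slopeN amplitudeN nonlinN mulrN H// oppr_gt0.
exact: H.
Qed.

Lemma slope_gt0 (y : R) : y != 0 -> 0 < k y.
Proof.
wlog y0 : y / 0 < y => [H|_]; last by rewrite divr_gt0// nonlin_gt0// V_gt0.
have [yn|yp|//] := ltgtP y 0; last by rewrite H// gt_eqF.
by rewrite -slopeN H// ?oppr_gt0// oppr_eq0 lt_eqF.
Qed.

Lemma slope0 : k 0 = 0. Proof. by rewrite /k /slope mul0r. Qed.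

Lemma slope_ge0 (y : R) : 0 <= k y.
Proof. by have [->|/slope_gt0/ltW//] := eqVneq y 0; rewrite slope0. Qed.

(* The bounds on [k] and its monotonicity are read off this rational expression
   in [w = v `^ (p - 1)], which decreases from infinity to [0] as [v] grows. *)
Let kE (y : R) : 0 < y -> let w := V y `^ (p - 1) in
  k y ^+ 2 = (mu + a * w) / (mu + w) ^+ 2.
Proof.
move=> y0 w; have v0 := V_gt0 y0.
have -> : k y ^+ 2 = Q (V y) / nonlin (V y) ^+ 2 by rewrite QV -expr_div_n.
rewrite QE// nonlinE// -/w.
have : mu + w != 0 by rewrite gt_eqF// addr_gt0// powR_gt0.
by move: v0; move/gt_eqF/negbT => ? ?; field; apply/andP.
Qed.

Lemma slope_sqr_le (y : R) : k y ^+ 2 <= mu^-1.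
Proof.
wlog y0 : y / 0 < y => [H|].
  have [y0|y0|->] := ltgtP y 0; last by rewrite slope0 expr0n/= invr_ge0 ltW.
    by rewrite -slopeN H// oppr_gt0.
  exact: H.
rewrite kE//; set w := _ `^ _; have w0 : 0 < w by rewrite powR_gt0// V_gt0.
rewrite ler_pdivrMr ?exprn_gt0 ?addr_gt0// [leRHS]mulrC ler_pdivlMr//.
have [_ [a2 _]] := a_bnd; rewrite -subr_ge0.
have -> : (mu + w) ^+ 2 - (mu + a * w) * mu = (2 - a) * (mu * w) + w ^+ 2 by ring.
by rewrite addr_ge0 ?sqr_ge0// mulr_ge0 ?subr_ge0 ?ltW// mulr_gt0.
Qed.

(** The exponent [1 - p] is positive, so that [k] tends to [0] at [0]. *)
Lemma slope_le_amplitude (y : R) : k y ^+ 2 <= 2 * `|V y| `^ (1 - p).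
Proof.
wlog y0 : y / 0 < y => [H|].
  have [y0|y0|->] := ltgtP y 0; last by rewrite slope0 expr0n/= mulr_ge0// powR_ge0.
    by rewrite -[y]opprK slopeN amplitudeN normrN H// oppr_gt0.
  exact: H.
rewrite kE// (gtr0_norm (V_gt0 y0)) -(opprB p 1) powRN; set w := _ `^ _.
have w0 : 0 < w by rewrite powR_gt0// V_gt0.
rewrite ler_pdivrMr ?exprn_gt0 ?addr_gt0// [leRHS]mulrAC ler_pdivlMr//.
have [_ [a2 _]] := a_bnd; have := mu0; nra.
Qed.

Lemma amplitude_sqr_le (y : R) : mu * V y ^+ 2 <= y ^+ 2.
Proof. by rewrite -(QV y); exact: Qge. Qed.

Let V_le (x y : R) : 0 <= x -> x <= y -> V x <= V y.
Proof.
rewrite le_eqVlt => /predU1P[<-|x0] xy.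
  rewrite amplitude0; move: xy; rewrite le_eqVlt => /predU1P[<-|/V_gt0/ltW//].
  by rewrite amplitude0.
apply: Q_le_inv; rewrite ?(ltW (V_gt0 _))// ?(lt_le_trans x0)//.
by rewrite !QV ler_pXn2r ?nnegrE// ?(le_trans _ xy) ?ltW.
Qed.

Lemma slope_nondecreasing (x y : R) : 0 <= x -> x <= y -> k x <= k y.
Proof.
rewrite le_eqVlt => /predU1P[<-|x0] xy; first by rewrite slope0 slope_ge0.
have y0 := lt_le_trans x0 xy.
rewrite -(@ler_pXn2r _ 2) ?nnegrE ?slope_ge0// !kE//.
have := wle (V_gt0 x0) (V_le (ltW x0) xy).
have : 0 < V y `^ (p - 1) by rewrite powR_gt0// V_gt0.
set w' := V y `^ _; set w := V x `^ _ => w'0 ww.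
have w0 := lt_le_trans w'0 ww.
rewrite ler_pdivrMr ?exprn_gt0 ?addr_gt0// [leRHS]mulrAC ler_pdivlMr ?exprn_gt0 ?addr_gt0//.
rewrite -subr_ge0.
have -> : (mu + a * w') * (mu + w) ^+ 2 - (mu + a * w) * (mu + w') ^+ 2 =
  (w - w') * (mu ^+ 2 * (2 - a) + mu * (w + w') + a * (w * w')) by ring.
have [a0 [a2 _]] := a_bnd.
rewrite mulr_ge0 ?subr_ge0// !addr_ge0// mulr_ge0 ?subr_ge0 ?sqr_ge0// ?ltW//.
  by rewrite addr_gt0.
by rewrite mulr_gt0.
Qed.

(** [k y / y] is nonincreasing, as the inverse of [nonlin (V y)]. *)
Lemma slope_scale (c y : R) : 0 <= c -> c <= 1 -> 0 <= y -> c * k y <= k (c * y).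
Proof.
rewrite le_eqVlt => /predU1P[<-|c0] c1; first by rewrite !mul0r slope0.
rewrite le_eqVlt => /predU1P[<-|y0]; first by rewrite slope0 !mulr0 slope0.
have cy0 : 0 < c * y by rewrite mulr_gt0.
rewrite /k /slope mulrA ler_wpM2l ?(ltW cy0)// lef_pV2 ?posrE ?nonlin_gt0 ?V_gt0//.
apply: nonlin_le; first exact: V_gt0.
by apply: V_le; [exact: ltW|rewrite ler_piMl// ltW].
Qed.

(** Although [k] is only Hoelder continuous at [0], it is Lipschitz in the
    logarithm of its argument: [k] is nondecreasing and [k y / y] is
    nonincreasing, so that [k (e^s c)] lies between [e^(s - t) k (e^t c)] and
    [k (e^t c)] when [s <= t] and [0 <= c]. *)
Lemma slope_log_lipschitz (c s t : R) :
  `|k (expR s * c) - k (expR t * c)| <= Num.sqrt mu^-1 * `|s - t|.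
Proof.
wlog c0 : c / 0 <= c => [H|].
  have [c0|/ltW c0] := leP 0 c; first exact: H.
  by have := H (- c); rewrite oppr_ge0 => /(_ c0); rewrite !mulrN !slopeN.
wlog st : s t / s <= t => [H|].
  have [|/ltW ts] := leP s t; first exact: H.
  by rewrite distrC (distrC s); exact: H.
have ec0 : 0 <= expR t * c by rewrite mulr_ge0// expR_ge0.
have kle : k (expR s * c) <= k (expR t * c).
  by apply: slope_nondecreasing; rewrite ?mulr_ge0 ?expR_ge0// ler_wpM2r// ler_expR.
rewrite ler0_norm ?subr_le0// opprB ler0_norm ?subr_le0// opprB.
have h : expR (s - t) * k (expR t * c) <= k (expR s * c).
  have := @slope_scale (expR (s - t)) (expR t * c); rewrite mulrA -expRD subrK.
  by apply; rewrite ?expR_ge0// -expR0 ler_expR subr_le0.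
have h2 : 1 + (s - t) <= expR (s - t) by exact: expR_ge1Dx.
have h3 : k (expR t * c) <= Num.sqrt mu^-1.
  rewrite -(ger0_norm (slope_ge0 _)) -sqrtr_sqr ler_sqrt ?slope_sqr_le//.
  by rewrite invr_ge0 ltW.
have h4 := slope_ge0 (expR t * c).
move: h h2 h3 h4; set K := k _; set K' := k _; set e := expR _; set m := Num.sqrt _.
by nra.
Qed.

Let V_small (e : R) : 0 < e -> \forall y \near (0 : R), `|V y| `^ (1 - p) < e.
Proof.
move=> e0.
have c : {for (0 : R), continuous (fun y : R => `|y / Num.sqrt mu| `^ (1 - p))}.
  apply: (@continuous_comp _ _ _ (fun y : R => y / Num.sqrt mu)
     (fun v : R => `|v| `^ (1 - p))).
    by apply: cvgM; [exact: cvg_id|exact: cvg_cst].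
  by apply: powR_norm_continuous; rewrite subr_gt0.
move: c; rewrite /prop_for /continuous_at mul0r normr0 powR0; last first.
  by rewrite gt_eqF// subr_gt0.
move/cvgrPdist_lt => /(_ _ e0); apply: filterS => y.
rewrite sub0r normrN ger0_norm ?powR_ge0//; apply: le_lt_trans.
apply: ge0_ler_powR; rewrite ?nnegrE// ?subr_ge0 ?(ltW p1)//.
rewrite -(@ler_pXn2r _ 2) ?nnegrE// !real_normK ?num_real//.
rewrite expr_div_n sqr_sqrtr ?(ltW mu0)// ler_pdivlMr// mulrC.
exact: amplitude_sqr_le.
Qed.

Let is_derive_V_pos (y : R) : 0 < y -> is_derive y 1 V (k y).
Proof.
move=> y0; pose F (v : R) := Num.sqrt (Q v); have v0 := V_gt0 y0.
have FV : F (V y) = y by rewrite /F QV sqrtr_sqr gtr0_norm.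
have dF (v : R) : 0 < v -> is_derive v 1 F (nonlin v / F v).
  move=> v_gt0.
  have dQ : is_derive v 1 Q (2 * nonlin v).
    apply: (@is_derive_near_eq _ (fun v => mu * v ^+ 2 + a * v `^ (p + 1))).
      near=> u; have u0 : 0 < u by near: u; exact: lt_nbhsr.
      by rewrite /Q gtr0_norm.
    have dpow := is_derive1_powR (p + 1) v_gt0.
    apply: is_derive_eq.
    rewrite nonlinE'// /GRing.scale /= addrK /a.
    have := p0 => ?; field; lra.
  have Q0' : 0 < Q v by rewrite -[X in X < _]Q0; exact: Q_lt.
  have := is_derive1_comp (is_derive1_sqrt Q0') dQ.
  rewrite /F [X in is_derive _ _ _ X -> _](_ : _ = nonlin v / Num.sqrt (Q v)) //.
  by field; rewrite gt_eqF// sqrtr_gt0.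
have := @is_derive_inverse R F V (nonlin (V y) / F (V y)) (V y).
rewrite FV invf_div; apply.
- near=> u; have u0 : 0 < u by near: u; exact: lt_nbhsr.
  apply: Q_inj; rewrite ?QV ?(ltW u0)//.
    by rewrite ltW// V_gt0// sqrtr_gt0 -Q0 Q_lt.
  by rewrite /F sqr_sqrtr// ltW// -Q0 Q_lt.
- near=> u; apply: is_derive1_continuous; apply: dF.
  near: u; exact: lt_nbhsr.
- by rewrite -[X in _ / X]FV; exact: dF.
- by rewrite mulf_neq0// ?invr_eq0 gt_eqF// nonlin_gt0.
Unshelve. all: by end_near. Qed.

(* At the origin the inverse function theorem does not apply to [sqrt Q], whose
   slope is infinite there; the difference quotients of [V] are bounded instead. *)
Let Vdiv (z : R) : z != 0 -> (V z / z) ^+ 2 <= `|V z| `^ (1 - p).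
Proof.
move=> z0; wlog z_gt0 : z z0 / 0 < z => [H|].
  have [zn|zp|/eqP] := ltgtP z 0; last by rewrite (negbTE z0).
    have := H (- z); rewrite oppr_eq0 oppr_gt0 amplitudeN normrN invrN mulrNN.
    exact.
  exact: H.
have v0 := V_gt0 z_gt0.
rewrite expr_div_n -(QV z) QE// gtr0_norm// -(opprB p 1) powRN; set w := _ `^ _.
have w0 : 0 < w by rewrite powR_gt0.
have [_ [_ a1]] := a_bnd.
have v2 : V z ^+ 2 != 0 by rewrite sqrf_eq0 gt_eqF.
have w1 : w <= a * w by rewrite ler_peMl ?ltW.
have maw : w <= mu + a * w by have := mu0; lra.
by rewrite invfM mulrA divff// mul1r lef_pV2// posrE (lt_le_trans w0).
Qed.

Lemma is_derive_amplitude (y : R) : is_derive y 1 V (k y).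
Proof.
have [y0|y0|->] := ltgtP y 0; last 2 first.
- exact: is_derive_V_pos.
- rewrite slope0.
  apply/is_derive1_caratheodory.
  exists (fun z => V z / z); split.
  + by move=> z; have [->|z0] := eqVneq z 0; rewrite amplitude0 !subr0 ?mulr0// divfK.
  + rewrite /prop_for /continuous_at invr0 mulr0.
    apply/cvgrPdist_lt => e e0; near=> z.
    rewrite sub0r normrN -(@ltr_pXn2r _ 2) ?nnegrE ?normr_ge0 ?(ltW e0)//.
    rewrite real_normK ?num_real//.
    have [->|z0] := eqVneq z 0; first by rewrite invr0 mulr0 expr0n exprn_gt0.
    apply: (@le_lt_trans _ _ (`|V z| `^ (1 - p))); last first.
      by near: z; apply: V_small; rewrite exprn_gt0.
    exact: Vdiv.
  + by rewrite invr0 mulr0.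
- have dn := is_derive_V_pos (_ : 0 < - y).
  have -> : V = (fun z => - V (- z)) by apply/funext => z; rewrite amplitudeN opprK.
  have := dn; rewrite oppr_gt0 => /(_ y0) ?.
  by apply: is_derive_eq; rewrite slopeN /GRing.scale /=; ring.
Unshelve. all: by end_near. Qed.

Lemma slope_continuous : continuous k.
Proof.
have cpos (y : R) : 0 < y -> {for y, continuous k}.
  move=> y0; rewrite /k /slope.
  apply: cvgM; first exact: cvg_id.
  apply: cvgV; first by rewrite gt_eqF// nonlin_gt0// V_gt0.
  apply: (@continuous_comp _ _ _ V nonlin).
    exact/is_derive1_continuous/is_derive_amplitude.
  have v0 := V_gt0 y0.
  have : {for V y, continuous (fun v : R => mu * v + v `^ p)}.
    apply: cvgD; first by apply: cvgM; [exact: cvg_cst|exact: cvg_id].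
    exact: (is_derive1_continuous (is_derive1_powR p v0)).
  move=> H; rewrite /prop_for /continuous_at nonlinE'//.
  apply: cvg_trans H; apply: near_eq_cvg; near=> u; rewrite nonlinE'//.
  by near: u; exact: lt_nbhsr.
move=> y; have [y0|/cpos//|->] := ltgtP y 0.
  have -> : k = k \o -%R by apply/funext => z /=; rewrite slopeN.
  apply: continuous_comp; first exact: opp_continuous.
  by apply: cpos; rewrite oppr_gt0.
rewrite /continuous_at slope0; apply/cvgrPdist_lt => e e0; near=> z.
rewrite sub0r normrN -(@ltr_pXn2r _ 2) ?nnegrE ?normr_ge0 ?(ltW e0)//.
rewrite real_normK ?num_real//.
apply: le_lt_trans (slope_le_amplitude z) _.
rewrite -ltr_pdivlMl//; near: z; apply: V_small.
by rewrite mulr_gt0// exprn_gt0.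
Unshelve. all: by end_near. Qed.

End energy_coordinate.

(** * Change of independent variable and the Prufer flow *)

Lemma is_derive_approx (R : realType) (f : R -> R) (x l : R) :
  (forall e : R, 0 < e ->
     \forall y \near x, `|f y - f x - l * (y - x)| <= e * `|y - x|) ->
  is_derive x 1 f l.
Proof.
move=> H; apply/is_derive1_caratheodory.
exists (fun y => if y == x then l else (f y - f x) / (y - x)); split.
- move=> y; case: eqP => [->|/eqP yx]; first by rewrite !subrr mulr0.
  by rewrite divfK// subr_eq0.
- rewrite /prop_for /continuous_at eqxx; apply/cvgrPdist_le => e e0.
  near=> y; case: eqP => [_|/eqP yx]; first by rewrite subrr normr0 ltW.
  have y0 : y - x != 0 by rewrite subr_eq0.
  have -> : l - (f y - f x) / (y - x) = - ((f y - f x - l * (y - x)) / (y - x)).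
    by field.
  rewrite normrN normrM normfV ler_pdivrMr ?normr_gt0//.
  by near: y; exact: H.
- by rewrite eqxx.
Unshelve. all: by end_near. Qed.

(** If [A' = g X'] with [X' >= 0] then [A], as a function of [X], has derivative
    [g] even where [X'] vanishes: the increments of [A - g t0 * X] are dominated
    by those of [e * X] near [t0]. This is what makes the time change
    [dx = k y dtau] reversible at the zeros of [k]. *)
Lemma is_derive_reparam (R : realType) (A X dX g tau : R -> R) (t0 : R) :
  (forall t : R, is_derive t 1 X (dX t)) -> (forall t, 0 <= dX t) ->
  (forall t : R, is_derive t 1 A (g t * dX t)) -> continuous g ->
  (forall t, tau (X t) = t) ->
  is_derive (X t0) 1 (A \o tau) (g t0).
Proof.
move=> dXP dX0 dA cg XK.
have cX : continuous X by move=> t; exact: is_derive1_continuous (dXP t).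
have nK : {near t0, cancel X tau} by near=> y; exact: XK.
have nc : {near t0, continuous X} by near=> y; exact: cX.
have [ctau tauK] := near_can_continuousAcan_sym nK nc.
have {}ctau : {for X t0, continuous tau} by exact: nbhs_singleton ctau.
apply: is_derive_approx => e e0.
have /cvgrPdist_le/(_ e e0) cgt : g t @[t --> t0] --> g t0 by exact: cg.
have [d /= d0 dP] := cgt.
have key a b : a <= b -> (forall u, a < u < b -> `|t0 - u| < d) ->
    `|(A b - g t0 * X b) - (A a - g t0 * X a)| <= e * X b - e * X a.
  move=> ab close.
  apply: (@derive_dominated_itv _ (fun t => A t - g t0 * X t)
    (fun t => g t * dX t - g t0 * dX t) (fun t => e * X t) (fun t => e * dX t)
    a b ab) => u uab.
  rewrite -mulrBl normrM (ger0_norm (dX0 u)) ler_wpM2r//.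
  by rewrite distrC; apply: dP => /=; exact: close.
near=> x.
have Xtx : X (tau x) = x by near: x.
have tx : `|t0 - tau x| < d.
  by near: x; have /cvgrPdist_lt/(_ d d0) := ctau; rewrite XK; exact.
rewrite /= XK; move: Xtx tx; set t := tau x => <- tx.
have [t_le|/ltW t_le] := leP t t0.
- have h : `|(A t0 - g t0 * X t0) - (A t - g t0 * X t)| <= e * X t0 - e * X t.
    apply: key => // u /andP[tu ut]; rewrite ger0_norm ?subr_ge0 ?(ltW ut)//.
    by move: tx; rewrite ger0_norm ?subr_ge0//; lra.
  have Xle : X t <= X t0.
    by rewrite -(ler_pM2l e0) -subr_ge0 (le_trans _ h).
  rewrite (ler0_norm (_ : X t - X t0 <= 0)) ?subr_le0// -normrN.
  have -> : - (A t - A t0 - g t0 * (X t - X t0)) =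
    (A t0 - g t0 * X t0) - (A t - g t0 * X t) by ring.
  by lra.
- have h : `|(A t - g t0 * X t) - (A t0 - g t0 * X t0)| <= e * X t - e * X t0.
    apply: key => // u /andP[tu ut]; rewrite ler0_norm ?subr_le0 ?(ltW tu)//.
    by move: tx; rewrite ler0_norm ?subr_le0//; lra.
  have Xle : X t0 <= X t.
    by rewrite -(ler_pM2l e0) -subr_ge0 (le_trans _ h).
  rewrite (ger0_norm (_ : 0 <= X t - X t0)) ?subr_ge0//.
  by rewrite (_ : A t - A t0 - _ = (A t - g t0 * X t) - (A t0 - g t0 * X t0));
    [lra|ring].
Unshelve. all: by end_near. Qed.

(** In polar coordinates [y = e^s sin t], [z = e^s cos t], and with the angle [t]
    as independent variable, the pair [(x, s)] solves a system whose right-hand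
    side [(prufer_x, prufer_s)] is bounded and globally Lipschitz in [(x, s)]:
    the derivative of the angle with respect to [tau] is
    [prufer_den t rho / rho], bounded away from [0], and [s] enters only through
    [k (e^s sin t)]. *)
Section vector_field.
Variables (R : realType) (mu p : R) (rho : R -> R) (m M N : R).
Hypotheses (mu0 : 0 < mu) (p0 : 0 < p) (p1 : p < 1).
Hypotheses (m0 : 0 < m) (mM : m <= M) (N0 : 0 <= N).
Hypothesis rho_bnd : forall x, m <= rho x <= M.
Hypothesis rho_lip : forall x y, `|rho x - rho y| <= N * `|x - y|.

Let k := slope mu0 p0 p1.

Definition prufer_den (t r : R) : R := cos t ^+ 2 + r ^+ 2 * sin t ^+ 2.

Definition prufer_x (t x s : R) : R :=
  k (expR s * sin t) * (rho x / prufer_den t (rho x)).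

Definition prufer_s (t x s : R) : R :=
  sin t * cos t * (1 - rho x ^+ 2) / prufer_den t (rho x).

Let d0 : R := Num.min 1 (m ^+ 2).

Let d0_gt0 : 0 < d0. Proof. by rewrite lt_min ltr01 exprn_gt0. Qed.

Lemma sin2_ge0_le1 t : 0 <= sin t ^+ 2 :> R /\ sin t ^+ 2 <= 1 :> R.
Proof.
split; first exact: sqr_ge0.
by have := cos2Dsin2 t; have := sqr_ge0 (cos t); lra.
Qed.

Let sincos_le1 t : `|sin t * cos t| <= 1 :> R.
Proof.
have := cos2Dsin2 t; have := sqr_ge0 (cos t - sin t); have := sqr_ge0 (cos t + sin t).
by rewrite ler_norml; nra.
Qed.

Lemma prufer_den_ge t r : m <= r -> d0 <= prufer_den t r.
Proof.
move=> mr; have r2 : m ^+ 2 <= r ^+ 2.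
  by rewrite ler_pXn2r ?nnegrE ?(ltW m0)// (le_trans (ltW m0)).
have [h1 h2] := sin2_ge0_le1 t; have := cos2Dsin2 t.
have : d0 <= 1 by rewrite ge_min lexx.
have : d0 <= m ^+ 2 by rewrite ge_min lexx orbT.
rewrite /prufer_den; move: (d0) (m ^+ 2) (r ^+ 2) (cos t ^+ 2) (sin t ^+ 2) r2 h1 h2.
by move=> d m2 r2 c s; nra.
Qed.

Lemma prufer_den_gt0 t r : m <= r -> 0 < prufer_den t r.
Proof. by move=> /(prufer_den_ge t); exact: lt_le_trans. Qed.

Let den_lip t r r' : m <= r <= M -> m <= r' <= M ->
  `|prufer_den t r - prufer_den t r'| <= 2 * M * `|r - r'|.
Proof.
move=> /andP[mr rM] /andP[mr' rM'].
have -> : prufer_den t r - prufer_den t r' = sin t ^+ 2 * (r + r') * (r - r').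
  by rewrite /prufer_den; ring.
rewrite normrM ler_wpM2r// ger0_norm; last first.
  by rewrite mulr_ge0 ?sqr_ge0//; have := m0; lra.
by have [? ?] := sin2_ge0_le1 t; have := m0; nra.
Qed.

Let quot_lip (a a' b b' La Lb B D : R) : d0 <= b -> d0 <= b' ->
  `|a'| <= B -> `|a - a'| <= La * D -> `|b - b'| <= Lb * D ->
  `|a / b - a' / b'| <= (La + B * Lb / d0) / d0 * D.
Proof.
move=> bd bd' aB aa bb.
have b0 : 0 < b by exact: lt_le_trans bd.
have b0' : 0 < b' by exact: lt_le_trans bd'.
have -> : a / b - a' / b' = ((a - a') - a' / b' * (b - b')) / b.
  by field; rewrite !gt_eqF.
have B0 : 0 <= B by exact: le_trans aB.
have q : `|a' / b'| <= B / d0.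
  rewrite normrM normfV (gtr0_norm b0') ler_pM// ?invr_ge0 ?(ltW b0')//.
  by rewrite lef_pV2 ?posrE.
rewrite normrM normfV (gtr0_norm b0) [leRHS]mulrAC ler_pM// ?invr_ge0 ?(ltW b0)//; last first.
  by rewrite lef_pV2 ?posrE.
apply: le_trans (ler_normB _ _) _; rewrite mulrDl lerD// normrM.
have -> : B * Lb / d0 * D = (B / d0) * (Lb * D) by ring.
by rewrite ler_pM.
Qed.

Let LH := (1 + M * (2 * M) / d0) / d0.
Let LG := (2 * M + (1 + M ^+ 2) * (2 * M) / d0) / d0.

Let M0 : 0 < M. Proof. exact: lt_le_trans mM. Qed.

Let H_lip t r r' : m <= r <= M -> m <= r' <= M ->
  `|r / prufer_den t r - r' / prufer_den t r'| <= LH * `|r - r'|.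
Proof.
move=> rb rb'; apply: quot_lip.
- by apply: prufer_den_ge; case/andP: rb.
- by apply: prufer_den_ge; case/andP: rb'.
- by case/andP: rb' => h h'; rewrite ger0_norm// (le_trans (ltW m0)).
- by rewrite mul1r.
- exact: den_lip.
Qed.

Let sq_bnd r : m <= r <= M -> `|1 - r ^+ 2| <= 1 + M ^+ 2.
Proof.
move=> /andP[h h']; apply: le_trans (ler_normB _ _) _; rewrite normr1 lerD2l.
rewrite ger0_norm ?sqr_ge0// ler_pXn2r ?nnegrE ?(ltW M0)//.
exact: le_trans (ltW m0) h.
Qed.

Let G_lip t r r' : m <= r <= M -> m <= r' <= M ->
  `|sin t * cos t * (1 - r ^+ 2) / prufer_den t r -
    sin t * cos t * (1 - r' ^+ 2) / prufer_den t r'| <= LG * `|r - r'|.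
Proof.
move=> rb rb'; apply: quot_lip.
- by apply: prufer_den_ge; case/andP: rb.
- by apply: prufer_den_ge; case/andP: rb'.
- rewrite normrM -[leRHS]mul1r ler_pM//; exact: sq_bnd.
- have -> : sin t * cos t * (1 - r ^+ 2) - sin t * cos t * (1 - r' ^+ 2) =
    sin t * cos t * ((r' + r) * (r' - r)) by ring.
  rewrite normrM -[leRHS]mul1r ler_pM// normrM distrC ler_wpM2r//.
  case/andP: rb => ? ?; case/andP: rb' => ? ?.
  by rewrite ger0_norm; have := m0; lra.
- exact: den_lip.
Qed.

Let K := Num.sqrt mu^-1.

Lemma slope_le y : k y <= K.
Proof.
rewrite -(ger0_norm (slope_ge0 mu0 p0 p1 y : 0 <= k y)) -sqrtr_sqr ler_sqrt ?slope_sqr_le//.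
by rewrite invr_ge0 ltW.
Qed.

Let HM t x : 0 <= rho x / prufer_den t (rho x) <= M / d0.
Proof.
have /andP[h h'] := rho_bnd x; have r0 : 0 <= rho x by exact: le_trans (ltW m0) h.
have D0 := prufer_den_gt0 t h.
rewrite divr_ge0 ?(ltW D0)//= ler_pM// ?invr_ge0 ?(ltW D0)//.
by rewrite lef_pV2 ?posrE//; exact: prufer_den_ge.
Qed.

Lemma prufer_lipschitz : exists2 L : R, 0 < L & forall t x s x' s' : R,
  `|prufer_x t x s - prufer_x t x' s'| <= L * (`|x - x'| + `|s - s'|) /\
  `|prufer_s t x s - prufer_s t x' s'| <= L * (`|x - x'| + `|s - s'|).
Proof.
have K0 : 0 <= K by exact: sqrtr_ge0.
have Md : 0 <= M / d0 by rewrite divr_ge0 ?ltW.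
have LH0 : 0 <= LH.
  by rewrite divr_ge0 ?(ltW d0_gt0)// addr_ge0// divr_ge0 ?(ltW d0_gt0)// !mulr_ge0 ?(ltW M0).
have LG0 : 0 <= LG.
  by rewrite divr_ge0 ?(ltW d0_gt0)// addr_ge0// ?divr_ge0 ?(ltW d0_gt0)// !mulr_ge0 ?addr_ge0 ?sqr_ge0 ?(ltW M0).
exists (K * (M / d0) + K * LH * N + LG * N + 1).
  have a1 : 0 <= K * (M / d0) by rewrite mulr_ge0.
  have a2 : 0 <= K * LH * N by apply: mulr_ge0 => //; exact: mulr_ge0.
  have a3 : 0 <= LG * N by exact: mulr_ge0.
  by lra.
move=> t x s x' s'.
have N1 := rho_lip x x'; have D0 := normr_ge0 (x - x'); have E0 := normr_ge0 (s - s').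
split.
- have -> : prufer_x t x s - prufer_x t x' s' =
    (k (expR s * sin t) - k (expR s' * sin t)) * (rho x / prufer_den t (rho x)) +
    k (expR s' * sin t) * (rho x / prufer_den t (rho x) - rho x' / prufer_den t (rho x')).
    by rewrite /prufer_x; ring.
  apply: le_trans (ler_normD _ _) _.
  have h1 : `|(k (expR s * sin t) - k (expR s' * sin t)) * (rho x / prufer_den t (rho x))|
      <= K * `|s - s'| * (M / d0).
    rewrite normrM ler_pM//; first exact: slope_log_lipschitz.
    by have /andP[h0 h1] := HM t x; rewrite ger0_norm.
  have h2 : `|k (expR s' * sin t) * (rho x / prufer_den t (rho x) - rho x' / prufer_den t (rho x'))|
      <= K * (LH * (N * `|x - x'|)).
    rewrite normrM ler_pM//; first by rewrite ger0_norm ?slope_le// slope_ge0.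
    by apply: le_trans (H_lip _ _ _) _ => //; rewrite ler_wpM2l.
  apply: le_trans (lerD h1 h2) _.
  have a1 : 0 <= K * (M / d0) by rewrite mulr_ge0.
  have a2 : 0 <= K * LH * N by apply: mulr_ge0 => //; exact: mulr_ge0.
  have a3 : 0 <= LG * N by exact: mulr_ge0.
  have e1 : K * `|s - s'| * (M / d0) = K * (M / d0) * `|s - s'| by ring.
  have e2 : K * (LH * (N * `|x - x'|)) = K * LH * N * `|x - x'| by ring.
  rewrite e1 e2; move: a1 a2 a3; move: (K * (M / d0)) (K * LH * N) (LG * N) => u v w.
  by nra.
- apply: (@le_trans _ _ (LG * (N * `|x - x'|))).
    by apply: le_trans (G_lip _ _ _) _ => //; rewrite ler_wpM2l.
  have a1 : 0 <= K * (M / d0) by rewrite mulr_ge0.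
  have a2 : 0 <= K * LH * N by apply: mulr_ge0 => //; exact: mulr_ge0.
  have a3 : 0 <= LG * N by exact: mulr_ge0.
  rewrite mulrA; move: a1 a2 a3; move: (K * (M / d0)) (K * LH * N) (LG * N) => u v w.
  by nra.
Qed.

Let B := K * (M / d0) + (1 + M ^+ 2) / d0.

Lemma prufer_bounded : exists2 B : R, 0 < B & forall t x s : R,
  [/\ `|prufer_x t x s| <= B, `|prufer_s t x s| <= B &
      prufer_x t x s <= B * k (expR s * sin t)].
Proof.
have a1 : 0 <= K * (M / d0).
  by rewrite mulr_ge0 ?sqrtr_ge0// divr_ge0 ?ltW.
have a2 : 0 < (1 + M ^+ 2) / d0 by rewrite divr_gt0// ltr_wpDr ?sqr_ge0.
have a3 : 0 <= M / d0 by rewrite divr_ge0 ?ltW.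
exists (B + M / d0); first by rewrite ltr_wpDr// /B ltr_wpDl.
move=> t x s; have /andP[h0 h1] := HM t x; split.
- rewrite /prufer_x normrM !ger0_norm ?slope_ge0//.
  apply: (@le_trans _ _ (K * (M / d0))); last by rewrite /B; lra.
  by rewrite ler_pM ?slope_ge0// slope_le.
- apply: (@le_trans _ _ ((1 + M ^+ 2) / d0)); last by rewrite /B; lra.
  have /andP[m1 _] := rho_bnd x.
  have D0 := prufer_den_gt0 t m1.
  rewrite /prufer_s normrM normfV (gtr0_norm D0) ler_pM// ?invr_ge0 ?(ltW D0)//.
    by rewrite normrM -[leRHS]mul1r ler_pM// sq_bnd.
  by rewrite lef_pV2 ?posrE//; exact: prufer_den_ge.
- rewrite /prufer_x mulrC ler_wpM2r ?slope_ge0//.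
  by rewrite (le_trans h1)// lerDr /B addr_ge0// ltW.
Qed.

Let rho_cont : continuous rho.
Proof. exact: lipschitz_continuous rho_lip. Qed.

Let den_cont (X : R -> R) : continuous X ->
  continuous (fun t => prufer_den t (rho (X t))).
Proof.
move=> cX t; have cr : (fun t => rho (X t)) t @[t --> t] --> rho (X t).
  by apply: continuous_comp; [exact: cX|exact: rho_cont].
apply: cvgD.
  by apply: cvgM; exact: continuous_cos.
by apply: cvgM; apply: cvgM => //; exact: continuous_sin.
Qed.

Lemma prufer_x_continuous (X S : R -> R) : continuous X -> continuous S ->
  continuous (fun t => prufer_x t (X t) (S t)).
Proof.
move=> cX cS t; have cr : (fun t => rho (X t)) t @[t --> t] --> rho (X t).
  by apply: continuous_comp; [exact: cX|exact: rho_cont].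
apply: cvgM.
  apply: (@continuous_comp _ _ _ (fun t => expR (S t) * sin t) k).
    apply: cvgM; last exact: continuous_sin.
    by apply: (@continuous_comp _ _ _ S expR); [exact: cS|exact: continuous_expR].
  exact: slope_continuous.
apply: cvgM => //; apply: cvgV; last exact: den_cont.
by have /andP[h _] := rho_bnd (X t); rewrite gt_eqF// prufer_den_gt0.
Qed.

Lemma prufer_s_continuous (X S : R -> R) : continuous X -> continuous S ->
  continuous (fun t => prufer_s t (X t) (S t)).
Proof.
move=> cX cS t; have cr : (fun t => rho (X t)) t @[t --> t] --> rho (X t).
  by apply: continuous_comp; [exact: cX|exact: rho_cont].
apply: cvgM; last first.
  apply: cvgV; last exact: den_cont.
  by have /andP[h _] := rho_bnd (X t); rewrite gt_eqF// prufer_den_gt0.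
apply: cvgM.
  by apply: cvgM; [exact: continuous_sin|exact: continuous_cos].
apply: cvgB; first exact: cvg_cst.
by apply: cvgM.
Qed.

(** [X s0 t] is the position at which the orbit starting from [x = 0] with
    [y = 0], [z = e^s0] has the angle [t]. *)
Lemma prufer_flow : exists X S : R -> R -> R, exists A : R,
  [/\ forall s0, X s0 0 = 0 /\ S s0 0 = s0,
      forall s0 t : R, is_derive t 1 (X s0) (prufer_x t (X s0 t) (S s0 t)),
      forall s0 t : R, is_derive t 1 (S s0) (prufer_s t (X s0 t) (S s0 t)) &
      forall s0 s1 t, 0 <= t -> (X s0 t - X s1 t) ^+ 2 + (S s0 t - S s1 t) ^+ 2
         <= expR (A * t) * (s0 - s1) ^+ 2].
Proof.
have [L L0 lip] := prufer_lipschitz; have [C C0 bnd] := prufer_bounded.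
have lip1 t x s x' s' := proj1 (lip t x s x' s').
have lip2 t x s x' s' := proj2 (lip t x s x' s').
have bnd1 t x s : `|prufer_x t x s| <= C by have [] := bnd t x s.
have bnd2 t x s : `|prufer_s t x s| <= C by have [] := bnd t x s.
have ex s0 := ode_exists L0 C0 lip1 lip2 bnd1 bnd2
  prufer_x_continuous prufer_s_continuous s0.
have /choice[XS XSP] := ex.
exists (fun s0 => (XS s0).1), (fun s0 => (XS s0).2), (4 * L).
split=> [s0|s0 t|s0 t|s0 s1 t t0].
- by have [] := XSP s0.
- by have [_ _ +] := XSP s0.
- by have [_ _ _ +] := XSP s0.
have [x0 s00 dx0 ds0] := XSP s0; have [x1 s11 dx1 ds1] := XSP s1.
have := ode_gronwall L0 lip1 lip2 dx0 ds0 dx1 ds1 t0.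
by rewrite x0 x1 s00 s11 subrr expr0n/= add0r.
Qed.

End vector_field.

(** * Shooting *)

(** Shooting from a Dirichlet condition at [0] to a Robin condition
    [w + kappa v = 0] at [ell], along the orbits of the Prufer flow, whose
    properties are collected as hypotheses on [X] and [S]. *)
Section shooting.
Variables (R : realType) (mu p ell : R) (rho drho : R -> R) (m M N : R).
Hypotheses (mu0 : 0 < mu) (p0 : 0 < p) (p1 : p < 1) (ell0 : 0 < ell).
Hypotheses (m0 : 0 < m) (N0 : 0 <= N).
Hypothesis rho_bnd : forall x, m <= rho x <= M.
Hypothesis rho_lip : forall x y, `|rho x - rho y| <= N * `|x - y|.
Hypothesis rho_der : forall x : R, 0 < x < ell -> is_derive x 1 rho (drho x).

Let k := slope mu0 p0 p1.
Let V := amplitude mu0 p0 p1.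

Let mM : m <= M.
Proof. by have /andP[a b] := rho_bnd 0; exact: le_trans b. Qed.

Let M0 : 0 < M. Proof. exact: lt_le_trans mM. Qed.

Let r0 x : 0 < rho x.
Proof. by have /andP[a _] := rho_bnd x; exact: lt_le_trans a. Qed.

Let den0 t x : 0 < prufer_den t (rho x).
Proof. by have /andP[a _] := rho_bnd x; exact: prufer_den_gt0 a. Qed.

Variables (X S : R -> R -> R) (A B : R).
Hypothesis B0 : 0 < B.
Hypothesis init : forall s, X s 0 = 0 /\ S s 0 = s.
Hypothesis dX : forall s t : R,
  is_derive t 1 (X s) (prufer_x rho mu0 p0 p1 t (X s t) (S s t)).
Hypothesis dS : forall s t : R,
  is_derive t 1 (S s) (prufer_s rho t (X s t) (S s t)).
Hypothesis dep : forall s s' t, 0 <= t ->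
  (X s t - X s' t) ^+ 2 + (S s t - S s' t) ^+ 2 <= expR (A * t) * (s - s') ^+ 2.
Hypothesis bnd : forall t x s, [/\ `|prufer_x rho mu0 p0 p1 t x s| <= B,
  `|prufer_s rho t x s| <= B &
  prufer_x rho mu0 p0 p1 t x s <= B * k (expR s * sin t)].

Let px := prufer_x rho mu0 p0 p1.

Let px_ge0 t x s : 0 <= px t x s.
Proof. by rewrite /px /prufer_x mulr_ge0 ?slope_ge0// divr_ge0 ?ltW. Qed.

Let X_continuous s : continuous (X s).
Proof. by move=> t; exact: is_derive1_continuous (dX s t). Qed.

Let X_le s a b : a <= b -> X s a <= X s b.
Proof.
move=> ab; apply: (derive_ge0_le ab _ (fun z _ => dX s z)) => [|z _].
  exact: continuous_subspaceT.
exact: px_ge0.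
Qed.

(* [X s] has critical points, at the multiples of [pi], but is constant on no
   interval since [sin] vanishes on none. *)
Let X_lt s a b : a < b -> X s a < X s b.
Proof.
move=> ab; rewrite lt_neqAle X_le ?ltW// andbT; apply/eqP => e.
have cst t : a <= t <= b -> X s t = X s a.
  move=> /andP[at_ tb]; apply/eqP; rewrite eq_le; apply/andP.
  by split; [rewrite e; exact: X_le|exact: X_le].
have s0 t : a < t < b -> sin t = 0.
  move=> /andP[at_ tb].
  have d0 : is_derive t 1 (X s) 0.
    apply: (@is_derive_near_eq _ (fun _ => X s a)).
    near=> u; rewrite cst//; apply/andP; split; apply: ltW.
      by near: u; exact: lt_nbhsr.
    by near: u; exact: lt_nbhsl.
  have := is_derive_derive1 d0; rewrite (is_derive_derive1 (dX s t)) => /eqP.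
  rewrite /prufer_x mulf_eq0 [X in _ || X]gt_eqF ?divr_gt0// orbF => /eqP k0.
  apply/eqP; apply: contraT => st.
  have : 0 < k (expR (S s t) * sin t).
    by apply: slope_gt0; rewrite mulf_neq0// gt_eqF// expR_gt0.
  by rewrite /k k0 ltxx.
pose c := (a + b) / 2.
have cab : a < c < b by rewrite /c; apply/andP; split; lra.
have dc : is_derive c 1 sin (0 : R).
  apply: (@is_derive_near_eq _ (fun _ => 0)).
  case/andP: cab => ac cb.
  near=> u; rewrite s0//; apply/andP; split.
    by near: u; exact: lt_nbhsr.
  by near: u; exact: lt_nbhsl.
have := is_derive_derive1 dc; rewrite (is_derive_derive1 (is_derive_sin c)) => c0.
by have := cos2Dsin2 c; rewrite c0 s0// expr0n/= addr0 => /eqP; rewrite eq_sym oner_eq0.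
Unshelve. all: by end_near. Qed.

Let X_inj s t t' : X s t = X s t' -> t = t'.
Proof.
by move=> e; have [/(X_lt s)|/(X_lt s)|//] := ltgtP t t'; rewrite e ltxx.
Qed.

Let y s t := expR (S s t) * sin t.
Let z s t := expR (S s t) * cos t.

Let dy s (t : R) : is_derive t 1 (y s) (z s t / prufer_den t (rho (X s t))).
Proof.
have := dS s t => ?; rewrite /y /z; apply: is_derive_eq.
have := den0 t (X s t); rewrite /GRing.scale /= /prufer_s /prufer_den.
rewrite cos2sin2; move: (rho _) (sin t) (cos t) (expR _) => r sn cs e /gt_eqF/negbT d.
by field; move: d; congr (_ != 0); ring.
Qed.

Let dz s (t : R) : is_derive t 1 (z s)
  (- (rho (X s t) ^+ 2 * y s t / prufer_den t (rho (X s t)))).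
Proof.
have := dS s t => ?; rewrite /y /z; apply: is_derive_eq.
have := den0 t (X s t); rewrite /GRing.scale /= /prufer_s /prufer_den.
rewrite sin2cos2; move: (rho _) (sin t) (cos t) (expR _) => r sn cs e /gt_eqF/negbT d.
by field; move: d; congr (_ != 0); ring.
Qed.

Let y_continuous s : continuous (y s).
Proof. by move=> t; exact: is_derive1_continuous (dy s t). Qed.

Let z_continuous s : continuous (z s).
Proof. by move=> t; exact: is_derive1_continuous (dz s t). Qed.

Let rho_continuous : continuous rho.
Proof. exact: lipschitz_continuous rho_lip. Qed.

Let rhoX_continuous s : continuous (fun t => rho (X s t)).
Proof. by move=> t; apply: continuous_comp; [exact: X_continuous|exact: rho_continuous]. Qed.

(* The quantity [En = y^2 + v'^2] is conserved when [rho] is constant; in general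
   its logarithmic derivative with respect to [x] is at most [c0] in absolute
   value, so [En * expR (c X)] is monotone for [c = c0] and for [c = - c0]. *)
Let En s t := y s t ^+ 2 + (z s t / rho (X s t)) ^+ 2.
Let W c s t := En s t * expR (c * X s t).

Let W_continuous c s : continuous (W c s).
Proof.
move=> t; apply: cvgM.
  apply: cvgD; first by apply: cvgM; exact: y_continuous.
  have h : (fun t => z s t / rho (X s t)) t @[t --> t] --> z s t / rho (X s t).
    apply: cvgM; first exact: z_continuous.
    by apply: cvgV; [rewrite gt_eqF|exact: rhoX_continuous].
  exact: cvgM.
apply: (@continuous_comp _ _ _ (fun t => c * X s t) expR); last exact: continuous_expR.
by apply: cvgM; [exact: cvg_cst|exact: X_continuous].
Qed.

Let dW c s (t : R) : 0 < X s t < ell -> let r := rho (X s t) in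
  is_derive t 1 (W c s) (expR (c * X s t) * px t (X s t) (S s t) *
    (c * y s t ^+ 2 + (z s t / r) ^+ 2 * (c - 2 * drho (X s t) / r))).
Proof.
move=> Xt r; rewrite /W /En.
have d1 := dy s t; have d2 := dz s t; have d3 := dX s t.
have d4 := is_derive1_comp (rho_der Xt) d3.
have rn : rho (X s t) != 0 by rewrite gt_eqF.
have d5 : is_derive t 1 (fun t => (rho (X s t))^-1)
   (- (rho (X s t)) ^- 2 *: (drho (X s t) * px t (X s t) (S s t))).
  exact: (is_deriveV rn d4).
apply: is_derive_eq.
rewrite /GRing.scale /= -/r -/px; have /gt_eqF/negbT dn := den0 t (X s t).
rewrite -/r in dn rn.
by field; rewrite rn dn.
Qed.

Let c0 := 2 * N / m.

Let c0_ge0 : 0 <= c0. Proof. by rewrite /c0 divr_ge0 ?(ltW m0)// mulr_ge0. Qed.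

Hypothesis drho_bnd : forall x, 0 < x < ell -> `|drho x| <= N.

Let drho_c0 x : 0 < x < ell -> `|2 * drho x / rho x| <= c0.
Proof.
move=> xb; rewrite normrM normfV (gtr0_norm (r0 x)) normrM (ger0_norm (_ : 0 <= 2))//.
rewrite ler_pM// ?mulr_ge0// ?invr_ge0 ?(ltW (r0 x))//.
  by rewrite ler_wpM2l// drho_bnd.
by rewrite lef_pV2 ?posrE//; case/andP: (rho_bnd x).
Qed.

Let Xin s t u : X s t <= ell -> u \in `]0, t[ -> 0 < X s u < ell.
Proof.
move=> Xt; rewrite in_itv /= => /andP[u0 ut].
have [X0 _] := init s; rewrite -{1}X0 X_lt//=.
by apply: lt_le_trans Xt; exact: X_lt.
Qed.

Let energy s t : 0 <= t -> X s t <= ell ->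
  En s 0 <= En s t * expR (c0 * ell) /\ En s t <= En s 0 * expR (c0 * ell).
Proof.
move=> t0 Xt; have [X0 _] := init s.
have X_ge0 : 0 <= X s t by rewrite -X0 X_le.
have E0 u : 0 <= En s u by rewrite addr_ge0 ?sqr_ge0.
have up : W c0 s 0 <= W c0 s t.
  apply: (derive_ge0_le t0 _ (fun u hu => dW c0 (Xin Xt hu))) => [|u /(Xin Xt) hu].
    exact: continuous_subspaceT.
  apply: mulr_ge0; first by apply: mulr_ge0; [exact: expR_ge0|exact: px_ge0].
  apply: addr_ge0; first by rewrite mulr_ge0 ?sqr_ge0.
  apply: mulr_ge0; first exact: sqr_ge0.
  by rewrite subr_ge0; exact: le_trans (ler_norm _) (drho_c0 hu).
have down : - W (- c0) s 0 <= - W (- c0) s t.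
  have dN u (hu : u \in `]0, t[) := is_deriveN (dW (- c0) (Xin Xt hu)).
  apply: (derive_ge0_le t0 _ dN) => [|u /(Xin Xt) hu].
    by apply: continuous_subspaceT => u; apply: cvgN; exact: W_continuous.
  rewrite -mulrN; apply: mulr_ge0.
    by apply: mulr_ge0; [exact: expR_ge0|exact: px_ge0].
  rewrite opprD mulNr opprK; apply: addr_ge0; first by rewrite mulr_ge0 ?sqr_ge0.
  rewrite -mulrN; apply: mulr_ge0; first exact: sqr_ge0.
  rewrite opprB opprK.
  have := le_trans (ler_norm _) (eq_ind_r (fun q => q <= c0) (drho_c0 hu) (normrN _)).
  by lra.
have e1 : expR (c0 * X s t) <= expR (c0 * ell) by rewrite ler_expR ler_wpM2l.
split.
- move: up; rewrite /W X0 mulr0 expR0 mulr1 => /le_trans; apply.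
  by rewrite ler_wpM2l.
- move: down; rewrite /W lerN2 X0 mulr0 expR0 mulr1 mulNr expRN.
  rewrite ler_pdivrMr ?expR_gt0// => /le_trans; apply.
  by rewrite ler_wpM2l.
Qed.

Let En0 s : En s 0 = (expR s / rho 0) ^+ 2.
Proof.
have [X0 S0] := init s.
by rewrite /En /y /z X0 S0 sin0 cos0 mulr0 mulr1 expr0n/= add0r.
Qed.

Let slope_sin s t : sin t ^+ 2 * k (expR s) <= k (expR s * sin t).
Proof.
have -> : k (expR s * sin t) = k (`|sin t| * expR s).
  rewrite mulrC; have [h|/ltW h] := leP 0 (sin t); first by rewrite ger0_norm.
  by rewrite ler0_norm// mulNr /k slopeN.
have h1 : `|sin t| <= 1 by exact: sin_max.
apply: le_trans (slope_scale mu0 p0 p1 (normr_ge0 _) h1 (expR_ge0 s)).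
rewrite ler_wpM2r ?slope_ge0// -real_normK ?num_real//.
by rewrite expr2 ler_piMl.
Qed.

(* If the orbit stayed in [[0, ell]] its energy, hence [e^S], would be bounded
   below by some [q > 0], and the derivative of [X] would be at least
   [c * sin t ^+ 2], which has the unbounded primitive
   [c * (t - sin t * cos t) / 2]. *)
Let reach s : exists2 t, 0 <= t & ell < X s t.
Proof.
apply: contrapT => H.
have Xle t : 0 <= t -> X s t <= ell.
  by move=> t0; rewrite leNgt; apply/negP => lt; apply: H; exists t.
pose c1 := 1 + m ^- 2.
have c1_gt0 : 0 < c1 by rewrite addr_gt0// invr_gt0 exprn_gt0.
have EnS t : En s t <= expR (S s t) ^+ 2 * c1.
  have [h1 h2] := sin2_ge0_le1 t.
  have h3 : cos t ^+ 2 <= 1 by have := cos2Dsin2 t; lra.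
  have h4 : (rho (X s t)) ^- 2 <= m ^- 2.
    rewrite lef_pV2 ?posrE ?exprn_gt0// ler_pXn2r ?nnegrE ?(ltW m0) ?(ltW (r0 _))//.
    by case/andP: (rho_bnd (X s t)).
  have -> : En s t = expR (S s t) ^+ 2 *
      (sin t ^+ 2 + cos t ^+ 2 * (rho (X s t)) ^- 2).
    by rewrite /En /y /z; field; rewrite gt_eqF.
  rewrite ler_wpM2l ?sqr_ge0// /c1 lerD// -[leRHS]mul1r ler_pM ?sqr_ge0// invr_ge0 sqr_ge0//.
pose q2 := En s 0 / (c1 * expR (c0 * ell)).
have q2_gt0 : 0 < q2.
  by rewrite divr_gt0 ?mulr_gt0 ?expR_gt0// En0 exprn_gt0// divr_gt0// expR_gt0.
pose q := Num.sqrt q2.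
have q0 : 0 < q by rewrite sqrtr_gt0.
have Sq t : 0 <= t -> q <= expR (S s t).
  move=> t0; rewrite -(@ler_pXn2r _ 2) ?nnegrE ?(ltW q0) ?expR_ge0//.
  rewrite /q sqr_sqrtr ?(ltW q2_gt0)// ler_pdivrMr ?mulr_gt0 ?expR_gt0//.
  have [h _] := energy t0 (Xle _ t0).
  apply: le_trans h _; rewrite mulrA ler_wpM2r ?expR_ge0//.
pose c := k q * (m / (1 + M ^+ 2)).
have M2 : 0 < 1 + M ^+ 2 by rewrite ltr_wpDr ?sqr_ge0.
have c_gt0 : 0 < c.
  by apply: mulr_gt0; [apply: slope_gt0; rewrite gt_eqF|exact: divr_gt0].
have pxc t : 0 <= t -> c * sin t ^+ 2 <= px t (X s t) (S s t).
  move=> t0; rewrite /c mulrAC /px /prufer_x ler_pM//.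
  - by rewrite mulr_ge0 ?slope_ge0 ?sqr_ge0.
  - by rewrite divr_ge0 ?ltW.
  - apply: le_trans (slope_sin _ _); rewrite mulrC ler_wpM2l ?sqr_ge0//.
    by apply: slope_nondecreasing; [exact: ltW|exact: Sq].
  - have /andP[h1 h2] := rho_bnd (X s t).
    rewrite ler_pM ?(ltW m0) ?invr_ge0 ?(ltW M2)//.
    rewrite lef_pV2 ?posrE// /prufer_den.
    have [h3 h4] := sin2_ge0_le1 t.
    have h5 : cos t ^+ 2 <= 1 by have := cos2Dsin2 t; lra.
    rewrite lerD// -[leRHS]mulr1 ler_pM ?sqr_ge0//.
    by rewrite ler_pXn2r ?nnegrE ?(ltW M0) ?(ltW (r0 _)).
have lower t : 0 <= t -> c * (t - sin t * cos t) / 2 <= X s t.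
  move=> t0.
  pose F t := X s t - c * (t - sin t * cos t) / 2.
  have dF (u : R) : is_derive u 1 F (px u (X s u) (S s u) - c * sin u ^+ 2).
    have := dX s u => ?; rewrite /F; apply: is_derive_eq.
    rewrite /GRing.scale /= -/px; have := cos2Dsin2 u.
    move: (px _ _ _) (sin u) (cos u) => P sn cs e; have -> : sn * - sn = - (1 - cs ^+ 2) by lra.
    have -> : sn ^+ 2 = 1 - cs ^+ 2 by lra.
    by field.
  have : F 0 <= F t.
    apply: (derive_ge0_le t0 _ (fun u _ => dF u)) => [|u].
      by apply: continuous_subspaceT => u; exact: is_derive1_continuous (dF u).
    by rewrite in_itv /= => /andP[/ltW u0 _]; rewrite subr_ge0 pxc.
  have -> : F 0 = 0 by rewrite /F (init s).1 sin0; ring.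
  by rewrite /F subr_ge0.
pose t := 2 * ell / c + 2.
have t0 : 0 <= t by rewrite /t addr_ge0// divr_ge0 ?(ltW c_gt0)// mulr_ge0// ltW.
have := le_trans (lower t t0) (Xle t t0).
have sc : sin t * cos t <= 1.
  have := cos2Dsin2 t; have := sqr_ge0 (cos t - sin t); nra.
have : c * (t - 1) / 2 <= c * (t - sin t * cos t) / 2.
  by rewrite ler_pM2r// ler_pM2l//; lra.
move=> h1 h2; have := le_trans h1 h2.
have -> : c * (t - 1) / 2 = ell + c / 2 by rewrite /t; field; rewrite gt_eqF.
by have := c_gt0; lra.
Qed.

Let reach_eq s : exists t, 0 < t /\ X s t = ell.
Proof.
have [t t0 Xt] := reach s; have [X0 _] := init s.
have [||u ut e] := @IVT R (X s) 0 t ell t0.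
- exact: continuous_subspaceT.
- by rewrite X0 min_l ?max_r ?(ltW ell0) ?(ltW Xt)// (le_trans (ltW ell0)) ?ltW.
exists u; split=> //; rewrite lt_neqAle (itvP ut) andbT.
by apply/eqP => u0; move: e; rewrite -u0 X0 => /esym/eqP; rewrite gt_eqF.
Qed.

(* [tp s] is the angle at which the orbit arrives at [ell]. *)
Let tpS : { tp : R -> R | forall s, 0 < tp s /\ X s (tp s) = ell }.
Proof. by apply: cid; have /choice[f fP] := reach_eq; exists f. Qed.

Let tp := sval tpS.
Let tp_gt0 s : 0 < tp s. Proof. by have [] := svalP tpS s. Qed.
Let X_tp s : X s (tp s) = ell. Proof. by have [] := svalP tpS s. Qed.

Let lt_tp s t : (t < tp s) = (X s t < ell).
Proof.
apply/idP/idP => [|h]; first by move=> /(X_lt s); rewrite X_tp.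
by rewrite ltNge; apply/negP => /(X_le s); rewrite X_tp leNgt h.
Qed.

Let gt_tp s t : (tp s < t) = (ell < X s t).
Proof.
apply/idP/idP => [|h]; first by move=> /(X_lt s); rewrite X_tp.
by rewrite ltNge; apply/negP => /(X_le s); rewrite X_tp leNgt h.
Qed.

Let dep1 t : 0 <= t -> continuous (fun s => X s t).
Proof.
move=> t0; apply: (@lipschitz_continuous _ _ (Num.sqrt (expR (A * t)))) => s s'.
rewrite -(@ler_pXn2r _ 2) ?nnegrE ?mulr_ge0 ?sqrtr_ge0//.
rewrite exprMn sqr_sqrtr ?expR_ge0// !real_normK ?num_real//.
by apply: le_trans (dep _ _ t0); rewrite lerDl sqr_ge0.
Qed.

Let dep2 t : 0 <= t -> continuous (fun s => S s t).
Proof.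
move=> t0; apply: (@lipschitz_continuous _ _ (Num.sqrt (expR (A * t)))) => s s'.
rewrite -(@ler_pXn2r _ 2) ?nnegrE ?mulr_ge0 ?sqrtr_ge0//.
rewrite exprMn sqr_sqrtr ?expR_ge0// !real_normK ?num_real//.
by apply: le_trans (dep _ _ t0); rewrite lerDr sqr_ge0.
Qed.

Let tp_continuous : continuous tp.
Proof.
move=> s; apply/cvgrPdist_lt => e e0.
pose t1 := tp s - e / 2; pose t2 := tp s + e / 2.
have t2_ge0 : 0 <= t2 by have := tp_gt0 s; rewrite /t2; lra.
have n2 : \forall s' \near s, ell < X s' t2.
  have h : ell < X s t2 by rewrite -gt_tp /t2; lra.
  have := dep1 t2_ge0 (x := s); move/cvgrPdist_lt => /(_ (X s t2 - ell)).
  rewrite subr_gt0 => /(_ h); apply: filterS => s' /=.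
  by rewrite ltr_norml; lra.
have n1 : \forall s' \near s, t1 < tp s'.
  have [t1_ge0|t1_lt0] := leP 0 t1; last by near=> s'; exact: lt_trans (tp_gt0 s').
  have h : X s t1 < ell by rewrite -lt_tp /t1; lra.
  have := dep1 t1_ge0 (x := s); move/cvgrPdist_lt => /(_ (ell - X s t1)).
  rewrite subr_gt0 => /(_ h); apply: filterS => s' /=.
  by rewrite lt_tp ltr_norml; lra.
near=> s'.
have h1 : t1 < tp s' by near: s'.
have h2 : tp s' < t2 by rewrite gt_tp; near: s'.
by move: h1 h2; rewrite /t1 /t2 ltr_norml; lra.
Unshelve. all: by end_near. Qed.

Let S_tp_continuous : continuous (fun s => S s (tp s)).
Proof.
move=> s; apply/cvgrPdist_lt => e e0.
have e2 : 0 < e / 2 by rewrite divr_gt0.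
have eB : 0 < e / 2 / B by rewrite divr_gt0.
have := dep2 (ltW (tp_gt0 s)) (x := s); move/cvgrPdist_lt => /(_ _ e2) n1.
have := tp_continuous (x := s); move/cvgrPdist_lt => /(_ _ eB) n2.
near=> s'.
have h1 : `|S s (tp s) - S s' (tp s)| < e / 2 by near: s'.
have h2 : `|tp s - tp s'| < e / 2 / B by near: s'.
have h3 : `|S s' (tp s) - S s' (tp s')| <= B * `|tp s - tp s'|.
  by apply: (derive_le_dist (dS s')) => t; have [] := bnd t (X s' t) (S s' t).
have h4 : B * `|tp s - tp s'| < e / 2 by rewrite mulrC -ltr_pdivlMr.
have -> : S s (tp s) - S s' (tp s') =
  (S s (tp s) - S s' (tp s)) + (S s' (tp s) - S s' (tp s')) by ring.
by apply: le_lt_trans (ler_normD _ _) _; lra.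
Unshelve. all: by end_near. Qed.

(* Small orbits turn fast: [tp] tends to infinity at minus infinity. *)
Let small t s1 : 0 < t -> exists2 s, s < s1 & t < tp s.
Proof.
move=> t0.
have e0 : 0 < ell / (B * t) by rewrite divr_gt0// mulr_gt0.
have : k e @[e --> (0 : R)] --> (0 : R).
  by have := @slope_continuous _ _ _ mu0 p0 p1 0; rewrite /continuous_at slope0.
move/cvgrPdist_lt => /(_ _ e0) [d /= d0 dP].
pose eta := d / 2.
have eta0 : 0 < eta by rewrite divr_gt0.
have keta : k eta < ell / (B * t).
  have := dP eta; rewrite /= !sub0r !normrN gtr0_norm// (ger0_norm (slope_ge0 _ _ _ _)).
  by apply; rewrite /eta; lra.
pose s := Num.min (s1 - 1) (ln eta - B * t).
have ss1 : s < s1 by rewrite gt_min; apply/orP; left; lra.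
exists s => //; rewrite lt_tp.
have sln : s <= ln eta - B * t by rewrite ge_min lexx orbT.
have Su u : 0 <= u <= t -> expR (S s u) <= eta.
  move=> /andP[u0 ut]; rewrite -(lnK (_ : eta \is Num.pos)) ?posrE// ler_expR.
  have h : `|S s u - S s 0| <= B * `|u - 0|.
    by apply: (derive_le_dist (dS s)) => t'; have [] := bnd t' (X s t') (S s t').
  move: h; rewrite (init s).2 subr0 (ger0_norm u0) ler_norml => /andP[_ h].
  have : B * u <= B * t by rewrite ler_pM2l.
  by lra.
have up : X s t <= B * k eta * t.
  have dF (u : R) : is_derive u 1 (fun u => B * k eta * u - X s u)
      (B * k eta - px u (X s u) (S s u)).
    by have := dX s u => ?; apply: is_derive_eq; rewrite /GRing.scale /= mulr1.
  have : B * k eta * 0 - X s 0 <= B * k eta * t - X s t.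
    apply: (derive_ge0_le (ltW t0) _ (fun u _ => dF u)) => [|u].
      by apply: continuous_subspaceT => u; exact: is_derive1_continuous (dF u).
    rewrite in_itv /= => /andP[/ltW u0 /ltW ut]; rewrite subr_ge0.
    have [_ _ h] := bnd u (X s u) (S s u); apply: le_trans h _.
    rewrite ler_pM2l//.
    have -> : k (expR (S s u) * sin u) = k (expR (S s u) * `|sin u|).
      have [h|/ltW h] := leP 0 (sin u); first by rewrite ger0_norm.
      by rewrite ler0_norm// mulrN /k slopeN.
    apply: slope_nondecreasing; first by rewrite mulr_ge0 ?expR_ge0.
    by rewrite (le_trans _ (Su u _)) ?u0// ler_piMr ?expR_ge0// sin_max.
  by rewrite mulr0 (init s).1 subr0 subr_ge0.
apply: le_lt_trans up _.
by rewrite mulrAC mulrC -ltr_pdivlMr ?mulr_gt0.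
Qed.

Variable kappa : R.

(* The defect in the Robin condition at [ell]. *)
Let b s := z s (tp s) + kappa * V (y s (tp s)).

Let y_tp_continuous : continuous (fun s => y s (tp s)).
Proof.
move=> s; apply: cvgM.
  apply: (@continuous_comp _ _ _ (fun s => S s (tp s)) expR); last exact: continuous_expR.
  exact: S_tp_continuous.
by apply: (@continuous_comp _ _ _ tp sin); [exact: tp_continuous|exact: continuous_sin].
Qed.

Let b_continuous : continuous b.
Proof.
move=> s; apply: cvgD.
  apply: cvgM.
    apply: (@continuous_comp _ _ _ (fun s => S s (tp s)) expR); last exact: continuous_expR.
    exact: S_tp_continuous.
  by apply: (@continuous_comp _ _ _ tp cos); [exact: tp_continuous|exact: continuous_cos].
apply: cvgM; first exact: cvg_cst.
apply: (@continuous_comp _ _ _ (fun s => y s (tp s)) V); first exact: y_tp_continuous.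
exact: is_derive1_continuous (is_derive_amplitude mu0 p0 p1 _).
Qed.

Let sin_pin (n : nat) : sin (pi *+ n) = 0 :> R.
Proof. by elim: n => [|n IH]; rewrite ?mulr0n ?sin0// mulrSr sinDpi IH oppr0. Qed.

Let cos_pin (n : nat) : cos (pi *+ n.+1) = - cos (pi *+ n) :> R.
Proof. by rewrite mulrSr cosDpi. Qed.

Let IVT_continuous (f : R -> R) u v c : continuous f ->
  (f u <= c <= f v) -> exists2 w, Num.min u v <= w <= Num.max u v & f w = c.
Proof.
move=> cf /andP[uc cv].
have le : Num.min u v <= Num.max u v by rewrite ge_min !le_max !lexx.
have [||w wi e] := @IVT R f _ _ c le.
- exact: continuous_subspaceT.
- case: (leP u v) => uv; rewrite ge_min le_max uc cv ?orbT//.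
by exists w => //; rewrite in_itv in wi.
Qed.

(** At the parameters where the arrival angle [tp s] is a multiple [pi *+ j], the
    defect is [e^S * cos (pi *+ j)], whose sign alternates with [j]; two
    consecutive multiples are taken by the continuous function [tp] on the left
    of [s1], and the defect vanishes in between. *)
Lemma shooting_parameter s1 : exists2 s, s <= s1 & b s = 0.
Proof.
have [n n0] : exists n : nat, tp s1 < pi *+ n.
  exists (Num.Def.truncn (tp s1 / pi)).+1.
  by rewrite -mulr_natl -ltr_pdivrMr ?pi_gt0// truncnS_gt.
have pin0 : 0 < pi *+ n.+1 :> R by rewrite pmulrn_lgt0 ?pi_gt0.
have [s2 s21 tps2] := small s1 pin0.
have [w1 /andP[_ w1b] tw1] : exists2 w, Num.min s1 s2 <= w <= Num.max s1 s2 & tp w = pi *+ n.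
  apply: IVT_continuous; first exact: tp_continuous.
  by rewrite (ltW n0) (le_trans _ (ltW tps2))// mulrSr lerDl pi_ge0.
have [w2 /andP[_ w2b] tw2] : exists2 w, Num.min s1 s2 <= w <= Num.max s1 s2 & tp w = pi *+ n.+1.
  apply: IVT_continuous; first exact: tp_continuous.
  by rewrite (ltW tps2) andbT (le_trans (ltW n0))// mulrSr lerDl pi_ge0.
rewrite max_l ?(ltW s21)// in w1b w2b.
have bw w (j : nat) : tp w = pi *+ j -> b w = expR (S w (tp w)) * cos (pi *+ j).
  by move=> e; rewrite /b /y /z e sin_pin mulr0 /V amplitude0 mulr0 addr0.
have fin u v : u <= s1 -> v <= s1 -> b u <= 0 <= b v -> exists2 s, s <= s1 & b s = 0.
  move=> us vs /(IVT_continuous b_continuous)[w /andP[_ h] e]; exists w => //.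
  by rewrite (le_trans h)// ge_max us.
have [c0'|/ltW c0'] := leP 0 (cos (pi *+ n) : R).
- apply: (fin w2 w1) => //; rewrite (bw _ _ tw1) (bw _ _ tw2) cos_pin.
  by rewrite mulr_ge0_le0 ?mulr_ge0 ?expR_ge0// oppr_le0.
- apply: (fin w1 w2) => //; rewrite (bw _ _ tw1) (bw _ _ tw2) cos_pin.
  by rewrite mulr_ge0_le0 ?mulr_ge0 ?expR_ge0// oppr_ge0.
Qed.

(** The orbit found above, read as a function of [x = X s t]. The initial energy
    is chosen so that the energy estimate yields [mu * v ^+ 2 <= mu * delta ^+ 2]
    up to [ell]. *)
Lemma shooting_solution (delta : R) : 0 < delta -> exists v w : R -> R,
  [/\ forall x : R, 0 <= x <= ell -> is_derive x 1 v (w x / rho x) /\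
        is_derive x 1 w (- (rho x * nonlin mu p (v x))),
      v 0 = 0, w ell + kappa * v ell = 0,
      forall x, 0 <= x <= ell -> `|v x| <= delta &
      exists2 x, 0 < x < ell & v x != 0].
Proof.
move=> delta0.
have sm0 : 0 < Num.sqrt mu by rewrite sqrtr_gt0.
have [s ss1 bs] := shooting_parameter (ln (delta * m * Num.sqrt mu) - c0 * ell / 2).
have [tau tauK] : exists tau : R -> R, forall t, tau (X s t) = t.
  suff /choice[f fP] : forall x, exists t, forall t', X s t' = x -> t = t'.
    by exists f => t; exact: fP.
  move=> x; have [[t <-]|H] := pselect (exists t, X s t = x).
    by exists t => t' /esym; exact: X_inj.
  by exists 0 => t' e; case: H; exists t'.
have onto x : 0 <= x <= ell -> exists2 t, 0 <= t <= tp s & X s t = x.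
  move=> /andP[x0 xl].
  have [||u ut <-] := @IVT R (X s) 0 (tp s) x (ltW (tp_gt0 s)).
  - exact: continuous_subspaceT.
  - by rewrite (init s).1 X_tp min_l ?max_r ?(ltW ell0)// x0.
  by exists u => //; rewrite in_itv in ut.
have dX_ t := dX s t.
have dX0 t : 0 <= px t (X s t) (S s t) by exact: px_ge0.
have kV t : k (y s t) * nonlin mu p (V (y s t)) = y s t by exact: slope_amplitude.
pose g1 t := z s t / rho (X s t).
have cg1 : continuous g1.
  move=> t; apply: cvgM; first exact: z_continuous.
  by apply: cvgV; [rewrite gt_eqF|exact: rhoX_continuous].
have dVy (t : R) : is_derive t 1 (V \o y s) (g1 t * px t (X s t) (S s t)).
  have := is_derive1_comp (is_derive_amplitude mu0 p0 p1 (y s t)) (dy s t).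
  rewrite (_ : _ * (_ / _) = g1 t * px t (X s t) (S s t)) //.
  rewrite /g1 /px /prufer_x -/k -/(y s t).
  by field; rewrite !gt_eqF.
pose g2 t := - (rho (X s t) * nonlin mu p (V (y s t))).
have cg2 : continuous g2.
  move=> t; apply: cvgN; apply: cvgM; first exact: rhoX_continuous.
  apply: (@continuous_comp _ _ _ (V \o y s) (nonlin mu p)).
    exact: is_derive1_continuous (dVy t).
  exact: nonlin_continuous.
have dz2 (t : R) : is_derive t 1 (z s) (g2 t * px t (X s t) (S s t)).
  have := dz s t.
  rewrite (_ : - _ = g2 t * px t (X s t) (S s t)) //.
  rewrite /g2 /px /prufer_x -/k -/(y s t) -[X in _ * X / _](kV t).
  by field; rewrite gt_eqF.
exists (fun x => V (y s (tau x))), (fun x => z s (tau x)); split.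
- move=> x /onto[t _ <-]; split.
    have := is_derive_reparam t dX_ dX0 dVy cg1 tauK.
    by rewrite /g1 tauK.
  have := is_derive_reparam t dX_ dX0 dz2 cg2 tauK.
  by rewrite /g2 tauK.
- have -> : tau 0 = 0 by rewrite -{1}(init s).1 tauK.
  by rewrite /y sin0 mulr0 /V amplitude0.
- have -> : tau ell = tp s by rewrite -(X_tp s) tauK.
  exact: bs.
- move=> x /onto[t /andP[t0 ttp] <-]; rewrite tauK.
  have Xl : X s t <= ell by rewrite -(X_tp s) X_le.
  have [_ e2] := energy t0 Xl.
  rewrite -(@ler_pXn2r _ 2) ?nnegrE ?(ltW delta0)// real_normK ?num_real//.
  rewrite -(ler_pM2l mu0).
  apply: le_trans (amplitude_sqr_le mu0 p0 p1 _) _.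
  apply: (@le_trans _ _ (En s t)); first by rewrite lerDl sqr_ge0.
  apply: le_trans e2 _; rewrite En0.
  have h : expR s <= delta * m * Num.sqrt mu * expR (- (c0 * ell / 2)).
    rewrite -[X in X * expR _](lnK (_ : _ \is Num.pos)) ?posrE ?mulr_gt0//.
    by rewrite -expRD ler_expR.
  have h2 : expR s / rho 0 <= delta * Num.sqrt mu * expR (- (c0 * ell / 2)).
    rewrite ler_pdivrMr//; apply: le_trans h _.
    rewrite [leRHS](_ : _ = delta * rho 0 * Num.sqrt mu * expR (- (c0 * ell / 2))); last by ring.
    rewrite ler_wpM2r ?expR_ge0// ler_pM2r// ler_pM2l//.
    by case/andP: (rho_bnd 0).
  have h3 : (expR s / rho 0) ^+ 2 <= (delta * Num.sqrt mu * expR (- (c0 * ell / 2))) ^+ 2.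
    by rewrite ler_pXn2r ?nnegrE// ?divr_ge0 ?expR_ge0 ?(ltW (r0 _))// !mulr_ge0 ?expR_ge0 ?ltW.
  apply: le_trans (ler_wpM2r (expR_ge0 _) h3) _.
  have e1 : expR (- (c0 * ell / 2)) ^+ 2 * expR (c0 * ell) = 1.
    by rewrite expr2 -!expRD (_ : _ + _ = 0) ?expR0//; field.
  by rewrite !exprMn sqr_sqrtr ?(ltW mu0)// -[_ * _ * expR (c0 * ell)]mulrA e1 mulr1 mulrC.
- pose t := Num.min (tp s / 2) 1.
  have tp0 := tp_gt0 s.
  have t0 : 0 < t by rewrite lt_min ltr01 divr_gt0.
  have t1 : t <= 1 by rewrite ge_min lexx orbT.
  have ttp : t < tp s by rewrite gt_min; apply/orP; left; lra.
  exists (X s t).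
    by rewrite -lt_tp ttp andbT -{1}(init s).1 X_lt.
  rewrite tauK; apply/eqP => V0.
  have := kV t; rewrite V0 nonlin0 mulr0 => /esym/eqP.
  rewrite mulf_eq0 !gt_eqF ?expR_gt0//.
  by apply: sin2_gt0; rewrite t0/=; lra.
Qed.

End shooting.

(** * The two-point boundary value problem *)

(** Used with projections onto an interval or a rectangle: it turns functions
    that are continuous up to the boundary into globally continuous ones. *)
Lemma within_continuous_retract (T U : topologicalType) (A : set T)
    (f : T -> U) (c : T -> T) :
  {within A, continuous f} -> continuous c -> (forall x, A (c x)) ->
  continuous (f \o c).
Proof.
move=> /subspace_continuousP cf cc Ac x.
apply: (@cvg_comp _ _ _ c f (nbhs x) (within A (nbhs (c x))) _); last exact: cf.
move=> P /= wP; have := cc x _ wP; rewrite /= /nbhs /=; apply: filterS => y /=.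
by apply.
Qed.

Section clamp.
Variables (R : realType) (l : R).
Hypothesis l0 : 0 <= l.

Definition clamp (x : R) : R := Num.min (Num.max x 0) l.

Lemma clamp_bounds x : 0 <= clamp x <= l.
Proof. by rewrite /clamp le_min le_max lexx orbT l0 ge_min lexx orbT. Qed.

Lemma clamp_itv x : clamp x \in `[0, l].
Proof. by rewrite in_itv /=; exact: clamp_bounds. Qed.

Lemma clamp_id x : 0 <= x <= l -> clamp x = x.
Proof. by move=> /andP[x0 xl]; rewrite /clamp max_l// min_l. Qed.

Lemma clamp_lipschitz x y : `|clamp x - clamp y| <= `|x - y|.
Proof.
wlog xy : x y / y <= x => [H|].
  have [/H//|/ltW xy] := leP y x.
  by rewrite distrC (distrC x); exact: H.
rewrite [leRHS]ger0_norm ?subr_ge0// /clamp.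
have := l0; case: (leP x 0) => hx; case: (leP y 0) => hy;
  case: (leP 0 l) => ?; case: (leP x l) => ?; case: (leP y l) => ? ?;
  rewrite ler_norml; lra.
Qed.

Lemma clamp_continuous : continuous clamp.
Proof.
apply: (@lipschitz_continuous _ _ 1) => x y.
by rewrite mul1r; exact: clamp_lipschitz.
Qed.

Lemma within_continuous_clamp (f : R -> R) :
  {within `[0, l], continuous f} -> continuous (f \o clamp).
Proof.
move=> cf; apply: within_continuous_retract cf clamp_continuous _ => x.
exact: clamp_itv.
Qed.

End clamp.

Section boundary_value_problem.
Variables (R : realType) (mu p ell : R).
Hypotheses (mu0 : 0 < mu) (p0 : 0 < p) (p1 : p < 1) (ell0 : 0 < ell).

Definition weight (rho drho : R -> R) : Prop :=
  [/\ {within `[0, ell], continuous rho}, {within `[0, ell], continuous drho},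
      forall x, 0 <= x <= ell -> 0 < rho x &
      forall x : R, 0 < x < ell -> is_derive x 1 rho (drho x)].

(** The equation as a first-order system in [v] and the flux [w = rho v'], so that
    no second derivative of [v] and no derivative of [rho] is needed. *)
Definition stationary (rho v w : R -> R) : Prop :=
  [/\ {within `[0, ell], continuous v}, {within `[0, ell], continuous w} &
   forall x : R, 0 < x < ell -> is_derive x 1 v (w x / rho x) /\
     is_derive x 1 w (- (rho x * nonlin mu p (v x)))].

(** The flow requires a coefficient on the whole line: [rho] is continued by its
    boundary values, which keeps it Lipschitz and positive. *)
Lemma dirichlet_robin (rho drho : R -> R) (kappa delta : R) :
  weight rho drho -> 0 < delta -> exists v w : R -> R,
  [/\ stationary rho v w, v 0 = 0, w ell + kappa * v ell = 0,
      forall x, 0 <= x <= ell -> `|v x| <= delta &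
      exists2 x, 0 < x < ell & v x != 0].
Proof.
move=> [crho cdrho rho_gt0 drhoP] delta0.
pose rhoc := rho \o clamp ell.
have ell_ge0 := ltW ell0.
have [xm xmI xmP] := EVT_min ell_ge0 crho.
have [xM xMI xMP] := EVT_max ell_ge0 crho.
have rho_bnd x : rho xm <= rhoc x <= rho xM.
  by rewrite xmP ?xMP//; exact: clamp_itv.
have m0 : 0 < rho xm by apply: rho_gt0; rewrite in_itv in xmI.
have [N [N0 NP]] : exists N, 0 <= N /\ forall x, 0 <= x <= ell -> `|drho x| <= N.
  have cn : {within `[0, ell], continuous (fun x => `|drho x|)}.
    by move=> x; apply: cvg_norm; exact: cdrho.
  have [xN _ xNP] := EVT_max ell_ge0 cn.
  exists `|drho xN|; split => // x x01; exact: xNP.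
have rho_lip x y : `|rhoc x - rhoc y| <= N * `|x - y|.
  apply: (@le_trans _ _ (N * `|clamp ell x - clamp ell y|)); last first.
    by rewrite ler_wpM2l// clamp_lipschitz.
  rewrite /rhoc /=; have := clamp_itv ell_ge0 x; have := clamp_itv ell_ge0 y.
  move: (clamp _ x) (clamp _ y) => {x y} x y.
  wlog xy : x y / y <= x => [H yI xI|yI xI].
    have [yx|/ltW xy] := leP y x; first exact: H.
    by rewrite distrC (distrC x); exact: H.
  have [||z zxy ->] := @MVT_segment R rho drho y x xy.
  - move=> z zxy; apply: drhoP; move: yI xI zxy; rewrite !in_itv /= => /andP[a b] /andP[c d] /andP[e f].
    by rewrite (le_lt_trans a e) (lt_le_trans f d).
  - apply: continuous_subspaceW crho => z /=; rewrite !in_itv/= in yI xI *.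
    move: yI xI => /andP[a b] /andP[c d] /andP[e f].
    by rewrite (le_trans a e) (le_trans f d).
  - rewrite normrM ler_wpM2r// NP//.
    move: yI xI zxy; rewrite !in_itv /= => /andP[a b] /andP[c d] /andP[e f].
    by rewrite (le_trans a e) (le_trans f d).
have rhocE x : 0 <= x <= ell -> rhoc x = rho x by move=> h; rewrite /rhoc /= clamp_id.
have rho_der (x : R) : 0 < x < ell -> is_derive x 1 rhoc (drho x).
  move=> /[dup] xI /andP[x0 xl]; apply: is_derive_near_eq (drhoP _ xI).
  near=> y; rewrite rhocE//; apply/andP; split; apply/ltW.
    by near: y; exact: lt_nbhsr.
  by near: y; exact: lt_nbhsl.
have NP' x : 0 < x < ell -> `|drho x| <= N.
  by move=> /andP[a b]; apply: NP; rewrite (ltW a) (ltW b).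
have mM : rho xm <= rho xM by have /andP[a b] := rho_bnd 0; exact: le_trans b.
have [X [S [A [init dX dS dep]]]] :=
  prufer_flow mu0 p0 p1 m0 mM N0 rho_bnd rho_lip.
have [B B0 bnd] := prufer_bounded mu0 p0 p1 m0 mM rho_bnd.
have [v [w [dvw v0 wl vd nz]]] := shooting_solution ell0 m0 N0 rho_bnd rho_lip
  rho_der B0 init dX dS dep bnd NP' kappa delta0.
exists v, w; split=> //; split=> [||x /andP[x0 xl]].
- apply: continuous_in_subspaceT => x /set_mem /=; rewrite in_itv /= => xI.
  exact: is_derive1_continuous (dvw x xI).1.
- apply: continuous_in_subspaceT => x /set_mem /=; rewrite in_itv /= => xI.
  exact: is_derive1_continuous (dvw x xI).2.
- have xI : 0 <= x <= ell by rewrite !ltW.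
  by have := dvw x xI; rewrite rhocE.
Unshelve. all: by end_near. Qed.

Let refl_cont (f : R -> R) : {within `[0, ell], continuous f} ->
  {within `[0, ell], continuous (fun x => f (ell - x))}.
Proof.
move=> cf; have ell_ge0 := ltW ell0.
have h := within_continuous_clamp ell_ge0 cf.
have h2 : continuous (fun x => (f \o clamp ell) (ell - x)).
  move=> x; apply: (@continuous_comp _ _ _ (fun x => ell - x) (f \o clamp ell)).
    by apply: cvgB; [exact: cvg_cst|exact: cvg_id].
  exact: h.
apply: (@subspace_eq_continuous _ _ _ (fun x => (f \o clamp ell) (ell - x))).
  move=> x /set_mem /=; rewrite in_itv /= => /andP[a b] /=.
  by rewrite clamp_id//; apply/andP; split; lra.
exact: continuous_subspaceT.
Qed.

Let refl_der (f : R -> R) (x l : R) : is_derive (ell - x) 1 f l ->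
  is_derive x 1 (fun x => f (ell - x)) (- l).
Proof.
move=> d.
have d2 : is_derive x 1 (fun x => ell - x) (-1).
  by apply: is_derive_eq; ring.
have := @is_derive1_comp _ f (fun x => ell - x) x l (-1) d d2.
by rewrite mulrN1.
Qed.

(** Reflection [x -> ell - x] exchanges the two ends and reverses the flux. *)
Lemma robin_dirichlet (rho drho : R -> R) (kappa delta : R) :
  weight rho drho -> 0 < delta -> exists v w : R -> R,
  [/\ stationary rho v w, w 0 = kappa * v 0, v ell = 0,
      forall x, 0 <= x <= ell -> `|v x| <= delta &
      exists2 x, 0 < x < ell & v x != 0].
Proof.
move=> [crho cdrho rho_gt0 drhoP] delta0.
have [|v [w [[cv cw dvw] v0 wl vd [x0 x0I vx0]]]] :=
  @dirichlet_robin (fun x => rho (ell - x)) (fun x => - drho (ell - x)) kappa delta _ delta0.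
  split=> [||x xI|x xI].
  - exact: refl_cont.
  - by move=> x; apply: continuousN; exact: refl_cont.
  - by apply: rho_gt0; lra.
  - by apply: refl_der; apply: drhoP; lra.
exists (fun x => v (ell - x)), (fun x => - w (ell - x)); split.
- split=> [||x xI]; first exact: refl_cont.
    by move=> x; apply: continuousN; exact: refl_cont.
  have [|d1 d2] := dvw (ell - x); first by lra.
  have := refl_der d1; have := refl_der d2; rewrite (_ : ell - (ell - x) = x); last by ring.
  rewrite opprK => d4 d3; split; first by rewrite mulNr.
  exact: is_deriveN d4.
- by rewrite subr0; lra.
- by rewrite subrr.
- by move=> x xI; apply: vd; lra.
- by exists (ell - x0); [lra|rewrite (_ : ell - (ell - x0) = x0)//; ring].
Qed.

End boundary_value_problem.

(** * Weak derivatives that are continuous *)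

Section open_FTC.
Variables (R : realType) (f F : R -> R) (a b : R).
Hypotheses (ab : a < b) (cf : continuous f) (cF : {within `[a, b], continuous F}).
Hypothesis dF : forall x : R, a < x < b -> is_derive x 1 F (f x).

Lemma integral_oo_derive :
  (\int[lebesgue_measure]_(x in `]a, b[) (f x)%:E = (F b - F a)%:E)%E.
Proof.
have mf : measurable_fun setT f by exact: continuous_measurable_fun.
rewrite integral_itv_bndo_bndc; last first.
  by apply/measurable_EFinP; exact: measurable_funS mf.
rewrite integral_itv_obnd_cbnd; last first.
  by apply/measurable_EFinP; exact: measurable_funS mf.
rewrite EFinB; apply: continuous_FTC2 => //.
- exact: continuous_subspaceT.
- have [_ ra lb] := (continuous_within_itvP F ab).1 cF.
  by split=> // x; rewrite in_itv /= => /dF[].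
- by move=> x; rewrite in_itv /= => /dF/is_derive_derive1.
Qed.

Lemma Rintegral_oo_derive :
  \int[lebesgue_measure]_(x in `]a, b[) f x = F b - F a.
Proof. by rewrite /Rintegral integral_oo_derive. Qed.

End open_FTC.

Section smooth.
Variable R : realType.
Implicit Types f g : R -> R.

(** Iterated differentiability through some chain of derivatives; unlike
    [derive1n], it is proved by induction along sums, products and affine
    changes of variable. *)
Fixpoint Ck (n : nat) f : Prop :=
  if n is n'.+1 then
    exists2 g, (forall x : R, is_derive x 1 f (g x)) & Ck n' g
  else True.

Lemma CkW n f : Ck n.+1 f -> Ck n f.
Proof.
elim: n f => [//|n IH] f [g dg Cg]; exists g => //; exact: IH.
Qed.

Lemma CkD n f g : Ck n f -> Ck n g -> Ck n (fun x => f x + g x).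
Proof.
elim: n f g => [//|n IH] f g [f' df Cf] [g' dg Cg].
exists (fun x => f' x + g' x); last exact: IH.
by move=> x; have := df x; have := dg x => ? ?; apply: is_derive_eq.
Qed.

Lemma CkZ n c f : Ck n f -> Ck n (fun x => c * f x).
Proof.
elim: n f => [//|n IH] f [f' df Cf].
exists (fun x => c * f' x); last exact: IH.
by move=> x; have := df x => ?; apply: is_derive_eq; rewrite /GRing.scale /=; ring.
Qed.

Lemma CkM n f g : Ck n f -> Ck n g -> Ck n (fun x => f x * g x).
Proof.
elim: n f g => [//|n IH] f g /[dup] /CkW Cf0 [f' df Cf] /[dup] /CkW Cg0 [g' dg Cg].
exists (fun x => f' x * g x + f x * g' x).
  move=> x; have := df x; have := dg x => ? ?; apply: is_derive_eq.
  by rewrite /GRing.scale /=; ring.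
by apply: CkD; exact: IH.
Qed.

Lemma Ck_affine n c d f : Ck n f -> Ck n (fun x => f (c * x + d)).
Proof.
elim: n f => [//|n IH] f [f' df Cf].
exists (fun x => c * f' (c * x + d)); last exact/CkZ/IH.
move=> x; have da : is_derive x 1 (fun x => c * x + d) c.
  by apply: is_derive_eq; rewrite /GRing.scale /=; ring.
have := @is_derive1_comp _ f (fun x => c * x + d) x _ _ (df _) da.
by rewrite mulrC.
Qed.

Lemma Ck_derivable n f (x : R) : (forall m, Ck m f) -> derivable (derive1n n f) x 1.
Proof.
elim: n f => [|n IH] f Cf.
  by have [g dg _] := Cf 1%N; exact: ex_derive.
rewrite derive1Sn; apply: IH => m; have [g dg Cg] := Cf m.+1.
suff -> : derive1 f = g by [].
by apply/funext => y; exact: is_derive_derive1.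
Qed.

(** The functions [x^-n exp (-1/x)], extended by [0]; the family is stable under
    differentiation up to linear combinations. *)
Definition flat (n : nat) (x : R) : R :=
  if 0 < x then x^-1 ^+ n * expR (- x^-1) else 0.

Lemma flat_ge0 n x : 0 <= flat n x.
Proof.
rewrite /flat; case: ifP => // x0.
by rewrite mulr_ge0 ?expR_ge0// exprn_ge0// invr_ge0 ltW.
Qed.

Lemma flat_gt0 n x : 0 < x -> 0 < flat n x.
Proof. by move=> x0; rewrite /flat x0 mulr_gt0 ?expR_gt0// exprn_gt0// invr_gt0. Qed.

Lemma flat_le0 n x : x <= 0 -> flat n x = 0.
Proof. by rewrite /flat ltNge => ->. Qed.

Lemma flat_le_sqr n x : flat n x <= n.+2`!%:R * x ^+ 2.
Proof.
have [x0|x0] := ltP 0 x; last first.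
  by rewrite flat_le0// mulr_ge0 ?sqr_ge0.
rewrite /flat x0; have X0 : 0 < x^-1 by rewrite invr_gt0.
have := @expR_ge1Dxn R x^-1 n.+1 (ltW X0).
move=> h; have {h} : x^-1 ^+ n.+2 / n.+2`!%:R <= expR x^-1 by lra.
have f0 : 0 < n.+2`!%:R :> R by rewrite ltr0n fact_gt0.
rewrite ler_pdivrMr// => h.
rewrite expRN ler_pdivrMr ?expR_gt0// mulrAC [_ * expR _]mulrC.
rewrite -ler_pdivrMr ?exprn_gt0//; apply: le_trans h.
by rewrite -exprVn -exprD addn2.
Qed.

Lemma is_derive_flat n (x : R) :
  is_derive x 1 (flat n) (- n%:R * flat n.+1 x + flat n.+2 x).
Proof.
have [x0|x0|->] := ltgtP x 0.
- rewrite !flat_le0 ?(ltW x0)// mulr0 addr0.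
  apply: (@is_derive_near_eq _ (fun _ => 0)).
  near=> y; rewrite flat_le0//; apply: ltW.
  by near: y; exact: lt_nbhsl.
- have xn : x != 0 by rewrite gt_eqF.
  apply: (@is_derive_near_eq _ (fun y => y^-1 ^+ n * expR (- y^-1))).
    near=> y; rewrite /flat ifT//.
    by near: y; exact: lt_nbhsr.
  have dV : is_derive x 1 (fun y : R => y^-1) (- (x^-1 ^+ 2)).
    have := is_deriveV xn (is_derive_id x (1 : R)).
    by rewrite /GRing.scale /= mulr1 exprVn.
  have dn : is_derive x 1 (fun y : R => y^-1 ^+ n) (- n%:R * x^-1 ^+ n.+1).
    elim: n => [|n IH].
      rewrite mulr0n oppr0 mul0r; apply: (@is_derive_near_eq _ (fun _ => 1)).
      by near=> y; rewrite expr0.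
    have -> : (fun y : R => y^-1 ^+ n.+1) = (fun y => y^-1 * y^-1 ^+ n).
      by apply/funext => y; rewrite exprS.
    apply: is_derive_eq; rewrite /GRing.scale /=.
    by rewrite -natr1 (exprS _ n.+1) (exprS _ n); ring.
  apply: is_derive_eq.
  rewrite /flat x0 /GRing.scale /= (exprS _ n.+1) (exprS _ n); ring.
- rewrite !flat_le0// mulr0 addr0.
  apply: is_derive_approx => e e0; near=> y.
  rewrite (@flat_le0 n 0)// mul0r !subr0 ger0_norm ?flat_ge0//.
  apply: le_trans (flat_le_sqr n y) _.
  rewrite -real_normK ?num_real// expr2 mulrA ler_wpM2r//.
  have f0 : 0 < n.+2`!%:R :> R by rewrite ltr0n fact_gt0.
  rewrite mulrC -ler_pdivlMr//.
  near: y; have := @cvgr_dist_le _ _ _ (nbhs (0 : R)) _ id 0 cvg_id (e / n.+2`!%:R).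
  rewrite divr_gt0// => /(_ _ isT); apply: filterS => y /=.
  by rewrite sub0r normrN.
Unshelve. all: by end_near. Qed.

Lemma Ck_flat k n : Ck k (flat n).
Proof.
elim: k n => [//|k IH] n.
exists (fun x => - n%:R * flat n.+1 x + flat n.+2 x); first exact: is_derive_flat.
by apply: CkD; [exact: CkZ|].
Qed.

(** [s] is an unnormalised smooth step from [0] to [s 1 > 0], constant outside
    [[0, 1]]. *)
Lemma smooth_step : exists s chi : R -> R,
  [/\ (forall n, Ck n s) /\ (forall x : R, is_derive x 1 s (chi x)),
      forall x, 0 <= chi x, forall x, 0 < x < 1 -> 0 < chi x,
      forall x, (x <= 0) || (1 <= x) -> chi x = 0 &
      forall x, (x <= 0 -> s x = 0) /\ (1 <= x -> s x = s 1)].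
Proof.
pose chi x := flat 0 x * flat 0 (-1 * x + 1).
have Cchi n : Ck n chi.
  by apply: CkM; [exact: Ck_flat|apply: Ck_affine; exact: Ck_flat].
have chi0 x : (x <= 0) || (1 <= x) -> chi x = 0.
  rewrite /chi => /orP[x0|x1]; first by rewrite (flat_le0 _ x0) mul0r.
  by rewrite (@flat_le0 0 (-1 * x + 1)) ?mulr0//; lra.
have cchi : continuous chi.
  by move=> x; have [g dg _] := Cchi 1%N; exact: is_derive1_continuous (dg x).
have [s s0 ds] := antiderivative cchi.
have cst x y : x <= y -> (forall z, x < z < y -> chi z = 0) -> s x = s y.
  move=> xy z0; have [||z zxy /eqP] := @MVT_segment R s (fun _ => 0) x y xy.
  - by move=> z; rewrite in_itv /= => /z0 z00; have := ds z; rewrite z00.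
  - by apply: continuous_subspaceT => z; exact: is_derive1_continuous (ds z).
  by rewrite mul0r subr_eq0 => /eqP.
exists s, chi; split=> //.
- by split=> // -[//|n]; exists chi.
- by move=> x; rewrite mulr_ge0// flat_ge0.
- by move=> x /andP[x0 x1]; rewrite mulr_gt0// flat_gt0//; lra.
- move=> x; split => x0.
    by rewrite -s0; apply: cst => // z /andP[_ z0]; rewrite chi0// (ltW z0).
  by apply/esym; apply: cst => // z /andP[z1 _]; rewrite chi0// (ltW z1) orbT.
Qed.

End smooth.

Lemma continuous_near_pos (R : realType) (q : R -> R) (x : R) :
  {for x, continuous q} -> 0 < q x ->
  exists2 d : R, 0 < d & forall y, `|y - x| <= d -> 0 < q y.
Proof.
move=> cq q0; have /cvgrPdist_lt/(_ _ q0) [d /= d0 dP] := cq.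
exists (d / 2); first by rewrite divr_gt0.
move=> y yx; have := dP y; rewrite /= distrC => H.
have /H : `|y - x| < d by lra.
by rewrite ltr_norml; lra.
Qed.

(** If [h x1 <> h x2], take for [phi] a plateau that rises near [x1] and falls near
    [x2]. For the value [mid] halfway between [h x1] and [h x2], the function
    [q = (h x2 - h x1) * (mid - h)] is positive near [x1] and negative near [x2],
    so [q * phi' >= 0]; its integral is [0] because the integrals of [phi'] and
    [h * phi'] are, which forces [q * phi' = 0], and this fails just to the right
    of [x1]. *)
Lemma du_bois_reymond (R : realType) (h : R -> R) (l x1 x2 : R) :
  continuous h ->
  (forall phi, test_fun 0 l phi ->
     \int[lebesgue_measure]_(x in `]0, l[) (h x * derive1 phi x) = 0) ->
  0 < x1 -> x1 < x2 -> x2 < l -> h x1 = h x2.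
Proof.
move=> ch H x1_gt0 x12 x2l; apply/eqP; apply: contraT => hne.
pose mid := (h x1 + h x2) / 2.
pose d := h x2 - h x1.
have d0 : d != 0 by rewrite subr_eq0 eq_sym.
pose q x := d * (mid - h x).
have cq : continuous q.
  move=> x; apply: cvgM; first exact: cvg_cst.
  by apply: cvgB; [exact: cvg_cst|exact: ch].
have dd : 0 < d ^+ 2 by rewrite exprn_even_gt0.
have q1 : 0 < q x1 by rewrite (_ : q x1 = d ^+ 2 / 2) ?divr_gt0// /q /mid /d; field.
have q2 : 0 < - q x2 by rewrite (_ : - q x2 = d ^+ 2 / 2) ?divr_gt0// /q /mid /d; field.
have [e1 e10 e1P] := continuous_near_pos (cq x1) q1.
have cqN : continuous (fun x => - q x) by move=> x; apply: cvgN; exact: cq.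
have [e2 e20 e2P] := continuous_near_pos (cqN x2) q2.
pose e := Num.min (Num.min e1 e2) (Num.min ((x2 - x1) / 2) ((l - x2) / 2)).
have e_gt0 : 0 < e by rewrite !lt_min e10 e20/= !divr_gt0 ?subr_gt0.
have ee1 : e <= e1 by rewrite !ge_min lexx.
have ee2 : e <= e2 by rewrite !ge_min lexx !orbT.
have ex : e <= (x2 - x1) / 2 by rewrite !ge_min lexx !orbT.
have exl : e <= (l - x2) / 2 by rewrite !ge_min lexx !orbT.
have [s [chi [[Cs ds] chi_ge0 chi_gt0 chi0 s01]]] := smooth_step R.
pose phi x := s (e^-1 * x + - (x1 / e)) + (-1) * s (e^-1 * x + - (x2 / e)).
pose dphi x := e^-1 * (chi (e^-1 * x + - (x1 / e)) - chi (e^-1 * x + - (x2 / e))).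
have arg c x : e^-1 * x + - (c / e) = (x - c) / e by ring.
have dphiP (x : R) : is_derive x 1 phi (dphi x).
  have da (c : R) : is_derive x 1 (fun x => e^-1 * x + - (c / e)) e^-1.
    by apply: is_derive_eq; rewrite /GRing.scale /=; ring.
  have d1 := @is_derive1_comp _ s (fun x => e^-1 * x + - (x1 / e)) x _ _ (ds _) (da x1).
  have d2 := @is_derive1_comp _ s (fun x => e^-1 * x + - (x2 / e)) x _ _ (ds _) (da x2).
  rewrite /phi; have -> : dphi x = chi (e^-1 * x + - (x1 / e)) * e^-1 +
    (-1) * (chi (e^-1 * x + - (x2 / e)) * e^-1) by rewrite /dphi; ring.
  by apply: is_deriveD.
have tphi : test_fun 0 l phi.
  split.
    move=> n x; apply: Ck_derivable => k.
    by apply: CkD; [exact: Ck_affine|apply: CkZ; exact: Ck_affine].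
  exists x1, (x2 + e); split => //; first by lra.
  move=> x; rewrite in_itv /= negb_and -!ltNge /phi !arg => /orP[xx1|xx2].
    rewrite (s01 _).1; last by rewrite pmulr_lle0 ?invr_gt0//; lra.
    rewrite (s01 _).1; last by rewrite pmulr_lle0 ?invr_gt0//; lra.
    by rewrite mulr0 addr0.
  rewrite (s01 _).2; last by rewrite ler_pdivlMr//; lra.
  rewrite (s01 ((x - x2) / e)).2; last by rewrite ler_pdivlMr//; lra.
  by ring.
have cdphi : continuous dphi.
  have cc c : continuous (fun x => chi (e^-1 * x + - (c / e))).
    move=> x; apply: (@continuous_comp _ _ _ (fun x => e^-1 * x + - (c / e)) chi).
      apply: cvgD; last exact: cvg_cst.
      by apply: cvgM; [exact: cvg_cst|exact: cvg_id].
    have [g dg [g' dg' _]] := Cs 2%N; suff -> : chi = g.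
      exact: is_derive1_continuous (dg' _).
    by apply/funext => z; rewrite -(is_derive_derive1 (ds z)) (is_derive_derive1 (dg z)).
  move=> x; apply: cvgM; first exact: cvg_cst.
  by apply: cvgB; exact: cc.
have qphi_ge0 x : 0 <= q x * dphi x.
  rewrite /dphi !arg.
  have [a1|na1] := boolP ((x - x1) / e <= 0).
    rewrite (chi0 ((x - x1) / e)) ?a1// (chi0 ((x - x2) / e)); last first.
      by move: a1; rewrite !pmulr_lle0 ?invr_gt0//; lra.
    by rewrite subrr !mulr0.
  have xx1 : x1 < x by move: na1; rewrite -ltNge pmulr_lgt0 ?invr_gt0//; lra.
  have [a2|na2] := boolP (1 <= (x - x1) / e).
    rewrite (chi0 ((x - x1) / e)) ?a2 ?orbT//.
    have [b|nb] := boolP (((x - x2) / e <= 0) || (1 <= (x - x2) / e)).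
      by rewrite chi0// subrr !mulr0.
    rewrite sub0r !mulrN -mulNr; apply: mulr_ge0; last first.
      by rewrite mulr_ge0 ?invr_ge0 ?(ltW e_gt0).
    move: nb; rewrite negb_or -!ltNge pmulr_lgt0 ?invr_gt0// ltr_pdivrMr// mul1r.
    move=> /andP[xx2 xx2'].
    by apply/ltW/e2P; rewrite ger0_norm; lra.
  have xx1' : x - x1 < e by move: na2; rewrite -ltNge ltr_pdivrMr// mul1r.
  rewrite (chi0 ((x - x2) / e)); last by rewrite pmulr_lle0 ?invr_gt0//; lra.
  rewrite subr0; apply: mulr_ge0; last by rewrite mulr_ge0 ?invr_ge0 ?(ltW e_gt0).
  by apply/ltW/e1P; rewrite ger0_norm; lra.
have cqd : continuous (fun x => q x * dphi x).
  by move=> x; apply: cvgM; [exact: cq|exact: cdphi].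
have [K K0 dK] := antiderivative cqd.
pose F x := mid * phi x - d^-1 * K x.
have dF (x : R) : is_derive x 1 F (h x * dphi x).
  have := dK x; have := dphiP x => ? ?; rewrite /F; apply: is_derive_eq.
  by rewrite /GRing.scale /= /q; field.
have l_gt0 : 0 < l by lra.
have cF : continuous F by move=> x; exact: is_derive1_continuous (dF x).
have := H _ tphi.
have -> : (fun x => h x * derive1 phi x) = (fun x => h x * dphi x).
  by apply/funext => x; rewrite (is_derive_derive1 (dphiP x)).
rewrite (@Rintegral_oo_derive _ _ F) //; last 2 first.
- by move=> x; apply: cvgM; [exact: ch|exact: cdphi].
- exact: continuous_subspaceT.
have phi0 x : (x <= x1) || (x2 + e <= x) -> phi x = 0.
  rewrite /phi !arg => /orP[xx1|xx2].
    rewrite (s01 _).1; last by rewrite pmulr_lle0 ?invr_gt0//; lra.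
    rewrite (s01 _).1; last by rewrite pmulr_lle0 ?invr_gt0//; lra.
    by rewrite mulr0 addr0.
  rewrite (s01 _).2; last by rewrite ler_pdivlMr//; lra.
  rewrite (s01 ((x - x2) / e)).2; last by rewrite ler_pdivlMr//; lra.
  by ring.
rewrite /F !phi0; [|by apply/orP; left; lra|by apply/orP; right; lra].
rewrite K0 !mulr0 subrr subr0 sub0r => /eqP; rewrite oppr_eq0 mulf_eq0 invr_eq0 (negbTE d0) /= => /eqP Kl.
have Kmono x y : x <= y -> K x <= K y.
  move=> xy; apply: (derive_ge0_le xy _ (fun z _ => dK z)) => [|z _]; last exact: qphi_ge0.
  by apply: continuous_subspaceT => z; exact: is_derive1_continuous (dK z).
pose c := x1 + e / 2.
have Kc x : 0 < x < l -> K x = 0.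
  move=> /andP[x0 xl]; apply/eqP; rewrite eq_le; apply/andP; split.
    by rewrite -Kl; apply: Kmono; exact: ltW.
  by rewrite -K0; apply: Kmono; exact: ltW.
have dKc : is_derive c 1 K (0 : R).
  apply: (@is_derive_near_eq _ (fun _ => 0)).
  near=> y; rewrite Kc//; apply/andP; split.
    by near: y; apply: lt_nbhsr; rewrite /c; lra.
  by near: y; apply: lt_nbhsl; rewrite /c; lra.
have := is_derive_derive1 dKc; rewrite (is_derive_derive1 (dK c)) /dphi !arg.
rewrite (chi0 ((c - x2) / e)); last first.
  by rewrite pmulr_lle0 ?invr_gt0// /c; apply/orP; left; lra.
have -> : (c - x1) / e = 1 / 2 by rewrite /c; field; rewrite gt_eqF.
have qc : 0 < q c by apply: e1P; rewrite /c ger0_norm; lra.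
have ch2 : 0 < chi (1 / 2) by apply: chi_gt0; lra.
rewrite subr0 => q0; have : 0 < q c * (e^-1 * chi (1 / 2)).
  by apply: mulr_gt0 => //; rewrite mulr_gt0 ?invr_gt0.
by rewrite q0 ltxx.
Unshelve. all: by end_near. Qed.

(** With [P] a primitive of [g], the difference [f - P] is orthogonal to all
    derivatives of test functions, hence constant. *)
Lemma weak_derivative_is_derive (R : realType) (l : R) (f g : R -> R) :
  0 < l -> {within `[0, l], continuous f} -> {within `[0, l], continuous g} ->
  weak_derivative 0 l f g -> forall x : R, 0 < x < l -> is_derive x 1 f (g x).
Proof.
move=> l0 cf cg wd x xI.
have l_ge0 := ltW l0.
have cfc := within_continuous_clamp l_ge0 cf.
have cgc := within_continuous_clamp l_ge0 cg.
have [P P0 dP] := antiderivative cgc.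
pose h x := (f \o clamp l) x - P x.
have cP : continuous P by move=> y; exact: is_derive1_continuous (dP y).
have ch : continuous h by move=> y; apply: cvgB; [exact: cfc|exact: cP].
have inI y : y \in [set` `]0, l[] -> clamp l y = y.
  by move=> /set_mem /=; rewrite in_itv /= => /andP[a b]; rewrite clamp_id// !ltW.
have hc y z : 0 < y -> y < z -> z < l -> h y = h z.
  apply: du_bois_reymond => // phi tphi.
  have [sm [c [d [c0 dl supp]]]] := tphi.
  have phi0 : phi 0 = 0 by apply: supp; rewrite in_itv /= negb_and -ltNge c0.
  have phil : phi l = 0 by apply: supp; rewrite in_itv /= negb_and -!ltNge dl orbT.
  have dphi (u : R) : is_derive u 1 phi (derive1 phi u).
    by rewrite derive1E; apply: derivableP; exact: (sm 0%N).
  have cphi : continuous phi by move=> u; exact: is_derive1_continuous (dphi u).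
  have cdphi : continuous (derive1 phi).
    move=> u; apply/differentiable_continuous/derivable1_diffP; exact: (sm 1%N).
  have fphi : continuous (fun u => (f \o clamp l) u * derive1 phi u).
    by move=> u; apply: cvgM; [exact: cfc|exact: cdphi].
  have gphi : continuous (fun u => (g \o clamp l) u * phi u).
    by move=> u; apply: cvgM; [exact: cgc|exact: cphi].
  have [Q1 Q10 dQ1] := antiderivative fphi.
  have [Q2 Q20 dQ2] := antiderivative gphi.
  have := wd _ tphi.
  have -> : \int[lebesgue_measure]_(u in `]0, l[) (f u * derive1 phi u) =
      \int[lebesgue_measure]_(u in `]0, l[) ((f \o clamp l) u * derive1 phi u).
    by apply: eq_Rintegral => u /inI uI /=; rewrite uI.
  have -> : \int[lebesgue_measure]_(u in `]0, l[) (g u * phi u) =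
      \int[lebesgue_measure]_(u in `]0, l[) ((g \o clamp l) u * phi u).
    by apply: eq_Rintegral => u /inI uI /=; rewrite uI.
  rewrite (Rintegral_oo_derive l0 fphi _ (fun u _ => dQ1 u)); last first.
    by apply: continuous_subspaceT => u; exact: is_derive1_continuous (dQ1 u).
  rewrite (Rintegral_oo_derive l0 gphi _ (fun u _ => dQ2 u)); last first.
    by apply: continuous_subspaceT => u; exact: is_derive1_continuous (dQ2 u).
  rewrite Q10 Q20 !subr0 => Q12.
  pose F u := Q1 u - (P u * phi u - Q2 u).
  have dF (u : R) : is_derive u 1 F (h u * derive1 phi u).
    have := dQ1 u; have := dQ2 u; have := dP u; have := dphi u => ? ? ? ?.
    by rewrite /F; apply: is_derive_eq; rewrite /h /GRing.scale /=; ring.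
  rewrite (Rintegral_oo_derive l0 _ _ (fun u _ => dF u)).
  - by rewrite /F Q10 Q20 phi0 phil Q12; ring.
  - by move=> u; apply: cvgM; [exact: ch|exact: cdphi].
  - by apply: continuous_subspaceT => u; exact: is_derive1_continuous (dF u).
case/andP: xI => x0 xl.
have hx y : 0 < y < l -> h y = h x.
  move=> /andP[y0 yl]; have [yx|xy|->//] := ltgtP y x; first exact: hc.
  by apply/esym; exact: hc.
have dPh : is_derive x 1 (fun y => P y + h x) (g x).
  have := dP x; rewrite /= (inI x); last by rewrite inE/= in_itv /= x0.
  by move=> ?; apply: is_derive_eq; rewrite addr0.
apply: is_derive_near_eq dPh; near=> y.
have yI : 0 < y < l.
  apply/andP; split; near: y; [exact: lt_nbhsr|exact: lt_nbhsl].
rewrite -(hx y)// /h addrC subrK /= inI// inE /= in_itv.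
exact: yI.
Unshelve. all: by end_near. Qed.

(** * The weak formulation on the rectangle *)

(** The plane with the product of the Borel sigma-algebras, on which [leb2] is
    defined. *)
Notation RxR R := (measurableTypeR R * measurableTypeR R)%type.

(** An open set is the union of the boxes with rational centres and radius
    [1 / n.+1] that it contains. *)
Lemma open_measurable_prod (R : realType) (U : set (R * R)) :
  open U -> measurable (U : set (RxR R)).
Proof.
move=> oU.
pose box (q1 q2 : rat) (n : nat) : set (RxR R) :=
  ball (ratr q1 : R) n.+1%:R^-1 `*` ball (ratr q2 : R) n.+1%:R^-1.
pose F q1 q2 n : set (RxR R) := if `[< box q1 q2 n `<=` U >] then box q1 q2 n else set0.
have -> : U = \bigcup_q1 \bigcup_q2 \bigcup_n F q1 q2 n.
  apply/seteqP; split => [[t x] Utx|[t x] [q1 _ [q2 _ [n _]]]]; last first.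
    by rewrite /F; case: asboolP => // sub /sub.
  have := oU; rewrite openE => /(_ _ Utx).
  rewrite /interior -nbhs_ballE => -[e /= e0 eP].
  have [n [d [nd d0 de]]] : exists (n : nat) (d : R),
      [/\ n.+1%:R^-1 = d, 0 < d & d < e / 2].
    have e20 : 0 < e / 2 by rewrite divr_gt0.
    exists (Num.Def.truncn (e / 2)^-1), (Num.Def.truncn (e / 2)^-1).+1%:R^-1.
    split=> //.
    rewrite -[ltRHS]invrK ltf_pV2 ?posrE ?ltr0n ?invr_gt0//.
    by rewrite truncnS_gt.
  have near_rat (z : R) : exists q : rat, `|ratr q - z| < d.
    have [|q] := @rat_in_itvoo R (z - d) (z + d); first by lra.
    by rewrite in_itv /= => /andP[a b]; exists q; rewrite ltr_norml; lra.
  have [q1 q1t] := near_rat t; have [q2 q2x] := near_rat x.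
  exists q1 => //; exists q2 => //; exists n => //.
  have tri (y z q : R) : `|q - y| < d -> `|q - z| < d -> `|y - z| < e.
    by rewrite !ltr_norml; lra.
  rewrite /F /box nd; case: asboolP => [_|]; first by split.
  case=> -[t' x'] [/= b1 b2]; apply: eP; split => /=.
    by apply: tri q1t _; move: b1; rewrite /ball /=.
  by apply: tri q2x _; move: b2; rewrite /ball /=.
apply: bigcupT_measurable_rat => q1; apply: bigcupT_measurable_rat => q2.
apply: bigcupT_measurable => n; rewrite /F; case: ifP => _; last exact: measurable0.
by apply: measurableX; exact: measurable_ball.
Qed.

Lemma continuous_measurable_prod (R : realType) (f : R * R -> R) :
  continuous f -> measurable_fun setT (f : RxR R -> R).
Proof.
move=> /continuousP cf; apply: (measurability _ (RGenOpens.measurableE R)).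
move=> _ [_ [a [b ->] <-]]; rewrite setTI; apply: open_measurable_prod.
exact/cf/interval_open.
Qed.

Section rectangle.
Variables (R : realType) (T : R).
Hypothesis T0 : 0 < T.

Let mu := @lebesgue_measure R.

Lemma measurable_Omega : measurable (Omega T : set (RxR R)).
Proof. by apply: measurableX; exact: measurable_itv. Qed.

Lemma leb2_Omega : (@leb2 R (Omega T) = (T * pi)%:E)%E.
Proof.
have -> : leb2 (Omega T) = (mu `]0%R, T[ * mu `]0%R, pi[)%E.
  by apply: (@product_measure1E _ _ _ _ R mu mu); exact: measurable_itv.
rewrite /mu !lebesgue_measure_itv /= !lte_fin T0 pi_gt0.
by rewrite -!EFinB !subr0 EFinM.
Qed.

Lemma integrable_Omega (f : R * R -> R) : continuous f ->
  (@leb2 R).-integrable (Omega T) (EFin \o f).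
Proof.
move=> cf; apply: measurable_bounded_integrable.
- exact: measurable_Omega.
- by rewrite leb2_Omega ltry.
- exact: measurable_funS (continuous_measurable_prod cf).
have cK : compact (f @` (`[0, T] `*` `[0, pi])).
  apply: continuous_compact; first exact: continuous_subspaceT.
  by apply: compact_setX; exact: segment_compact.
have [M [Mr HM]] := compact_bounded cK; exists M; split=> // M' MM' z.
move=> [/= z1 z2]; apply: (HM M' MM'); exists z => //; split => /=.
  exact: subset_itv_oo_cc z1.
exact: subset_itv_oo_cc z2.
Qed.

Lemma Omega_integral_fst0 (f : R * R -> R) : continuous f ->
  (forall x, 0 < x < pi -> (\int[mu]_(t in `]0%R, T[) (f (t, x))%:E = 0)%E) ->
  \int[leb2]_(z in Omega T) f z = 0.
Proof.
move=> cf H; rewrite /Rintegral integral_mkcond.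
have i : (@leb2 R).-integrable setT ((EFin \o f) \_ (Omega T)).
  apply/(integrable_mkcond _ _).1; first exact: measurable_Omega.
  exact: integrable_Omega.
rewrite -(@integral21_prod_meas1 _ _ _ _ _ _ _ _ i).
rewrite integral0_eq// => x _; rewrite /fubini_G.
have [xI|xI] := boolP (x \in `]0, pi[).
  rewrite -[RHS](H x); last by move: xI; rewrite in_itv.
  rewrite [RHS]integral_mkcond; apply: eq_integral => t _.
  rewrite !patchE; congr (if _ then _ else _); apply/idP/idP; rewrite !inE.
    by case.
  by split.
rewrite integral0_eq// => t _; rewrite patchE ifF//; apply/negbTE.
by rewrite notin_setE => -[/= _ h]; move: xI; rewrite h.
Qed.

Lemma Omega_integral_snd0 (f : R * R -> R) : continuous f ->
  (forall t, 0 < t < T -> (\int[mu]_(x in `]0%R, pi[) (f (t, x))%:E = 0)%E) ->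
  \int[leb2]_(z in Omega T) f z = 0.
Proof.
move=> cf H; rewrite /Rintegral integral_mkcond.
have i : (@leb2 R).-integrable setT ((EFin \o f) \_ (Omega T)).
  apply/(integrable_mkcond _ _).1; first exact: measurable_Omega.
  exact: integrable_Omega.
rewrite -(@integral12_prod_meas1 _ _ _ _ _ _ _ _ i).
rewrite integral0_eq// => t _; rewrite /fubini_F.
have [tI|tI] := boolP (t \in `]0, T[).
  rewrite -[RHS](H t); last by move: tI; rewrite in_itv.
  rewrite [RHS]integral_mkcond; apply: eq_integral => x _.
  rewrite !patchE; congr (if _ then _ else _); apply/idP/idP; rewrite !inE.
    by case.
  by split.
rewrite integral0_eq// => x _; rewrite patchE ifF//; apply/negbTE.
by rewrite notin_setE => -[/= h _]; move: tI; rewrite h.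
Qed.

End rectangle.

Section weak_form.
Variables (R : realType) (mu p T a1 b1 a2 b2 : R) (rho drho : R -> R).
Hypothesis T0 : 0 < T.
Hypotheses (bc1 : a1 ^+ 2 + b1 ^+ 2 != 0) (bc2 : a2 ^+ 2 + b2 ^+ 2 != 0).
Hypothesis Wrho : weight pi rho drho.
Variables v w : R -> R.
Hypothesis S : stationary mu p pi rho v w.
Hypothesis bv0 : a1 * v 0 + b1 * (w 0 / rho 0) = 0.
Hypothesis bvpi : a2 * v pi + b2 * (w pi / rho pi) = 0.
Hypothesis cnl : continuous (nonlin mu p).

Let pi_ge0 : 0 <= pi :> R. Proof. exact: pi_ge0. Qed.
Let T_ge0 : 0 <= T. Proof. exact: ltW. Qed.

(* All functions are precomposed with the projection onto the closed rectangle: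
   they become continuous on the plane and are unchanged on [Omega T]. *)
Let c (z : R * R) : R * R := (clamp T z.1, clamp pi z.2).

Let c_continuous : continuous c.
Proof.
move=> z; apply: (@cvg_pair _ _ _ _ (nbhs (clamp T z.1)) (nbhs (clamp pi z.2))).
  apply: (@continuous_comp _ _ _ (fun z : R * R => z.1) (clamp T)); first exact: cvg_fst.
  exact: clamp_continuous.
apply: (@continuous_comp _ _ _ (fun z : R * R => z.2) (clamp pi)); first exact: cvg_snd.
exact: clamp_continuous.
Qed.

Let c_bar z : Omega_bar T (c z).
Proof. by split => /=; exact: clamp_itv. Qed.

Let c_id t x : 0 <= t <= T -> 0 <= x <= pi -> c (t, x) = (t, x).
Proof. by move=> tI xI; rewrite /c /= !clamp_id. Qed.

Let lift_continuous (f : R -> R) : {within `[0, pi], continuous f} ->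
  continuous (fun z : R * R => f (clamp pi z.2)).
Proof.
move=> cf z; apply: (@continuous_comp _ _ _ (fun z : R * R => z.2) (f \o clamp pi)).
  exact: cvg_snd.
exact: within_continuous_clamp.
Qed.

(* Two vectors orthogonal to [(a, b)] are parallel: the boundary terms of Green's
   identity vanish because [v] and [psi] satisfy the same boundary condition. *)
Let wronskian0 a b v0 w0 s0 ds0 : a ^+ 2 + b ^+ 2 != 0 :> R ->
  a * v0 + b * w0 = 0 -> a * s0 + b * ds0 = 0 -> v0 * ds0 - w0 * s0 = 0.
Proof.
move=> ab e1 e2; apply: (mulfI ab); rewrite mulr0.
have -> : (a ^+ 2 + b ^+ 2) * (v0 * ds0 - w0 * s0) =
  (a * v0 + b * w0) * (a * ds0 - b * s0) - (a * w0 - b * v0) * (a * s0 + b * ds0).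
  by ring.
by rewrite e1 e2 mul0r mulr0 subr0.
Qed.

Variables (psi : R * R -> R) (D : nat -> nat -> R * R -> R).
Hypothesis jet : smooth_jet T psi D.
Hypothesis psi_bc : forall t : R, t \in `[0, T] ->
  a1 * psi (t, 0) + b1 * D 0%N 1%N (t, 0) = 0 /\
  a2 * psi (t, pi) + b2 * D 0%N 1%N (t, pi) = 0.
Hypothesis psi_per : forall x : R, x \in `[0, pi] ->
  psi (0, x) = psi (T, x) /\ D 1%N 0%N (0, x) = D 1%N 0%N (T, x).

Let Dc i j (z : R * R) := D i j (c z).

Let Dc_continuous i j : continuous (Dc i j).
Proof.
have [_ cD _] := jet.
exact: within_continuous_retract (cD i j) c_continuous c_bar.
Qed.

Let Dc_t i j (t x : R) : 0 < t < T -> 0 < x < pi ->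
  is_derive t 1 (fun s => Dc i j (s, x)) (Dc i.+1 j (t, x)).
Proof.
move=> /andP[t0 tT] /[dup] xI /andP[x0 xpi]; have [_ _ dD] := jet.
have [] := dD i j t x; first by split; rewrite /= in_itv /= ?t0 ?x0.
rewrite -{1}(c_id (x := x) (t := t)) ?ltW// => d _.
apply: is_derive_near_eq d; near=> s; rewrite /Dc c_id//; last by rewrite !ltW.
by apply/andP; split; apply/ltW; near: s; [exact: lt_nbhsr|exact: lt_nbhsl].
Unshelve. all: by end_near. Qed.

Let Dc_x i j (t x : R) : 0 < t < T -> 0 < x < pi ->
  is_derive x 1 (fun y => Dc i j (t, y)) (Dc i j.+1 (t, x)).
Proof.
move=> /[dup] tI /andP[t0 tT] /andP[x0 xpi]; have [_ _ dD] := jet.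
have [] := dD i j t x; first by split; rewrite /= in_itv /= ?t0 ?x0.
move=> _; rewrite -[in X in is_derive _ _ _ X -> _](c_id (x := x) (t := t)) ?ltW// => d.
apply: is_derive_near_eq d; near=> s; rewrite /Dc c_id//; first by rewrite !ltW.
by apply/andP; split; apply/ltW; near: s; [exact: lt_nbhsr|exact: lt_nbhsl].
Unshelve. all: by end_near. Qed.

Let psiE t x : 0 <= t <= T -> 0 <= x <= pi -> psi (t, x) = Dc 0 0 (t, x).
Proof.
move=> tI xI; have [D0 _ _] := jet.
by rewrite /Dc c_id// D0//; split; rewrite /= in_itv.
Qed.

Let near_in (l u : R) : 0 < u < l -> \forall y \near u, 0 < y < l.
Proof.
move=> /andP[u0 ul]; near=> y; apply/andP.
by split; near: y; [exact: lt_nbhsr|exact: lt_nbhsl].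
Unshelve. all: by end_near. Qed.

Let oo_cc (l u : R) : 0 < u < l -> 0 <= u <= l.
Proof. by move=> /andP[/ltW -> /ltW ->]. Qed.

Lemma wave_opE t x : 0 < t < T -> 0 < x < pi -> wave_op rho psi (t, x) =
  rho x * Dc 2 0 (t, x) - (drho x * Dc 0 1 (t, x) + rho x * Dc 0 2 (t, x)).
Proof.
move=> tI xI; have [_ _ _ drhoP] := Wrho; rewrite /wave_op /=; congr (_ * _ - _).
  apply: is_derive_derive1.
  apply: (@is_derive_near_eq _ (fun s => Dc 1 0 (s, x))); last exact: Dc_t.
  have := near_in tI; apply: filterS => s sI.
  apply/esym/is_derive_derive1.
  apply: (@is_derive_near_eq _ (fun s => Dc 0 0 (s, x))); last exact: Dc_t.
  by have := near_in sI; apply: filterS => s' s'I; rewrite psiE// oo_cc.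
apply: is_derive_derive1.
apply: (@is_derive_near_eq _ (fun y => rho y * Dc 0 1 (t, y))).
  have := near_in xI; apply: filterS => y yI; congr (_ * _).
  apply/esym/is_derive_derive1.
  apply: (@is_derive_near_eq _ (fun s => Dc 0 0 (t, s))); last exact: Dc_x.
  by have := near_in yI; apply: filterS => s' s'I; rewrite psiE// oo_cc.
have := drhoP x xI; have := Dc_x 0 1 tI xI => ? ?.
by apply: is_derive_eq; rewrite /GRing.scale /=; ring.
Qed.

(* The weak equation is the integral of [Av - (Bv + Cv)]. Along every horizontal
   line [Av] is the [t]-derivative of [v * rho * psi_t], which is periodic; along
   every vertical line [Bv + Cv] is the [x]-derivative of
   [v * rho * psi_x - w * psi], which vanishes at both ends. *)
Let Av (z : R * R) := v (clamp pi z.2) * rho (clamp pi z.2) * Dc 2 0 z.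
Let Bv (z : R * R) := v (clamp pi z.2) *
   (drho (clamp pi z.2) * Dc 0 1 z + rho (clamp pi z.2) * Dc 0 2 z).
Let Cv (z : R * R) := nonlin mu p (v (clamp pi z.2)) * Dc 0 0 z * rho (clamp pi z.2).

Let cv := lift_continuous (let: And3 a _ _ := S in a).
Let crho := lift_continuous (let: And4 a _ _ _ := Wrho in a).
Let cdrho := lift_continuous (let: And4 _ a _ _ := Wrho in a).

Let cnlv : continuous (fun z : R * R => nonlin mu p (v (clamp pi z.2))).
Proof.
by move=> z; apply: (@continuous_comp _ _ _ (fun z : R * R => v (clamp pi z.2)) (nonlin mu p)); [exact: cv|exact: cnl].
Qed.

Let cAv : continuous Av.
Proof. by move=> z; apply: cvgM; [apply: cvgM; [exact: cv|exact: crho]|exact: Dc_continuous]. Qed.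

Let cBv : continuous Bv.
Proof.
move=> z; apply: cvgM; first exact: cv.
by apply: cvgD; (apply: cvgM; last exact: Dc_continuous); [exact: cdrho|exact: crho].
Qed.

Let cCv : continuous Cv.
Proof.
move=> z; apply: cvgM; last exact: crho.
by apply: cvgM; [exact: cnlv|exact: Dc_continuous].
Qed.

Let slice1 (f : R * R -> R) x : continuous f -> continuous (fun t => f (t, x)).
Proof.
move=> cf t; apply: (@continuous_comp _ _ _ (fun t => (t, x)) f); last exact: cf.
by apply: (@cvg_pair _ _ _ _ (nbhs t) (nbhs x)); [exact: cvg_id|exact: cvg_cst].
Qed.

Let slice2 (f : R * R -> R) t : continuous f -> continuous (fun x => f (t, x)).
Proof.
move=> cf x; apply: (@continuous_comp _ _ _ (fun x => (t, x)) f); last exact: cf.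
by apply: (@cvg_pair _ _ _ _ (nbhs t) (nbhs x)); [exact: cvg_cst|exact: cvg_id].
Qed.

Let intA : \int[leb2]_(z in Omega T) Av z = 0.
Proof.
apply: Omega_integral_fst0 => // x xI.
have cF : {within `[0, T], continuous (fun t => v x * rho x * Dc 1 0 (t, x))}.
  by apply: continuous_subspaceT => t; apply: cvgM; [exact: cvg_cst|exact: slice1].
have dF (t : R) : 0 < t < T ->
    is_derive t 1 (fun t => v x * rho x * Dc 1 0 (t, x)) (Av (t, x)).
  move=> tI; have := Dc_t 1 0 tI xI => ?; apply: is_derive_eq.
  by rewrite /Av /= clamp_id ?oo_cc// /GRing.scale /= mulr0 addr0.
rewrite (integral_oo_derive T0 (slice1 cAv) cF dF).
have [_ e] : psi (0, x) = psi (T, x) /\ D 1%N 0%N (0, x) = D 1%N 0%N (T, x).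
  by apply: psi_per; rewrite in_itv /= oo_cc.
by rewrite /Dc !c_id ?lexx ?T_ge0 ?oo_cc// e subrr.
Qed.

Let intBC : \int[leb2]_(z in Omega T) (Bv z + Cv z) = 0.
Proof.
have cBC : continuous (fun z => Bv z + Cv z).
  by move=> z; apply: cvgD; [exact: cBv|exact: cCv].
apply: Omega_integral_snd0 => // t tI.
have [cv_ cw dvw] := S; have [crho_ _ rho0 drhoP] := Wrho.
have tI' : t \in `[0, T] by rewrite in_itv /= oo_cc.
have [bt0 btpi] := psi_bc tI'.
pose W x := v (clamp pi x) * (rho (clamp pi x) * Dc 0 1 (t, x)) - w (clamp pi x) * Dc 0 0 (t, x).
have W0 : W 0 = 0.
  rewrite /W clamp_id ?lexx//; have r0 : rho 0 != 0 by rewrite gt_eqF// rho0 ?lexx.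
  have := @wronskian0 a1 b1 (v 0) (w 0 / rho 0) (psi (t, 0)) (D 0%N 1%N (t, 0)) bc1 bv0 bt0.
  rewrite psiE ?lexx ?oo_cc// => h.
  have -> : v 0 * (rho 0 * Dc 0 1 (t, 0)) - w 0 * Dc 0 0 (t, 0) =
    rho 0 * (v 0 * D 0%N 1%N (t, 0) - w 0 / rho 0 * Dc 0 0 (t, 0)).
    by rewrite {1}/Dc c_id ?lexx ?oo_cc//; field.
  by rewrite h mulr0.
have Wpi : W pi = 0.
  have pI : 0 <= (pi : R) <= pi by rewrite lexx pi_ge0.
  rewrite /W clamp_id//; have r0 : rho pi != 0 by rewrite gt_eqF// rho0.
  have := @wronskian0 a2 b2 (v pi) (w pi / rho pi) (psi (t, pi)) (D 0%N 1%N (t, pi)) bc2 bvpi btpi.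
  rewrite psiE ?(oo_cc tI)// => h.
  have -> : v pi * (rho pi * Dc 0 1 (t, pi)) - w pi * Dc 0 0 (t, pi) =
    rho pi * (v pi * D 0%N 1%N (t, pi) - w pi / rho pi * Dc 0 0 (t, pi)).
    by rewrite {1}/Dc c_id ?(oo_cc tI)//; field.
  by rewrite h mulr0.
have cW : {within `[0, pi], continuous W}.
  apply: continuous_subspaceT => x; apply: cvgB.
    apply: cvgM; first exact: within_continuous_clamp.
    by apply: cvgM; [exact: within_continuous_clamp|exact: slice2].
  by apply: cvgM; [exact: within_continuous_clamp|exact: slice2].
have dW (x : R) : 0 < x < pi -> is_derive x 1 W (Bv (t, x) + Cv (t, x)).
  move=> xI; have [dv dw] := dvw x xI.
  have := drhoP x xI; have := Dc_x 0 1 tI xI; have := Dc_x 0 0 tI xI => ? ? ?.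
  have r0 : rho x != 0 by rewrite gt_eqF// rho0// oo_cc.
  apply: (@is_derive_near_eq _ (fun x => v x * (rho x * Dc 0 1 (t, x)) - w x * Dc 0 0 (t, x))).
    by have := near_in xI; apply: filterS => y yI; rewrite /W clamp_id ?oo_cc.
  apply: is_derive_eq.
  by rewrite /Bv /Cv /= clamp_id ?oo_cc// /GRing.scale /=; field.
rewrite (integral_oo_derive (pi_gt0 R) (slice2 cBC) cW dW).
by rewrite W0 Wpi subrr.
Qed.

Lemma stationary_weak_form :
  \int[leb2]_(z in Omega T) (v (clamp pi z.2) * wave_op rho psi z) -
  \int[leb2]_(z in Omega T) (nonlin mu p (v (clamp pi z.2)) * psi z * rho z.2) = 0.
Proof.
have Oin z : z \in Omega T -> 0 < z.1 < T /\ 0 < z.2 < pi.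
  by move=> /set_mem [/=]; rewrite !in_itv.
have -> : \int[leb2]_(z in Omega T) (v (clamp pi z.2) * wave_op rho psi z) =
    \int[leb2]_(z in Omega T) (Av z - Bv z).
  apply: eq_Rintegral => -[t x] /Oin [/= tI xI]; rewrite wave_opE//.
  by rewrite /Av /Bv /= !clamp_id ?oo_cc//; ring.
have -> : \int[leb2]_(z in Omega T) (nonlin mu p (v (clamp pi z.2)) * psi z * rho z.2) =
    \int[leb2]_(z in Omega T) Cv z.
  apply: eq_Rintegral => -[t x] /Oin [/= tI xI]; rewrite psiE ?oo_cc//.
  by rewrite /Cv /= !clamp_id ?oo_cc.
have mO := @measurable_Omega R T.
have cAB : continuous (fun z => Av z - Bv z).
  by move=> z; apply: cvgB; [exact: cAv|exact: cBv].
have cBC : continuous (fun z => Bv z + Cv z).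
  by move=> z; apply: cvgD; [exact: cBv|exact: cCv].
rewrite -RintegralB//; [|exact: integrable_Omega|exact: integrable_Omega].
have -> : \int[leb2]_(z in Omega T) (Av z - Bv z - Cv z) =
    \int[leb2]_(z in Omega T) (Av z - (Bv z + Cv z)).
  by apply: eq_Rintegral => z _; ring.
rewrite RintegralB//; [|exact: integrable_Omega|exact: integrable_Omega].
by rewrite intA intBC subrr.
Qed.

End weak_form.

(** * Small stationary weak solutions *)

(** The essential infimum being positive, [eta] agrees almost everywhere with its
    positive part. *)
Lemma eta_average_ge0 (R : realType) (rho drho ddrho : R -> R) :
  weight pi rho drho -> measurable_fun `]0, pi[ drho ->
  measurable_fun `]0, pi[ ddrho ->
  (0 < ess_inf_eta rho drho ddrho)%E -> 0 <= eta_average rho drho ddrho.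
Proof.
move=> [crho _ rho0 _] mdrho mddrho ei.
have pi0 : 0 <= pi :> R by exact: pi_ge0.
rewrite /eta_average mulr_ge0 ?divr_ge0//.
have minv : measurable_fun `]0, pi[ (fun x => (rho x)^-1).
  have ci : continuous (fun x => (rho (clamp pi x))^-1).
    move=> x; apply: cvgV; first by rewrite gt_eqF// rho0// clamp_bounds.
    exact: (within_continuous_clamp pi0 crho).
  apply: (@eq_measurable_fun _ _ _ _ _ (fun x => (rho (clamp pi x))^-1)).
    by move=> x /set_mem /=; rewrite in_itv /= => /andP[/ltW a /ltW b]; rewrite clamp_id// a.
  by apply: measurable_funS (continuous_measurable_fun ci).
have meta : measurable_fun `]0, pi[ (eta rho drho ddrho).
  apply: measurable_funB.
    by apply: measurable_funM => //; apply: measurable_funM.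
  apply: measurable_funM => //; apply: measurable_funX.
  exact: measurable_funM.
rewrite /Rintegral fine_ge0//.
have -> : (\int[lebesgue_measure]_(x in `]0%R, pi[) (eta rho drho ddrho x)%:E =
    \int[lebesgue_measure]_(x in `]0%R, pi[) (Num.max (eta rho drho ddrho x) 0)%:E)%E; last first.
  by apply: integral_ge0 => x _; rewrite lee_fin le_max lexx orbT.
apply: ae_eq_integral => //; first exact/measurable_EFinP.
  by apply/measurable_EFinP; exact: measurable_maxr.
have [N [mN N0 sub]] := @ess_inf_le _ _ _ (mrestr lebesgue_measure (measurable_itv `](0 : R), pi[))
    (EFin \o eta rho drho ddrho).
exists (N `&` `]0, pi[); split.
- by apply: measurableI.
- exact: N0.
- move=> x /= H; have [xI Hx] : `]0%R, pi[%classic x /\ ~ (0 <= eta rho drho ddrho x).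
    apply: contrapT => H2; apply: H => xI; apply/esym; rewrite max_l//.
    by apply: contrapT => h; apply: H2.
  split => //; apply: sub => /= h; apply: Hx.
  by rewrite -lee_fin; exact: le_trans (ltW ei) h.
Qed.

Section small_solutions.
Variables (R : realType) (mu p T a1 b1 a2 b2 : R) (rho drho : R -> R).
Hypotheses (mu0 : 0 < mu) (p0 : 0 < p) (p1 : p < 1) (T0 : 0 < T).
Hypotheses (bc1 : a1 ^+ 2 + b1 ^+ 2 != 0) (bc2 : a2 ^+ 2 + b2 ^+ 2 != 0).
Hypothesis Wrho : weight pi rho drho.
Hypothesis DN : (b1 = 0 /\ b2 != 0) \/ (b1 != 0 /\ b2 = 0).

Let pi_ge0 : 0 <= pi :> R. Proof. exact: pi_ge0. Qed.

Lemma small_stationary (delta : R) : 0 < delta -> exists v w : R -> R,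
  [/\ stationary mu p pi rho v w,
      a1 * v 0 + b1 * (w 0 / rho 0) = 0, a2 * v pi + b2 * (w pi / rho pi) = 0,
      forall x, 0 <= x <= pi -> `|v x| <= delta &
      exists2 x, 0 < x < pi & v x != 0].
Proof.
move=> d0; have [_ _ rho0 _] := Wrho.
have r0 : rho 0 != 0 by rewrite gt_eqF// rho0// lexx.
have rpi : rho pi != 0 by rewrite gt_eqF// rho0// lexx pi_ge0.
have [[b10 b20]|[b10 b20]] := DN.
- have [v [w [S v0 wpi vd nz]]] :=
    dirichlet_robin mu0 p0 p1 (pi_gt0 R) (a2 * rho pi / b2) Wrho d0.
  exists v, w; split=> //; first by rewrite v0 b10 mulr0 mul0r addr0.
  have -> : w pi = - (a2 * rho pi / b2 * v pi) by lra.
  by field; rewrite b20 rpi.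
- have [v [w [S w0 vpi vd nz]]] :=
    robin_dirichlet mu0 p0 p1 (pi_gt0 R) (- (a1 * rho 0 / b1)) Wrho d0.
  exists v, w; split=> //; last by rewrite vpi b20 mulr0 mul0r addr0.
  by rewrite w0; field; rewrite b10 r0.
Qed.

(** The power [p + 1] of the norm of [u] in the weighted Lebesgue space. *)
Definition weighted_norm (u : R * R -> R) : \bar R :=
  (\int[leb2]_(z in Omega T) ((`|u z| `^ (p + 1) * rho z.2)%:E))%E.

(** The amplitude bound [delta] is chosen so that [delta `^ (p + 1)] times the
    maximum of [rho] times the area of [Omega T] is [e / 2]. The norm is positive
    because [|v|] exceeds half of [|v x0|] on a strip around a point [x0] where [v]
    does not vanish. *)
Lemma small_weak_solution (e : R) : 0 < e -> exists u,
  [/\ weak_solution T rho a1 b1 a2 b2 mu p (p + 1) u,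
      (0 < weighted_norm u)%E & (weighted_norm u < e%:E)%E].
Proof.
move=> e0; have [crho _ rho0 _] := Wrho.
have [xM xMI xMP] := EVT_max pi_ge0 crho.
have [xm xmI xmP] := EVT_min pi_ge0 crho.
have M0 : 0 < rho xM by apply: rho0; rewrite in_itv in xMI.
have m0 : 0 < rho xm by apply: rho0; rewrite in_itv in xmI.
pose q := e / (2 * (rho xM * (T * pi))).
have Tpi : 0 < T * pi by rewrite mulr_gt0 ?pi_gt0.
have q0 : 0 < q by rewrite divr_gt0// mulr_gt0// mulr_gt0.
have p10 : 0 < p + 1 by rewrite addr_gt0.
pose delta := q `^ (p + 1)^-1.
have d0 : 0 < delta by rewrite powR_gt0.
have dE : delta `^ (p + 1) = q by rewrite -powRrM mulVf ?gt_eqF// powRr1// ltW.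
have [v [w [S bv0 bvpi vd [x0 x0I vx0]]]] := small_stationary d0.
have [cv _ _] := S.
pose vc := v \o clamp pi; pose rc := rho \o clamp pi.
have cvc : continuous vc by exact: within_continuous_clamp.
have crc : continuous rc by exact: within_continuous_clamp.
pose u (z : R * R) := vc z.2.
have cu : continuous u.
  move=> z; apply: (@continuous_comp _ _ _ (fun z : R * R => z.2) vc); first exact: cvg_snd.
  exact: cvc.
pose g (z : R * R) := `|u z| `^ (p + 1) * rc z.2.
have cg : continuous g.
  move=> z; apply: cvgM.
    apply: (@continuous_comp _ _ _ u (fun y : R => `|y| `^ (p + 1))); first exact: cu.
    exact: powR_norm_continuous.
  apply: (@continuous_comp _ _ _ (fun z : R * R => z.2) rc); first exact: cvg_snd.
  exact: crc.
have mO := @measurable_Omega R T.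
have rcb x : rho xm <= rc x <= rho xM by rewrite xmP ?xMP ?clamp_itv.
have Oin z : z \in Omega T -> 0 < z.1 < T /\ 0 < z.2 < pi.
  by move=> /set_mem [/=]; rewrite !in_itv.
have nE : weighted_norm u = (\int[leb2]_(z in Omega T) (g z)%:E)%E.
  apply: eq_integral => z /Oin[_ /andP[/ltW a /ltW b]].
  by rewrite /g /rc /= clamp_id// a.
have mg : measurable_fun (Omega T) (EFin \o g : RxR R -> \bar R).
  by apply/measurable_EFinP; apply: measurable_funS (continuous_measurable_prod cg).
have g0 z : 0 <= g z.
  by rewrite mulr_ge0 ?powR_ge0//; have /andP[h _] := rcb z.2; exact: le_trans (ltW m0) h.
have nlt : (weighted_norm u < e%:E)%E.
  rewrite nE; apply: (@le_lt_trans _ _ (\int[leb2]_(z in Omega T) (q * rho xM)%:E)%E).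
    apply: ge0_le_integral => //.
    - by move=> z _; rewrite lee_fin.
    - move=> z _; have /andP[h1 h2] := rcb z.2.
      rewrite lee_fin /g -dE; apply: ler_pM;
        [exact: powR_ge0|exact: le_trans (ltW m0) h1| |exact: h2].
      apply: ge0_ler_powR; rewrite ?nnegrE ?(ltW p10) ?(ltW d0)//.
      by apply: vd; exact: clamp_bounds.
  rewrite integral_cst// leb2_Omega// -EFinM lte_fin.
  have -> : q * rho xM * (T * pi) = e / 2.
    have alg (A B : R) : 0 < A -> 0 < B -> e / (2 * (B * A)) * B * A = e / 2.
      by move=> A0 B0; field; rewrite !gt_eqF.
    exact: alg.
  by lra.
have npos : (0 < weighted_norm u)%E.
  rewrite nE.
  have vx : v x0 = vc x0 by rewrite /vc /= clamp_id//; case/andP: x0I => /ltW -> /ltW ->.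
  pose c0 := `|v x0| / 2.
  have c00 : 0 < c0 by rewrite divr_gt0// normr_gt0.
  have cq : {for x0, continuous (fun x => `|vc x| - c0)}.
    by apply: cvgB; [apply: cvg_norm; exact: cvc|exact: cvg_cst].
  have [|d d_gt0 dP] := continuous_near_pos cq.
    have nv : 0 < `|v x0| by rewrite normr_gt0.
    by rewrite -vx /c0; lra.
  pose d' := Num.min d (Num.min x0 (pi - x0)).
  have /andP[x00 x0pi] := x0I.
  have d'0 : 0 < d' by rewrite !lt_min d_gt0 x00 subr_gt0.
  have d'd : d' <= d by rewrite !ge_min lexx.
  have d'x : d' <= x0 by rewrite !ge_min lexx !orbT.
  have d'p : d' <= pi - x0 by rewrite !ge_min lexx !orbT.
  pose B : set (RxR R) := `]0, T[ `*` `]x0 - d', x0 + d'[.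
  have mB : measurable B by apply: measurableX; exact: measurable_itv.
  have BO : B `<=` Omega T.
    by move=> z [z1 z2]; split => //; move: z2 => /=; rewrite !in_itv /=; lra.
  have leb2B : leb2 B = (T * (2 * d'))%:E.
    have -> : leb2 B = (@lebesgue_measure R `]0%R, T[ * @lebesgue_measure R `](x0 - d')%R, (x0 + d')%R[)%E.
      by apply: (@product_measure1E _ _ _ _ R lebesgue_measure lebesgue_measure); exact: measurable_itv.
    rewrite !lebesgue_measure_itv /= !lte_fin T0 ifT; last by lra.
    by rewrite -!EFinB -EFinM; congr (_%:E); ring.
  apply: (@lt_le_trans _ _ (\int[leb2]_(z in B) (c0 `^ (p + 1) * rho xm)%:E)%E).
    by rewrite integral_cst// leb2B -EFinM lte_fin !mulr_gt0// powR_gt0.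
  apply: (@le_trans _ _ (\int[leb2]_(z in B) (g z)%:E)%E).
    apply: ge0_le_integral => //.
    - by move=> z _; rewrite lee_fin mulr_ge0 ?powR_ge0// ltW.
    - exact: measurable_funS mg.
    - move=> z [_ /=]; rewrite in_itv /= => /andP[z1 z2].
      rewrite lee_fin ler_pM ?powR_ge0 ?(ltW m0)//; last by case/andP: (rcb z.2).
      apply: ge0_ler_powR; rewrite ?nnegrE ?(ltW p10) ?(ltW c00)//.
      apply/ltW; rewrite -subr_gt0; apply: dP; rewrite ler_norml; apply/andP; split; lra.
  by apply: ge0_subset_integral => // z _; rewrite lee_fin.
exists u; split=> //; split; first split.
- by apply: measurable_funS (continuous_measurable_prod cu).
- exact: lt_trans nlt (ltry _).
move=> psi [D [jet psi_bc psi_per]].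
have H := stationary_weak_form T0 bc1 bc2 Wrho S bv0 bvpi
  (nonlin_continuous mu0 p0) jet psi_bc psi_per.
exact H.
Qed.

(** Each solution is picked with a norm below that of its predecessor, so that
    the norms, and hence the solutions, are pairwise different. *)
Lemma weak_solution_sequence : exists u : nat -> R * R -> R,
  [/\ forall l, weak_solution T rho a1 b1 a2 b2 mu p (p + 1) (u l),
      forall l m, (l < m)%N -> (weighted_norm (u m) < weighted_norm (u l))%E &
      weighted_norm (u l) @[l --> \oo] --> 0%E].
Proof.
pose good e u := [/\ weak_solution T rho a1 b1 a2 b2 mu p (p + 1) u,
      (0 < weighted_norm u)%E & (weighted_norm u < e%:E)%E].
have /choice[pick pickP] : forall e : R, exists u, 0 < e -> good e u.
  move=> e; have [/small_weak_solution[u uP]|ne] := pselect (0 < e); first by exists u.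
  by exists (fun _ => 0).
pose next (n : nat) (e : R) := Num.min (n.+1%:R^-1) (fine (weighted_norm (pick e))).
pose eps := fix eps n : R := if n is n'.+1 then next n (eps n') else 1.
have eps0 n : 0 < eps n.
  elim: n => [|n IH]; first exact: ltr01.
  have [_ h1 h2] := pickP _ IH.
  rewrite /= /next lt_min invr_gt0 ltr0n /= fine_gt0// h1/=.
  exact: lt_trans h2 (ltry _).
have P n := pickP _ (eps0 n).
have epsn n : eps n <= n.+1%:R^-1.
  by case: n => [|n] /=; rewrite ?invr1// ge_min lexx.
have dec n : (weighted_norm (pick (eps n.+1)) < weighted_norm (pick (eps n)))%E.
  have [_ _ h] := P n.+1; have [_ h1 h2] := P n.
  apply: lt_le_trans h _; rewrite -[leRHS]fineK ?lee_fin /=.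
    by rewrite ge_min lexx orbT.
  by rewrite ge0_fin_numE ?(ltW h1)//; exact: lt_trans h2 (ltry _).
exists (fun n => pick (eps n)); split.
- by move=> l; have [] := P l.
- move=> l m; elim: m => [//|m IH]; rewrite ltnS leq_eqVlt => /predU1P[->|lm]; first exact: dec.
  exact: lt_trans (dec _) (IH lm).
apply: (@squeeze_cvge _ _ _ _ (fun _ => 0%E) _ (fun n => (n.+1%:R^-1)%:E)).
- near=> n; have [_ h1 h2] := P n; rewrite (ltW h1)/=.
  by apply: le_trans (ltW h2) _; rewrite lee_fin.
- exact: cvg_cst.
- by apply/cvg_EFin; [near=> n|exact: cvg_harmonic].
Unshelve. all: by end_near. Qed.

Lemma ae_eq_weighted_norm u u' :
  weighted_Lr T rho (p + 1) u -> weighted_Lr T rho (p + 1) u' ->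
  {ae leb2, forall z, Omega T z -> u z = u' z} ->
  weighted_norm u = weighted_norm u'.
Proof.
move=> [mu_ _] [mu'_ _] ae; have [crho _ _ _] := Wrho.
have m1 w : measurable_fun (Omega T) (w : RxR R -> R) ->
    measurable_fun (Omega T) (fun z : RxR R => (`|w z| `^ (p + 1) * rho z.2)%:E).
  move=> mw; apply/measurable_EFinP; apply: measurable_funM.
    apply: (@measurableT_comp _ _ _ _ _ _ (fun y : R => `|y| `^ (p + 1))) => //.
    by apply: continuous_measurable_fun; apply: powR_norm_continuous; rewrite addr_gt0.
  apply: (@eq_measurable_fun _ _ _ _ _ (fun z : RxR R => rho (clamp pi z.2))).
    move=> z /set_mem [_ /=]; rewrite in_itv /= => /andP[/ltW a /ltW b].
    by rewrite clamp_id// a.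
  apply: measurable_funS (continuous_measurable_prod _) => //.
  move=> z; apply: (@continuous_comp _ _ _ (fun z : R * R => z.2) (rho \o clamp pi)).
    exact: cvg_snd.
  exact: within_continuous_clamp.
apply: ae_eq_integral; [exact: measurable_Omega|exact: m1|exact: m1|].
have [N [mN N0 sub]] := ae; exists N; split=> // z /= h; apply: sub => /= H.
by apply: h => Oz; rewrite H.
Qed.

End small_solutions.

Unset Implicit Arguments.

Theorem theorem2p2 (R : realType) (a b : nat) (T : R)
    (a1 b1 a2 b2 : R) (rho drho ddrho : R -> R) (beta0 p mu : R)
    (ha : (0 < a)%N) (hb : (0 < b)%N) (hab : coprime a b)
    (hT : T = 2 * pi * a%:R / b%:R)
    (hbc1 : a1 ^+ 2 + b1 ^+ 2 != 0) (hbc2 : a2 ^+ 2 + b2 ^+ 2 != 0)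
    (hrho : sobolev_H2 0 pi rho drho ddrho)
    (hrho_bd : forall x : R, x \in `[0, pi] -> 0 < rho x <= beta0)
    (heta : (0 < ess_inf_eta rho drho ddrho)%E)
    (hp : 0 < p < 1)
    (hDN : [/\ 0 < alpha1 a1 b1 rho drho, beta1 b1 = 0,
               alpha2 a2 b2 rho drho = 0 & 0 < beta2 b2] \/
           [/\ alpha1 a1 b1 rho drho = 0, 0 < beta1 b1,
               0 < alpha2 a2 b2 rho drho & beta2 b2 = 0])
    (hmuL : ~ Lambda T rho a1 b1 a2 b2 mu)
    (hmu : eta_average rho drho ddrho < mu) :
  exists u : nat -> R * R -> R,
    [/\ forall l : nat, weak_solution T rho a1 b1 a2 b2 mu p (p + 1) (u l),
        forall l m : nat, l <> m ->
          ~ {ae leb2, forall z, Omega T z -> u l z = u m z} &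
        (\int[leb2]_(z in Omega T) ((`|u l z| `^ (p + 1) * rho z.2)%:E))%E
          @[l --> \oo] --> 0%E].
Proof.
have [[_ [mdrho _] [mddrho _]] wd1 _ crho cdrho] := hrho.
have [p0 p1] := andP hp.
have Wrho : weight pi rho drho.
  split=> // [x xI|x xI]; last exact: weak_derivative_is_derive (pi_gt0 R) crho cdrho wd1 x xI.
  by have /andP[] : 0 < rho x <= beta0 by apply: hrho_bd; rewrite in_itv.
have mu0 : 0 < mu by apply: le_lt_trans hmu; exact: eta_average_ge0.
have T0 : 0 < T by rewrite hT divr_gt0 ?mulr_gt0 ?pi_gt0 ?ltr0n.
have DN : (b1 = 0 /\ b2 != 0) \/ (b1 != 0 /\ b2 = 0).
  case: hDN => [[_ /eqP + _ b20]|[_ + _ b20]].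
    by rewrite /beta1 oppr_eq0 => /eqP b10; left; split=> //; rewrite gt_eqF.
  by rewrite /beta1 oppr_gt0 => b10; right; split=> //; rewrite lt_eqF.
have [u [us dec cvgu]] :=
  weak_solution_sequence mu0 p0 p1 T0 hbc1 hbc2 Wrho DN.
exists u; split=> // l m /eqP lm ae.
have := ae_eq_weighted_norm p0 Wrho (us l).1 (us m).1 ae.
by move: lm; rewrite neq_ltn => /orP[] /dec + e; rewrite e ltxx.
Qed.
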